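(* Let $\delta\in\mathbb{Z}$ and $\lambda$ satisfy $\lambda\pm\delta\in2\mathbb{Z}$, $\lambda+\delta\neq0$ and $\lambda-\delta\neq0$. The $(\mathfrak{g},K)$-module $I(\chi_{\delta,\lambda})$ of $SU(2,1)$ has the following composition series, where for a condition $C$ on $(k,l)$ we write $\{C\}$ for the subspace $\bigoplus_{(k,l)\in L,\ C}\tau^{(\frac k2,\,-\delta+\frac{3l}{2})}$. (I$_1$) If $\lambda-\delta\ge2$ and $\lambda+\delta\ge2$: there are submodules $V_{\mathbb{H}}\subset V_1\subset I(\chi_{\delta,\lambda})$ with $V_{\mathbb{H}}=U(\mathfrak{g})\tau^{(\frac\lambda2,\frac\delta2)}=\{k-l\ge\lambda-\delta,\ k+l\ge\lambda+\delta\}$, $V_1=U(\mathfrak{g})\tau^{(\frac{\lambda+\delta}4,\frac{3\lambda-\delta}4)}+U(\mathfrak{g})\tau^{(\frac{\lambda-\delta}4,\frac{-3\lambda-\delta}4)}$, $V_1/V_{\mathbb{H}}\cong Q_-\oplus Q_+$ and $I(\chi_{\delta,\lambda})/V_1\cong V_{\mathrm{fin}}$, where $Q_\pm$ have the $K$-types of $\{k\mp l<\lambda\mp\delta,\ k\pm l\ge\lambda\pm\delta\}$ and $V_{\mathrm{fin}}$ those of $\{k+l<\lambda+\delta,\ k-l<\lambda-\delta\}$. The modules $V_{\mathbb{H}},Q_+,Q_-,V_{\mathrm{fin}}$ are irreducible. (II$_1$) If $\lambda>0$ and $\lambda-\delta\le-2$: $V_{\mathbb{H}}=U(\mathfrak{g})\tau^{(\frac{\lambda+\delta}4,\frac{3\lambda-\delta}4)}=\{k+l\ge\lambda+\delta\}$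 and $V_{\mathrm{disc}-}=U(\mathfrak{g})\tau^{(0,-\delta)}=\{k+l<-\lambda+\delta\}$ are submodules, and $I(\chi_{\delta,\lambda})/(V_{\mathbb{H}}\oplus V_{\mathrm{disc}-})\cong Q_-$ has the $K$-types of $\{-\lambda+\delta\le k+l<\lambda+\delta\}$. The modules $V_{\mathbb{H}},V_{\mathrm{disc}-},Q_-$ are irreducible. (II$_2$) If $\lambda<0$ and $\lambda+\delta\ge2$: $Q_-=U(\mathfrak{g})\tau^{(\frac{\lambda+\delta}4,\frac{3\lambda-\delta}4)}=\{\lambda+\delta\le k+l<-\lambda+\delta\}$ is a submodule, and $I(\chi_{\delta,\lambda})/Q_-\cong V_{\mathbb{H}}\oplus V_{\mathrm{disc}-}$, where $V_{\mathbb{H}}$ has the $K$-types of $\{k+l\ge-\lambda+\delta\}$ and $V_{\mathrm{disc}-}$ those of $\{k+l<\lambda+\delta\}$. The modules $Q_-,V_{\mathbb{H}},V_{\mathrm{disc}-}$ are irreducible. (I$_2$) If $\lambda-\delta\le-2$ and $\lambda+\delta\le-2$: there are submodules $V_{\mathrm{fin}}\subset V_1\subset I(\chi_{\delta,\lambda})$ with $V_{\mathrm{fin}}=U(\mathfrak{g})\tau^{(0,-\delta)}=\{k+l<-\lambda+\delta,\ k-l<-\lambda-\delta\}$, $V_1=U(\mathfrak{g})\tau^{(\frac{-\lambda+\delta}4,\frac{-3\lambda-\delta}4)}+U(\mathfrak{g})\tau^{(\frac{-\lambda-\delta}4,\frac{3\lambda-\delta}4)}$, $V_1/V_{\mathrm{fin}}\cong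 Q_-\oplus Q_+$ and $I(\chi_{\delta,\lambda})/V_1\cong V_{\mathbb{H}}$, where $Q_\pm$ have the $K$-types of $\{k\mp l<-\lambda\mp\delta,\ k\pm l\ge-\lambda\pm\delta\}$ and $V_{\mathbb{H}}$ those of $\{k+l\ge-\lambda+\delta,\ k-l\ge-\lambda-\delta\}$. The modules $V_{\mathrm{fin}},Q_+,Q_-,V_{\mathbb{H}}$ are irreducible. (III$_1$) If $\lambda>0$ and $\lambda+\delta\le-2$: $V_{\mathrm{disc}+}=U(\mathfrak{g})\tau^{(0,-\delta)}=\{k-l<-\lambda-\delta\}$ and $V_{\mathbb{H}}=U(\mathfrak{g})\tau^{(\frac{\lambda-\delta}4,\frac{-3\lambda-\delta}4)}=\{k-l\ge\lambda-\delta\}$ are submodules, and $I(\chi_{\delta,\lambda})/(V_{\mathbb{H}}\oplus V_{\mathrm{disc}+})\cong Q_+$ has the $K$-types of $\{-\lambda-\delta\le k-l<\lambda-\delta\}$. The modules $V_{\mathrm{disc}+},V_{\mathbb{H}},Q_+$ are irreducible. (III$_2$) If $\lambda<0$ and $\lambda-\delta\ge2$: $Q_+=U(\mathfrak{g})\tau^{(\frac{\lambda-\delta}4,\frac{-3\lambda-\delta}4)}=\{\lambda-\delta\le k-l<-\lambda-\delta\}$ is a submodule, and $I(\chi_{\delta,\lambda})/Q_+\cong V_{\mathbb{H}}\oplus V_{\mathrm{disc}+}$, where $V_{\mathbb{H}}$ has the $K$-types of $\{k-l\ge-\lambda-\delta\}$ and $V_{\mathrm{disc}+}$ those of $\{k-l<\lambda-\delta\}$.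 The modules $Q_+,V_{\mathbb{H}},V_{\mathrm{disc}+}$ are irreducible.
   Context: **Group.** $G=SU(2,1)=\{g\in SL(3,\mathbb{C}) : \bar g^{t}Jg=J\}$ with $J=\mathrm{diag}(1,1,-1)$, Lie algebra $\mathfrak{g}$; $U(\mathfrak{g})$ denotes the universal enveloping algebra of the complexification of $\mathfrak{g}$. The maximal compact subgroup is $K=\{\mathrm{diag}(A,\det(A)^{-1}) : A\in U(2)\}\cong U(2)$. Let $E_{ab}$ be the matrix units, $U_0=\frac12\mathrm{diag}(i,i,-2i)$, $U_3=\frac12\mathrm{diag}(i,-i,0)$, and $N$ the analytic subgroup with Lie algebra $$\left\{\begin{pmatrix} iw&z&-iw\\-\bar z&0&\bar z\\ iw&z&-iw\end{pmatrix} : z\in\mathbb{C},\,w\in\mathbb{R}\right\}.$$ **Principal series.** $I(\chi_{\delta,\lambda})$ is the space of smooth $K$-finite functions $f:G\to\mathbb{C}$ with $$f\left(g\,e^{-t(U_0-3U_3)}e^{s(E_{13}+E_{31})}n\right)=e^{-i\delta t-(\lambda+2)s}f(g)\qquad(t,s\in\mathbb{R},\ n\in N),$$ a $(\mathfrak{g},K)$-module under left translation. Functions are identified with their restrictions to $K$. **$K$-types.** For $j\in\frac12\mathbb{Z}_{\ge0}$, $n\in\frac12\mathbb{Z}$ with $j+n\in\mathbb{Z}$, let $\pi_{j,n}$ be the irreducible representation of $U(2)$ on homogeneous polynomials of degree $2j$ in $z=(z_1,z_2)^t$ given by $\pi_{j,n}(g)f(z)=(\det g)^{j+n}f(g^{-1}z)$.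 It has basis $v^j_m=\frac{z_1^{j-m}z_2^{j+m}}{\sqrt{(j-m)!(j+m)!}}$, $m\in\{-j,\dots,j\}$, declared orthonormal for a Hermitian inner product $\langle\cdot,\cdot\rangle$, linear in the first and conjugate linear in the second argument. Put $W^{(j,n)}_{m_1,m_2}(k)=\langle v^j_{m_1},\pi_{j,n}(k)v^j_{m_2}\rangle$, $k\in K\cong U(2)$. The functions $W^{(j,n)}_{m_1,m_2}$ with $-n+3m_2=\delta$ form a basis of $I(\chi_{\delta,\lambda})$. The $K$-isotypic subspaces of $I(\chi_{\delta,\lambda})$ are $\tau^{(j,n)}=\bigoplus_{m_1\in\{-j,\dots,j\}}\mathbb{C}W^{(j,n)}_{m_1,m_2}$ with $m_2=\frac{n+\delta}3\in\{-j,-j+1,\dots,j\}$; each is an irreducible $K$-module occurring with multiplicity one. They are parametrized by $$L=\{(k,l)\in\mathbb{Z}_{\ge0}\times\mathbb{Z} : -k\le l\le k,\ k\equiv l \bmod 2\}$$ through $j=\frac k2$, $n=-\delta+\frac{3l}2$. A subquotient ''has the $K$-types of $\{C\}$'' if it is isomorphic as a $K$-module to $\{C\}$, the image of $\{C\}$ in that subquotient being the whole subquotient. The symbols $V_{\mathbb{H}},V_{\mathrm{fin}},V_{\mathrm{disc}\pm},Q_\pm$ are used separately in each case as names for the subquotients described there (the paper calls $V_{\mathbb{H}}$ the quaternionic discrete series, $V_{\mathrm{disc}\pm}$ the holomorphic/antiholomorphic discrete series and $V_{\mathrm{fin}}$ the finite dimensional representation). *)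

(* Defs.v *)
From HB Require Import structures.
From mathcomp Require Import all_boot all_order all_algebra.
From mathcomp Require Import complex.
From mathcomp Require Import all_classical all_reals all_analysis.

Set Implicit Arguments.
Unset Strict Implicit.
Unset Printing Implicit Defensive.

Import Order.TTheory GRing.Theory Num.Theory.
Import numFieldNormedType.Exports.

Local Open Scope classical_set_scope.
Local Open Scope complex_scope.
Local Open Scope ring_scope.

Section SU21.
Variable R : realType.
Local Notation C := R[i].
Local Notation M3 := 'M[R[i]]_3.

Definition adjmx (n : nat) (A : 'M[C]_n) : 'M[C]_n := (map_mx Num.conj A)^T.

Definition mx3 (s : seq (seq C)) : M3 := \matrix_(a, b) (nth [::] s a)`_b.

Definition diag3 (x y z : C) : M3 := diag_mx (\row_b [:: x; y; z]`_b).

Definition matJ : M3 := diag3 1 1 (-1).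

Definition SU21 : set M3 :=
  [set g | adjmx g *m matJ *m g = matJ /\ \det g = 1].

Definition su21 : set M3 :=
  [set X | adjmx X *m matJ + matJ *m X = 0 /\ \tr X = 0].

Definition U2 : set 'M[C]_2 := [set A | adjmx A *m A = 1%:M].

Definition Kemb (A : 'M[C]_2) : M3 := block_mx A 0 0 ((\det A)^-1)%:M.

Definition K : set M3 := Kemb @` U2.

Definition clim (u : nat -> C) : C :=
  lim ((fun n => complex.Re (u n)) @ \oo) +i*
  lim ((fun n => complex.Im (u n)) @ \oo).

Definition expmx (X : M3) : M3 := \matrix_(a, b)
  clim (fun n => \sum_(0 <= k < n) (k`!%:R)^-1 * (X ^+ k) a b).

Definition matU0 : M3 := 2^-1 *: diag3 'i%C 'i%C (- 2 * 'i%C).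
Definition matU3 : M3 := 2^-1 *: diag3 'i%C (- 'i%C) 0.
Definition matH : M3 := delta_mx 0 2 + delta_mx 2 0.

Definition lieN : set M3 := [set X | exists (z : C) (w : R),
  let iw := 'i%C * w%:C in
  X = mx3 [:: [:: iw;          z; - iw];
              [:: - Num.conj z; 0; Num.conj z];
              [:: iw;          z; - iw]] ].

(* The analytic subgroup with Lie algebra [lieN]: it is generated by the
   exponentials of [lieN], which are stable under inversion. *)
Definition groupN : set M3 := [set n | exists s : seq M3,
  (forall X, X \in s -> lieN X) /\ n = \prod_(X <- s) expmx X].

Definition cexp (z : C) : C :=
  (expR (complex.Re z))%:C *
  (cos (complex.Im z) +i* sin (complex.Im z)).

Fixpoint Cn_on (V W : normedModType R) (n : nat) (U : set V) (F : V -> W) :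
    Prop :=
  match n with
  | 0 => forall x, U x -> {for x, continuous F}
  | n'.+1 => (forall x, U x -> differentiable F x) /\
             forall v, Cn_on n' U ('D_v F)
  end.

Definition Cinfty_on (V W : normedModType R) (U : set V) (F : V -> W) : Prop :=
  forall n, Cn_on n U F.

Definition cmx (P : ('M[R]_3 * 'M[R]_3)%type) : M3 :=
  \matrix_(a, b) (P.1 a b +i* P.2 a b).

(* A function on the closed submanifold SU(2,1) of M_3(C) is smooth iff it
   extends locally to smooth functions on open subsets of M_3(C). *)
Definition smoothG (f : M3 -> C) : Prop :=
  forall P, SU21 (cmx P) ->
  exists (U : set ('M[R]_3 * 'M[R]_3)%type) (F1 F2 : 'M[R]_3 * 'M[R]_3 -> R),
  [/\ open U, U P, Cinfty_on U F1, Cinfty_on U F2 &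
      forall Q, U Q -> SU21 (cmx Q) -> f (cmx Q) = F1 Q +i* F2 Q].

(* A function on SU(2,1) is represented by its extension by zero to M_3(C), so
   that equality of functions on the group is equality in [funG]; the actions
   below preserve the functions vanishing outside of the group. *)
Definition funG := M3 -> C.

Definition Kact (k : M3) (f : funG) : funG := fun g => f (invmx k *m g).

(* (X f)(g) = d/dt f(exp(-tX) g) at t = 0, for X in the real Lie algebra. *)
Definition lieact (X : M3) (f : funG) : funG := fun g =>
  derive1 (fun t : R => complex.Re (f (expmx (- t%:C *: X) *m g))) 0 +i*
  derive1 (fun t : R => complex.Im (f (expmx (- t%:C *: X) *m g))) 0.

Definition zeroF : set funG := [set fun=> 0].

Definition cspan (S : set funG) : set funG := [set f |
  exists (m : nat) (c : 'I_m -> C) (b : 'I_m -> funG),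
  (forall i, S (b i)) /\ f = fun g => \sum_(i < m) c i * b i g].

Definition sumF (A B : set funG) : set funG :=
  [set f | exists a b, [/\ A a, B b & f = fun g => a g + b g]].

Definition Kfinite (f : funG) : Prop :=
  exists (m : nat) (b : 'I_m -> funG), forall k, K k ->
  cspan (range b) (Kact k f).

(* U(g) S: the complex span of all X_1 ... X_r f with f in S and X_i in the real
   Lie algebra, whose products span the enveloping algebra of the
   complexification. *)
Definition Ug (S : set funG) : set funG := cspan [set f |
  exists (s : seq M3) (h : funG),
  [/\ forall X, X \in s -> su21 X, S h & f = foldr lieact h s]].

Definition princ (delta : int) (lambda : C) : set funG := [set f | [/\
  forall g, ~ SU21 g -> f g = 0,
  smoothG f,
  Kfinite f &
  forall (g : M3) (t s : R) (n : M3), SU21 g -> groupN n ->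
    f (g *m expmx (- t%:C *: (matU0 - 3 *: matU3))
         *m expmx (s%:C *: matH) *m n)
    = cexp (- 'i%C * delta%:~R * t%:C - (lambda + 2) * s%:C) * f g]].

(* Polynomials in z = (z_1, z_2)^t are represented by polynomial functions, and
   the half-integers j, n, m by rationals; [Num.truncn] and [Num.floor] only
   convert the integral rationals 2j, j - m, j + m, j + n to integers. *)

Definition dimpi (j : rat) : nat := (Num.truncn (2 * j)).+1.

Definition vpol (j m : rat) (z : 'cV[C]_2) : C :=
  let a := Num.truncn (j - m) in let b := Num.truncn (j + m) in
  z 0 0 ^+ a * z 1 0 ^+ b / sqrtC (a`! * b`!)%:R.

Definition wt (j : rat) (i : 'I_(dimpi j)) : rat := i%:R - j.

Definition pirep (j n : rat) (A : 'M[C]_2) (f : 'cV[C]_2 -> C) :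
    'cV[C]_2 -> C :=
  fun z => (\det A) ^ (Num.floor (j + n)) * f (invmx A *m z).

(* Coordinates of a homogeneous polynomial of degree 2j in the basis of the
   v^j_m. *)
Definition vcoord (j : rat) (f : 'cV[C]_2 -> C) : 'rV[C]_(dimpi j) :=
  xget 0 [set c : 'rV[C]_(dimpi j) |
            f = fun z => \sum_i c 0 i * vpol j (wt i) z].

(* The Hermitian inner product for which the v^j_m are orthonormal. *)
Definition hprod (j : rat) (f h : 'cV[C]_2 -> C) : C :=
  \sum_i vcoord j f 0 i * Num.conj (vcoord j h 0 i).

Definition Wfun (j n m1 m2 : rat) (A : 'M[C]_2) : C :=
  hprod j (vpol j m1) (pirep j n A (vpol j m2)).

Section PrincipalSeries.
Variables (delta : int) (lambda : C).

(* tau^(j,n), as a subspace of the principal series through restriction to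
   K = U(2). *)
Definition tau (j n : rat) : set funG := [set f |
  princ delta lambda f /\
  exists c : 'I_(dimpi j) -> C, forall A, U2 A ->
    f (Kemb A) = \sum_i c i * Wfun j n (wt i) ((n + delta%:~R) / 3) A].

Definition inL (k l : int) : Prop :=
  [/\ 0 <= k, - k <= l, l <= k & (k = l %[mod 2])%Z].

(* The subspace {P} spanned by the K-types (k,l) in L satisfying P. *)
Definition ktypes (P : int -> int -> bool) : set funG := cspan [set f |
  exists k l : int, [/\ inL k l, P k l &
    tau (k%:Q / 2) (- delta%:Q + 3 * l%:Q / 2) f]].

Definition submodule (V : set funG) : Prop := [/\
  V `<=` princ delta lambda,
  V (fun=> 0),
  (forall (c : C) f h, V f -> V h -> V (fun g => c * f g + h g)),
  (forall X f, su21 X -> V f -> V (lieact X f)) &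
  (forall k f, K k -> V f -> V (Kact k f))].

(* A pair (A, B) of subspaces stands for the subquotient A / B. *)
Definition subquotient (A B : set funG) : Prop :=
  [/\ submodule A, submodule B & B `<=` A].

(* The submodules of A / B are the V / B with B <= V <= A. *)
Definition irreducible (A B : set funG) : Prop :=
  [/\ subquotient A B, A <> B &
      forall V, submodule V -> B `<=` V -> V `<=` A -> V = B \/ V = A].

(* A1 / B1 and A2 / B2 are isomorphic K-modules, by an isomorphism lifted to a
   map phi from A1 to A2. *)
Definition Kiso (A1 B1 A2 B2 : set funG) : Prop := exists phi : funG -> funG,
  let eq2 f h := B2 (fun g => f g - h g) in
  [/\ forall f, A1 f -> A2 (phi f),
      forall (c : C) f h, A1 f -> A1 h ->
        eq2 (phi (fun g => c * f g + h g)) (fun g => c * phi f g + phi h g),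
      forall k f, K k -> A1 f -> eq2 (phi (Kact k f)) (Kact k (phi f)),
      forall f, A1 f -> (B2 (phi f) <-> B1 f) &
      forall h, A2 h -> exists2 f, A1 f & eq2 (phi f) h].

Definition has_Ktypes (A B : set funG) (P : int -> int -> bool) : Prop := [/\
  subquotient A B,
  ktypes P `<=` A,
  (forall f, A f -> exists2 h, ktypes P h & B (fun g => f g - h g)) &
  Kiso (ktypes P) zeroF A B].

(* A / B is the direct sum of its submodules A1 / B and A2 / B. *)
Definition dsum_quo (A B A1 A2 : set funG) : Prop := [/\
  subquotient A B, subquotient A1 B, subquotient A2 B,
  A1 `&` A2 = B & sumF A1 A2 = A].

End PrincipalSeries.
End SU21.

(* Main.v *)
(** The group acts transitively on the null cone |u_1|^2 + |u_2|^2 = |u_3|^2, and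
    N fixes v_0 = (1, 0, 1), so elements of the principal series are functions of
    u = g v_0 homogeneous under u -> z u.  Put lambda + delta = 2B and
    lambda - delta = 2A.  The coefficients in X of
      u_3^-(B+1+a) conj(u_3)^-(A+1+b) (u_1 + u_2 X)^a (- conj(u_2) + conj(u_1) X)^b
    form a basis of the K-type k = a + b, l = b - a.  The noncompact matrix units
    map it to its four neighbours (a -+ 1, b), (a, b -+ 1), with coefficients
    a - A and b - B for the decreasing steps and B + 1 + a, A + 1 + b for the
    increasing ones, so the submodules correspond to the sets of labels (a, b)
    closed under the steps whose coefficient does not vanish.

    That the principal series contains nothing else is a statement about
    functions on the sphere S^3: the U(2)-translates of a K-finite function span
    a finite-dimensional space, on which every circle subgroup acts by characters
    t -> e^{int}.  Three circles show that the function is a Laurent polynomial in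
    polar coordinates, hence becomes a polynomial after multiplication by a power
    of |xy|^2; the same holds for its translates, and
      |xy|^2 + |x^2 - y^2|^2 / 4 + |x^2 + y^2|^2 / 4 = 1/2
    on the sphere, so the function itself is a polynomial. *)

Require Import Defs.
From mathcomp Require Import all_boot all_order all_algebra.
From mathcomp Require Import complex ring lra zify.
From mathcomp Require Import all_classical all_reals all_analysis.
Set Implicit Arguments.
Unset Strict Implicit.
Unset Printing Implicit Defensive.
Import Order.TTheory GRing.Theory Num.Theory.
Import numFieldNormedType.Exports.
Local Open Scope classical_set_scope.
Local Open Scope ring_scope.

(** * Complex-valued curves and the complex exponential *)

(** The pairs (u_1, u_2) and (- conj u_2, conj u_1) transform alike under SU(2), so the coefficients
    in X of a product of powers of the two linear forms span an irreducible space of binary forms;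
    this explicit basis replaces an abstract theory of K-types. Irreducibility quantifies over all
    submodules of the principal series, so nothing follows until every function in it is known to be
    a combination of that basis; the argument on the sphere stands in for the Peter-Weyl theorem.
    The polar coordinates used there are redundant, (s, r) and (-s, -r) giving the same point, and
    this symmetry removes the monomials of odd parity, which cannot be written through x and conj x.
    Clearing denominators with |xy|^2 alone leaves possible poles on the two circles xy = 0; the
    zero sets of xy and of its two rotated copies have no common point. The factors a - A and b - B
    appear when the derivative of the power of u_3 is added to the Leibniz term and |u_1|^2 +
    |u_2|^2 is replaced by |u_3|^2. As A and B are integers, each case then becomes linear integer
    arithmetic. *)

Section ComplexCalculus.
Variable R : realType.
Local Notation C := R[i].
Local Notation Re := complex.Re.
Local Notation Im := complex.Im.
Implicit Types (z w : C) (f g : R -> C).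

Lemma conjE z : z^* = Complex (Re z) (- Im z).
Proof. by case: z. Qed.

Lemma cReM z w : Re (z * w) = Re z * Re w - Im z * Im w.
Proof. by case: z; case: w. Qed.

Lemma cImM z w : Im (z * w) = Re z * Im w + Im z * Re w.
Proof. by case: z; case: w => *; rewrite /= addrC. Qed.

Lemma cReD z w : Re (z + w) = Re z + Re w. Proof. by case: z; case: w. Qed.
Lemma cImD z w : Im (z + w) = Im z + Im w. Proof. by case: z; case: w. Qed.
Lemma cReN z : Re (- z) = - Re z. Proof. by case: z. Qed.
Lemma cImN z : Im (- z) = - Im z. Proof. by case: z. Qed.

Lemma complexP z w : Re z = Re w -> Im z = Im w -> z = w.
Proof. by case: z; case: w => /= ? ? ? ? -> ->. Qed.

(** Derivatives of complex-valued curves are recorded on real and imaginary parts, the form in which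
    [lieact] takes them. *)
Definition cder f (t : R) (d : C) :=
  is_derive t 1 (fun x => Re (f x)) (Re d) /\
  is_derive t 1 (fun x => Im (f x)) (Im d).

Lemma cder_eq f t d d' : cder f t d -> d = d' -> cder f t d'.
Proof. by move=> ? <-. Qed.

Lemma cder_ext f g t d : cder f t d -> f =1 g -> cder g t d.
Proof. by move=> + /funext <-. Qed.

Lemma cder_cst z t : cder (fun=> z) t 0.
Proof. by split; exact: is_derive_cst. Qed.

Lemma cderD f g t d e : cder f t d -> cder g t e ->
  cder (fun x => f x + g x) t (d + e).
Proof.
move=> [f1 f2] [g1 g2]; split.
  rewrite cReD (_ : (fun x => _) = (fun x => Re (f x)) + (fun x => Re (g x))).
    exact: is_deriveD.
  by apply/funext => x; rewrite cReD.
rewrite cImD (_ : (fun x => _) = (fun x => Im (f x)) + (fun x => Im (g x))).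
  exact: is_deriveD.
by apply/funext => x; rewrite cImD.
Qed.

Lemma cderM f g t d e : cder f t d -> cder g t e ->
  cder (fun x => f x * g x) t (d * g t + f t * e).
Proof.
move=> [f1 f2] [g1 g2]; split.
  rewrite (_ : (fun x => _) = (fun x => Re (f x)) * (fun x => Re (g x))
     - (fun x => Im (f x)) * (fun x => Im (g x))).
    apply: (is_derive_eq (is_deriveB (is_deriveM f1 g1) (is_deriveM f2 g2))).
    by rewrite cReD !cReM /GRing.scale /=; ring.
  by apply/funext => x; rewrite cReM.
rewrite (_ : (fun x => _) = (fun x => Re (f x)) * (fun x => Im (g x))
     + (fun x => Im (f x)) * (fun x => Re (g x))).
  apply: (is_derive_eq (is_deriveD (is_deriveM f1 g2) (is_deriveM f2 g1))).
  by rewrite cImD !cImM /GRing.scale /=; ring.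
by apply/funext => x; rewrite cImM.
Qed.

Lemma cder_conj f t d : cder f t d -> cder (fun x => (f x)^*) t d^*.
Proof.
move=> [f1 f2]; split.
  rewrite conjE /= (_ : (fun x => _) = (fun x => Re (f x))) //.
  by apply/funext => x; rewrite conjE.
rewrite conjE /= (_ : (fun x => _) = - (fun x => Im (f x))).
  exact: is_deriveN.
by apply/funext => x; rewrite conjE.
Qed.

Lemma cderZ z f t d : cder f t d -> cder (fun x => z * f x) t (z * d).
Proof.
move=> fd; apply: cder_eq; first exact: (cderM (cder_cst z t) fd).
by rewrite mul0r add0r.
Qed.

Lemma cderX f t d n : cder f t d ->
  cder (fun x => f x ^+ n) t (n%:R * f t ^+ n.-1 * d).
Proof.
move=> fd; elim: n => [|n IH].
  by rewrite !mul0r; exact: cder_cst.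
apply: (@cder_ext (fun x => f x * f x ^+ n)).
  apply: cder_eq; first exact: (cderM fd IH).
  case: n {IH} => [|n]; first by rewrite /= !expr0; ring.
  by rewrite /= exprS -[n.+2]addn1 natrD; ring.
by move=> x; rewrite exprS.
Qed.

Lemma cder_sum (I : Type) (s : seq I) (F : I -> R -> C) (D : I -> C) t :
  (forall i, cder (F i) t (D i)) ->
  cder (fun x => \sum_(i <- s) F i x) t (\sum_(i <- s) D i).
Proof.
move=> FD; elim: s => [|i s IH].
  rewrite big_nil; apply: (@cder_ext (fun=> 0)); first exact: cder_cst.
  by move=> x; rewrite big_nil.
rewrite big_cons; apply: (@cder_ext (fun x => F i x + \sum_(i <- s) F i x)).
  exact: cderD.
by move=> x; rewrite big_cons.
Qed.

Lemma cder_real (h : R -> R) (t d : R) :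
  is_derive t 1 h d -> cder (fun x => (h x)%:C%C) t d%:C%C.
Proof. by move=> hd; split => //=; exact: is_derive_cst. Qed.

(** Writing 1/f as conj f / |f|^2 leaves only the reciprocal of a real function to differentiate. *)
Lemma cderV f t d : f t != 0 -> cder f t d ->
  cder (fun x => (f x)^-1) t (- d / f t ^+ 2).
Proof.
move=> f0 fd; pose h x := Re (f x) ^+ 2 + Im (f x) ^+ 2.
have hE x : (h x)%:C%C = f x * (f x)^*.
  apply: complexP; rewrite ?cReM ?cImM conjE /= /h ?expr2; ring.
have h0 : h t != 0.
  have : (h t)%:C%C != 0 by rewrite hE mulf_neq0 // conjC_eq0.
  by apply: contra => /eqP ->.
have [f1 f2] := fd.
have hd : is_derive t 1 h (Re (f t) * Re d *+ 2 + Im (f t) * Im d *+ 2).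
  rewrite (_ : h = (fun x => Re (f x)) ^+ 2 + (fun x => Im (f x)) ^+ 2).
    apply: (is_derive_eq (is_deriveD (is_deriveX 2 f1) (is_deriveX 2 f2))).
    by rewrite /GRing.scale /= !expr1; ring.
  by apply/funext => x.
have hVd := is_deriveV h0 hd.
have := cderM (cder_conj fd) (cder_real hVd).
move=> H; apply: (@cder_ext (fun x => (f x)^* * ((h x)^-1)%:C%C)).
  apply: cder_eq H _.
  rewrite /GRing.scale /= rmorphM rmorphN /=.
  have -> : ((h t)^-1)%:C%C = ((f t) * (f t)^*)^-1 by rewrite -hE fmorphV.
  have -> : (h t ^- 2)%:C%C = ((f t) * (f t)^*) ^- 2.
    by rewrite -hE fmorphV rmorphXn.
  have -> : (Re (f t) * Re d *+ 2 + Im (f t) * Im d *+ 2)%:C%C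
     = f t * d^* + (f t)^* * d.
    by apply: complexP; rewrite ?cReD ?cImD ?cReM ?cImM !conjE /=; ring.
  have c0 : (f t)^* != 0 by rewrite conjC_eq0.
  by field; rewrite f0 c0.
move=> x; rewrite fmorphV /= hE.
(* The two expressions must agree at every x; where f vanishes both are 0, since the inverse of 0 is
   0. *)
have [->|fx] := eqVneq (f x) 0; first by rewrite conjC0 mul0r invr0.
have c0 : (f x)^* != 0 by rewrite conjC_eq0.
by field; rewrite fx c0.
Qed.

Lemma cderXz f t d (n : int) : f t != 0 -> cder f t d ->
  cder (fun x => f x ^ n) t (n%:~R * f t ^ (n - 1) * d).
Proof.
move=> f0 fd; case: n => n.
  apply: cder_eq; first exact: (cderX n fd).
  case: n => [|n]; first by rewrite !mul0r.
  by rewrite (_ : Posz n.+1 - 1 = Posz n) //; lia.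
rewrite NegzE; apply: (@cder_ext (fun x => (f x ^+ n.+1)^-1)).
  have f0n : f t ^+ n.+1 != 0 by rewrite expf_neq0.
  apply: cder_eq; first exact: (@cderV (fun x => f x ^+ n.+1) _ _ f0n (cderX n.+1 fd)).
  rewrite (_ : - (Posz n.+1) - 1 = - (Posz n.+2)); last by lia.
  by rewrite /= mulrNz -!exprnN !exprS; field; rewrite f0 expf_neq0.
by move=> x; rewrite -exprnN.
Qed.

Lemma cder0_cst f : (forall t, cder f t 0) -> forall t, f t = f 0.
Proof.
move=> fd t; apply: complexP.
  by apply: (@is_derive_0_is_cst _ (fun x => Re (f x))) => x; exact: (fd x).1.
by apply: (@is_derive_0_is_cst _ (fun x => Im (f x))) => x; exact: (fd x).2.
Qed.

Lemma cexpE z : cexp z = Complex (expR (Re z) * cos (Im z)) (expR (Re z) * sin (Im z)).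
Proof. by rewrite /cexp; apply: complexP; rewrite ?cReM ?cImM /=; ring. Qed.

Lemma cexpD z w : cexp (z + w) = cexp z * cexp w.
Proof.
rewrite !cexpE; apply: complexP; rewrite ?cReM ?cImM /= cReD cImD expRD ?cosD ?sinD; ring.
Qed.

Lemma cexp0 : cexp 0 = 1 :> C.
Proof. by rewrite cexpE /= expR0 cos0 sin0 mulr0 mulr1. Qed.

Lemma cexp_neq0 z : cexp z != 0.
Proof.
apply/eqP => z0; have := cexpD z (- z).
by rewrite subrr cexp0 z0 mul0r => /eqP; rewrite oner_eq0.
Qed.

Lemma cexpN z : cexp (- z) = (cexp z)^-1.
Proof.
apply: (mulfI (cexp_neq0 z)); rewrite -cexpD subrr cexp0 mulfV //.
exact: cexp_neq0.
Qed.

Lemma cexp_conj z : cexp z^* = (cexp z)^*.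
Proof. by rewrite !cexpE !conjE /= cosN sinN mulrN. Qed.

Lemma cexpMn z n : cexp (z *+ n) = cexp z ^+ n.
Proof. by elim: n => [|n IH]; rewrite ?cexp0 // mulrS cexpD IH exprS. Qed.

Lemma cexpMz z (n : int) : cexp (n%:~R * z) = cexp z ^ n.
Proof.
case: n => n; first by rewrite -[RHS]cexpMn -mulr_natl.
by rewrite NegzE mulrNz mulNr cexpN -exprnN -cexpMn -mulr_natl.
Qed.

Lemma cder_cexp z t : cder (fun x => cexp (z * x%:C%C)) t (z * cexp (z * t%:C%C)).
Proof.
pose a := Re z; pose b := Im z.
have E x : cexp (z * x%:C%C) =
    Complex (expR (a * x) * cos (b * x)) (expR (a * x) * sin (b * x)).
  by rewrite cexpE cReM cImM /= !mulr0 subr0 add0r.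
have la (c : R) : is_derive t 1 (fun x => c * x) c.
  have := is_deriveZ c (is_derive_id t (1 : R)).
  by rewrite [_ *: 1]mulr1.
have ea : is_derive t 1 (fun x => expR (a * x)) (a * expR (a * t)).
  have := @is_derive1_comp _ expR (fun x => a * x) t _ _ (is_derive_expR (a * t)) (la a).
  by rewrite mulrC.
have cb : is_derive t 1 (fun x => cos (b * x)) (- b * sin (b * t)).
  have := @is_derive1_comp _ cos (fun x => b * x) t _ _ (is_derive_cos (b * t)) (la b).
  by rewrite mulNr -mulrN mulrC.
have sb : is_derive t 1 (fun x => sin (b * x)) (b * cos (b * t)).
  have := @is_derive1_comp _ sin (fun x => b * x) t _ _ (is_derive_sin (b * t)) (la b).
  by rewrite mulrC.
split.
  rewrite (_ : (fun x => _) = (fun x => expR (a * x)) * (fun x => cos (b * x))).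
    apply: (is_derive_eq (is_deriveM ea cb)).
    by rewrite E cReM /= -/a -/b /GRing.scale /=; ring.
  by apply/funext => x; rewrite E.
rewrite (_ : (fun x => _) = (fun x => expR (a * x)) * (fun x => sin (b * x))).
  apply: (is_derive_eq (is_deriveM ea sb)).
  by rewrite E cImM /= -/a -/b /GRing.scale /=; ring.
by apply/funext => x; rewrite E.
Qed.

(** The product of f with [cexp (- z t)] has zero derivative. This scalar uniqueness statement
    computes all the exponentials and flows below, one entry at a time. *)
Lemma cder_linear_ode f z : (forall t, cder f t (z * f t)) ->
  forall t, f t = cexp (z * t%:C%C) * f 0.
Proof.
move=> fd t; pose h x := cexp (- z * x%:C%C) * f x.
have : forall x, cder h x 0.
  move=> x; apply: cder_eq; first exact: (cderM (cder_cexp (- z) x) (fd x)).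
  by rewrite /=; ring.
move=> /cder0_cst/(_ t); rewrite /h mulr0 cexp0 mul1r => <-.
by rewrite mulrA -cexpD mulNr subrr cexp0 mul1r.
Qed.

End ComplexCalculus.

(** * The matrix exponential *)

Section MatrixExponential.
Variable R : realType.
Local Notation C := R[i].
Local Notation Re := complex.Re.
Local Notation Im := complex.Im.
Local Notation M3 := 'M[C]_3.

(** A majorant by an exponential series. It passes to the formal derivative with D replaced by D M,
    which supplies the three convergent series needed for termwise differentiation. *)
Definition expbound (c : R^nat) (D M : R) :=
  forall k, `|c k| <= D * (M ^+ k / k`!%:R).

Lemma expbound_cvg c D M x : expbound c D M -> cvgn (pseries c x).
Proof.
have ec (y : R) n : exp_coeff y n = y ^+ n / n`!%:R by [].
move=> cD; apply: normed_cvg.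
apply: (@series_le_cvg _ _ (fun k => D * exp_coeff (M * `|x|) k)).
- by move=> n; exact: normr_ge0.
- move=> n; apply: le_trans (_ : `|D * (M ^+ n / n`!%:R) * `|x| ^+ n| <= _).
    exact: normr_ge0.
  rewrite ec exprMn.
  have h : `|c n| <= D * (M ^+ n / n`!%:R) := cD n.
  have h2 : 0 <= D * (M ^+ n / n`!%:R) by exact: le_trans h.
  rewrite normrM (ger0_norm h2) normrX normr_id le_eqVlt; apply/orP; left.
  by apply/eqP; ring.
- move=> n; rewrite /= normrM normrX ec exprMn.
  apply: le_trans (ler_wpM2r (exprn_ge0 _ (normr_ge0 _)) (cD n)) _.
  by rewrite le_eqVlt; apply/orP; left; apply/eqP; ring.
- exact: is_cvg_seriesZ (is_cvg_series_exp_coeff _).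
Qed.

Lemma expbound_diffs c D M : expbound c D M -> expbound (pseries_diffs c) (D * M) M.
Proof.
move=> cD k; rewrite /pseries_diffs normrM ger0_norm //.
apply: le_trans (ler_wpM2l _ (cD k.+1)) _ => //.
rewrite le_eqVlt factS natrM exprS; apply/orP; left; apply/eqP.
have f0 : (k`!%:R : R) != 0 by rewrite pnatr_eq0 -lt0n fact_gt0.
have k0 : (k.+1%:R : R) != 0 by rewrite pnatr_eq0.
by rewrite invfM; field; rewrite f0 addrC natr1.
Qed.

Lemma expbound_der c D M (x : R) : expbound c D M ->
  is_derive x 1 (fun x => limn (pseries c x)) (limn (pseries (pseries_diffs c) x)).
Proof.
move=> cD; apply: (@pseries_snd_diffs _ _ (`|x| + 1)).
- exact: expbound_cvg cD.
- exact: expbound_cvg (expbound_diffs cD).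
- exact: expbound_cvg (expbound_diffs (expbound_diffs cD)).
- by rewrite [X in _ < X]ger0_norm ?ltrDl // addr_ge0.
Qed.

Definition ccvg (u : nat -> C) (l : C) :=
  (fun n => Re (u n)) @ \oo --> Re l /\ (fun n => Im (u n)) @ \oo --> Im l.

Lemma ccvg_clim u l : ccvg u l -> clim u = l.
Proof.
by case=> /cvg_lim h1 /cvg_lim h2; rewrite /clim h1 // h2 //; case: l {h1 h2}.
Qed.

Lemma ccvg_unique u l l' : ccvg u l -> ccvg u l' -> l = l'.
Proof. by move=> /ccvg_clim <- /ccvg_clim <-. Qed.

Lemma ccvg_cst l : ccvg (fun=> l) l.
Proof. by split; exact: cvg_cst. Qed.

Lemma ccvgD u v l m : ccvg u l -> ccvg v m -> ccvg (fun n => u n + v n) (l + m).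
Proof.
move=> [u1 u2] [v1 v2]; split; rewrite ?cReD ?cImD.
  under eq_fun do rewrite cReD; exact: cvgD.
under eq_fun do rewrite cImD; exact: cvgD.
Qed.

Lemma ccvgZ u l z : ccvg u l -> ccvg (fun n => z * u n) (z * l).
Proof.
move=> [u1 u2]; split; rewrite ?cReM ?cImM.
  under eq_fun do rewrite cReM.
  by apply: cvgB; apply: cvgM => //; exact: cvg_cst.
under eq_fun do rewrite cImM.
by apply: cvgD; apply: cvgM => //; exact: cvg_cst.
Qed.

Lemma ccvg_sum (I : Type) (s : seq I) (U : I -> nat -> C) (L : I -> C) :
  (forall i, ccvg (U i) (L i)) ->
  ccvg (fun n => \sum_(i <- s) U i n) (\sum_(i <- s) L i).
Proof.
move=> UL; elim: s => [|i s IH].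
  rewrite big_nil (_ : (fun n => _) = fun=> 0); first exact: ccvg_cst.
  by apply/funext => n; rewrite big_nil.
rewrite big_cons (_ : (fun n => _) = fun n => U i n + \sum_(i <- s) U i n).
  exact: ccvgD.
by apply/funext => n; rewrite big_cons.
Qed.

Lemma Re_sum n (F : nat -> C) : Re (\sum_(0 <= k < n) F k) = \sum_(0 <= k < n) Re (F k).
Proof. by elim/big_rec2: _ => // i x y _ <-; rewrite cReD. Qed.
Lemma Im_sum n (F : nat -> C) : Im (\sum_(0 <= k < n) F k) = \sum_(0 <= k < n) Im (F k).
Proof. by elim/big_rec2: _ => // i x y _ <-; rewrite cImD. Qed.

Lemma mx_pow_bound (X : M3) : exists M : R, forall k a b,
  `|(X ^+ k) a b| <= (M ^+ k)%:C%C.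
Proof.
pose m : C := \sum_a \sum_b `|X a b|.
have mE a b : `|X a b| <= m.
  rewrite /m (bigD1 a) //= (bigD1 b) //= -addrA lerDl addr_ge0 ?sumr_ge0 //.
  by move=> i _; rewrite sumr_ge0.
have m0 : 0 <= m by rewrite sumr_ge0 // => i _; rewrite sumr_ge0.
have mR : m = (Re m)%:C%C by rewrite RRe_real // ger0_real.
(* m is the sum of the absolute values of all entries; the factor 3 counts the summands of an entry
   of a product. *)
exists (3 * Re m) => k a b; rewrite rmorphXn rmorphM /= rmorph_nat -mR.
elim: k a b => [|k IH] a b.
  by rewrite expr0 mxE; case: eqP => _; rewrite ?normr1 ?normr0.
rewrite exprS [X * _]/(X *m _) mxE; apply: le_trans (ler_norm_sum _ _ _) _.
apply: le_trans (_ : \sum_(j < 3) m * (3 * m) ^+ k <= _).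
  by apply: ler_sum => j _; rewrite normrM ler_pM.
by rewrite sumr_const card_ord exprS -[_ *+ 3]mulr_natl !mulrA.
Qed.

Definition expterm (X : M3) (a b : 'I_3) (k : nat) : C := (k`!%:R)^-1 * (X ^+ k) a b.

Lemma scaled_pow (X : M3) (t : C) k : (t *: X) ^+ k = t ^+ k *: X ^+ k.
Proof. by rewrite exprZn. Qed.

Lemma expterm_bound (X : M3) a b : exists M : R,
  expbound (fun k => Re (expterm X a b k)) 1 M /\
  expbound (fun k => Im (expterm X a b k)) 1 M.
Proof.
have [M Mb] := mx_pow_bound X; exists M.
have key k : `|expterm X a b k| <= (1 * (M ^+ k / k`!%:R))%:C%C.
  rewrite mul1r /expterm normrM normfV normr_nat mulrC rmorphM /=.
  rewrite fmorphV rmorph_nat ler_wpM2r // invr_ge0 //.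
have bound (z : C) (r : R) : `|z| <= r%:C%C -> `|Re z| <= r /\ `|Im z| <= r.
  move=> zr; split; rewrite -lecR.
    exact: le_trans (normc_ge_Re z) zr.
  have := normc_ge_Re (z * 'i%C).
  rewrite ReiNIm normrN => h; apply: le_trans h _.
  by rewrite normrM (_ : `|'i%C| = 1) ?mulr1 // complexiE normCi.
by split => k; have [] := bound _ _ (key k).
Qed.

Lemma expmx_ccvg (X : M3) a b :
  ccvg (fun n => \sum_(0 <= k < n) expterm X a b k) (expmx X a b).
Proof.
have [M [h1 h2]] := expterm_bound X a b.
have e1 : ccvg (fun n => \sum_(0 <= k < n) expterm X a b k)
  (Complex (limn (pseries (fun k => Re (expterm X a b k)) 1))
           (limn (pseries (fun k => Im (expterm X a b k)) 1))).
  split => /=.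
    rewrite (_ : (fun n => _) = pseries (fun k => Re (expterm X a b k)) 1).
      exact: (expbound_cvg h1).
    apply/funext => n; rewrite Re_sum; apply: eq_bigr => i _ /=.
    by rewrite expr1n mulr1.
  rewrite (_ : (fun n => _) = pseries (fun k => Im (expterm X a b k)) 1).
    exact: (expbound_cvg h2).
  apply/funext => n; rewrite Im_sum; apply: eq_bigr => i _ /=.
  by rewrite expr1n mulr1.
by rewrite /expmx mxE (ccvg_clim e1).
Qed.

Lemma RerM (r : R) (z : C) : Re (r%:C%C * z) = r * Re z.
Proof. by rewrite cReM /= mul0r subr0. Qed.
Lemma ImrM (r : R) (z : C) : Im (r%:C%C * z) = r * Im z.
Proof. by rewrite cImM /= mul0r addr0. Qed.

Lemma expterm_scaled (X : M3) a b (t : R) k :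
  expterm (t%:C%C *: X) a b k = (t ^+ k)%:C%C * expterm X a b k.
Proof. by rewrite /expterm scaled_pow mxE rmorphXn; ring. Qed.

(** The entries are power series in t, differentiated termwise; the differentiated series is that of
    X exp(tX) because (k+1) X^(k+1) / (k+1)! = X X^k / k!. *)
Lemma expmx_cder (X : M3) a b (t : R) :
  cder (fun t => expmx (t%:C%C *: X) a b) t ((X *m expmx (t%:C%C *: X)) a b).
Proof.
have [M [h1 h2]] := expterm_bound X a b.
pose c1 k := Re (expterm X a b k); pose c2 k := Im (expterm X a b k).
have E1 s : Re (expmx (s%:C%C *: X) a b) = limn (pseries c1 s).
  have [/cvg_lim <- // _] := expmx_ccvg (s%:C%C *: X) a b.
  congr (lim (_ @ \oo)); apply/funext => n; rewrite Re_sum; apply: eq_bigr => i _.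
  by rewrite expterm_scaled RerM mulrC.
have E2 s : Im (expmx (s%:C%C *: X) a b) = limn (pseries c2 s).
  have [_ /cvg_lim <- //] := expmx_ccvg (s%:C%C *: X) a b.
  congr (lim (_ @ \oo)); apply/funext => n; rewrite Im_sum; apply: eq_bigr => i _.
  by rewrite expterm_scaled ImrM mulrC.
pose d := Complex (limn (pseries (pseries_diffs c1) t))
                  (limn (pseries (pseries_diffs c2) t)).
have -> : (X *m expmx (t%:C%C *: X)) a b = d.
  rewrite mxE; apply: (@ccvg_unique (fun n => \sum_(0 <= k < n)
     \sum_j X a j * expterm (t%:C%C *: X) j b k)).
    rewrite (_ : (fun n => _) = fun n => \sum_j X a j *
      \sum_(0 <= k < n) expterm (t%:C%C *: X) j b k).
      by apply: ccvg_sum => j; apply: ccvgZ; exact: expmx_ccvg.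
    apply/funext => n; rewrite exchange_big /=; apply: eq_bigr => j _.
    by rewrite mulr_sumr.
  have key k : \sum_j X a j * expterm (t%:C%C *: X) j b k =
      (t ^+ k)%:C%C * (k.+1%:R * expterm X a b k.+1).
    under eq_bigr do rewrite expterm_scaled mulrCA.
    rewrite -mulr_sumr /expterm; congr (_ * _).
    rewrite exprS [X * _]/(X *m _) mxE mulrA factS natrM invfM mulrA mulfV ?mul1r.
      by rewrite mulr_sumr; apply: eq_bigr => j _; ring.
    by rewrite pnatr_eq0.
  have natRe (m : nat) (z : C) : Re (m%:R * z) = m%:R * Re z.
    by rewrite -(rmorph_nat (real_complex R)) RerM.
  have natIm (m : nat) (z : C) : Im (m%:R * z) = m%:R * Im z.
    by rewrite -(rmorph_nat (real_complex R)) ImrM.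
  split => /=.
    rewrite (_ : (fun n => _) = pseries (pseries_diffs c1) t).
      exact: (expbound_cvg (expbound_diffs h1)).
    apply/funext => n; rewrite Re_sum; apply: eq_bigr => i _.
    by rewrite key RerM natRe mulrC.
  rewrite (_ : (fun n => _) = pseries (pseries_diffs c2) t).
    exact: (expbound_cvg (expbound_diffs h2)).
  apply/funext => n; rewrite Im_sum; apply: eq_bigr => i _.
  by rewrite key ImrM natIm mulrC.
split => /=.
  under eq_fun do rewrite E1; exact: (expbound_der _ h1).
under eq_fun do rewrite E2; exact: (expbound_der _ h2).
Qed.

Lemma expmx0 : expmx (0 : M3) = 1%:M.
Proof.
apply/matrixP => a b; apply: (ccvg_unique (expmx_ccvg 0 a b)).
have h n : (0 < n)%N -> \sum_(0 <= k < n) expterm (0 : M3) a b k = (1%:M : M3) a b.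
  case: n => // n _; rewrite big_nat_recl // big1 ?addr0.
    by rewrite /expterm expr0 fact0 invr1 mul1r.
  by move=> i _; rewrite /expterm exprS mul0r mxE mulr0.
split; apply/cvg_ballP => e e0; exists 1%N => // n n0 /=; rewrite h //;
  exact: ballxx.
Qed.

Lemma expmx_comm (X : M3) (t : C) : X *m expmx (t *: X) = expmx (t *: X) *m X.
Proof.
apply/matrixP => a b; rewrite !mxE.
have h1 : ccvg (fun n => \sum_j X a j * \sum_(0 <= k < n) expterm (t *: X) j b k)
   (\sum_j X a j * expmx (t *: X) j b).
  by apply: ccvg_sum => j; apply: ccvgZ; exact: expmx_ccvg.
have h2 : ccvg (fun n => \sum_j X j b * \sum_(0 <= k < n) expterm (t *: X) a j k)
   (\sum_j X j b * expmx (t *: X) a j).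
  by apply: ccvg_sum => j; apply: ccvgZ; exact: expmx_ccvg.
under [RHS]eq_bigr do rewrite mulrC.
apply: (ccvg_unique h1); congr (ccvg _ _): h2; apply/funext => n.
under eq_bigr do rewrite mulr_sumr.
under [RHS]eq_bigr do rewrite mulr_sumr.
rewrite exchange_big [RHS]exchange_big /=; apply: eq_bigr => k _.
have : (X * (t *: X) ^+ k) a b = ((t *: X) ^+ k * X) a b.
  by rewrite scaled_pow -scalerAr -scalerAl -exprS -exprSr.
rewrite [X * _]/(X *m _) [_ * X]/(_ *m X) !mxE /expterm => e.
transitivity ((k`!%:R)^-1 * \sum_j ((t *: X) ^+ k) a j * X j b).
  by rewrite mulr_sumr; apply: eq_bigr => j _; ring.
by rewrite -e mulr_sumr; apply: eq_bigr => j _; ring.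
Qed.

Lemma expmx_nilp (X : M3) : X ^+ 3 = 0 -> expmx X = 1%:M + X + 2^-1 *: X ^+ 2.
Proof.
move=> X3; apply/matrixP => a b; apply: (ccvg_unique (expmx_ccvg X a b)).
have h n : (2 < n)%N -> \sum_(0 <= k < n) expterm X a b k =
    (1%:M + X + 2^-1 *: X ^+ 2) a b.
  case: n => // [[|[|n]]] // _; rewrite !big_nat_recl // big1 ?addr0.
    rewrite /expterm expr0 expr1 !mxE fact0 (_ : 1`! = 1)%N // (_ : 2`! = 2)%N //.
    by rewrite invr1 !mul1r addrA.
  by move=> i _; rewrite /expterm -addn3 exprD X3 mulr0 mxE mulr0.
split; apply/cvg_ballP => e e0; exists 3%N => // n n0 /=; rewrite h //;
  exact: ballxx.
Qed.

End MatrixExponential.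

(** * The group SU(2,1) and the isotropy group of a null vector *)

Section Group.
Variable R : realType.
Local Notation C := R[i].
Local Notation Re := complex.Re.
Local Notation Im := complex.Im.
Local Notation M3 := 'M[C]_3.

Lemma ord3P (P : 'I_3 -> Prop) : P 0 -> P 1 -> P 2 -> forall i, P i.
Proof.
move=> P0 P1 P2 [[|[|[|//]]] i].
- by rewrite (_ : Ordinal i = 0) //; exact: val_inj.
- by rewrite (_ : Ordinal i = 1) //; exact: val_inj.
- by rewrite (_ : Ordinal i = 2) //; exact: val_inj.
Qed.

Lemma ord2P (P : 'I_2 -> Prop) : P 0 -> P 1 -> forall i, P i.
Proof.
move=> P0 P1 [[|[|//]] i].
- by rewrite (_ : Ordinal i = 0) //; exact: val_inj.
- by rewrite (_ : Ordinal i = 1) //; exact: val_inj.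
Qed.

Lemma sum3 (V : nmodType) (F : 'I_3 -> V) : \sum_i F i = F 0 + F 1 + F 2.
Proof.
rewrite !big_ord_recl big_ord0 addr0 addrA; congr (_ + _ + _); congr F; exact: val_inj.
Qed.

Lemma sum2 (V : nmodType) (F : 'I_2 -> V) : \sum_i F i = F 0 + F 1.
Proof.
rewrite !big_ord_recl big_ord0 addr0; congr (_ + _); congr F; exact: val_inj.
Qed.

Lemma mx33P (T : Type) (A B : 'M[T]_3) :
  A 0 0 = B 0 0 -> A 0 1 = B 0 1 -> A 0 2 = B 0 2 ->
  A 1 0 = B 1 0 -> A 1 1 = B 1 1 -> A 1 2 = B 1 2 ->
  A 2 0 = B 2 0 -> A 2 1 = B 2 1 -> A 2 2 = B 2 2 -> A = B.
Proof.
by move=> *; apply/matrixP; apply: ord3P; apply: ord3P.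
Qed.

Lemma mx22P (T : Type) (A B : 'M[T]_2) :
  A 0 0 = B 0 0 -> A 0 1 = B 0 1 ->
  A 1 0 = B 1 0 -> A 1 1 = B 1 1 -> A = B.
Proof. by move=> *; apply/matrixP; apply: ord2P; apply: ord2P. Qed.

Lemma mulmx_entry (K : pzSemiRingType) m n p (A : 'M[K]_(m, n)) (B : 'M[K]_(n, p)) i j :
  (A *m B) i j = \sum_k A i k * B k j.
Proof. exact: mxE. Qed.

Lemma det22 (K : comNzRingType) (A : 'M[K]_2) : \det A = A 0 0 * A 1 1 - A 0 1 * A 1 0.
Proof.
rewrite (expand_det_row _ 0) sum2 /cofactor !det_mx11 !mxE /= expr0 expr1 mul1r.
rewrite mulN1r mulrN; congr (_ * A _ _ - _ * A _ _); exact: val_inj.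
Qed.

Lemma det33 (K : comNzRingType) (A : 'M[K]_3) : \det A =
  A 0 0 * (A 1 1 * A 2 2 - A 1 2 * A 2 1) - A 0 1 * (A 1 0 * A 2 2 - A 1 2 * A 2 0)
  + A 0 2 * (A 1 0 * A 2 1 - A 1 1 * A 2 0).
Proof.
rewrite (expand_det_row _ 0) sum3 /cofactor !det22 !mxE /= expr0 expr1 sqrrN expr1n.
rewrite !mul1r mulN1r mulrN.
by congr (_ * (A _ _ * A _ _ - A _ _ * A _ _) - _ * (A _ _ * A _ _ - A _ _ * A _ _) +
  _ * (A _ _ * A _ _ - A _ _ * A _ _)); apply: val_inj.
Qed.

Lemma adjmxM n (A B : 'M[C]_n) : adjmx (A *m B) = adjmx B *m adjmx A.
Proof. by rewrite /adjmx map_mxM trmx_mul. Qed.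

Lemma adjmxE n (A : 'M[C]_n) i j : adjmx A i j = (A j i)^*.
Proof. by rewrite /adjmx !mxE. Qed.

Lemma adjmxK n (A : 'M[C]_n) : adjmx (adjmx A) = A.
Proof. by apply/matrixP => i j; rewrite !adjmxE conjCK. Qed.

Lemma adjmx1 n : adjmx (1%:M : 'M[C]_n) = 1%:M.
Proof.
apply/matrixP => i j; rewrite adjmxE !mxE eq_sym.
by case: eqP => _; rewrite ?conjC1 ?conjC0.
Qed.

Lemma matJE (i j : 'I_3) :
  (matJ R) i j = if i == j then (if i == 2 then -1 else 1) else 0.
Proof.
rewrite /matJ /diag3 !mxE; elim/ord3P: i; elim/ord3P: j; rewrite //= ?mulr1n ?mulr0n //.
Qed.

Lemma SU21_mul (g h : M3) : SU21 g -> SU21 h -> SU21 (g *m h).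
Proof.
move=> [g1 g2] [h1 h2]; split; last by rewrite det_mulmx g2 h2 mulr1.
by rewrite adjmxM -!mulmxA (mulmxA (adjmx g)) (mulmxA _ g h) g1 mulmxA.
Qed.

Lemma SU21_unit (g : M3) : SU21 g -> g \in unitmx.
Proof. by move=> [_ g2]; rewrite unitmxE g2 unitr1. Qed.

Lemma SU21_inv (g : M3) : SU21 g -> SU21 (invmx g).
Proof.
move=> gG; have [g1 g2] := gG; have gu := SU21_unit gG.
split; last by rewrite det_inv g2 invr1.
have {1}<- : adjmx g *m matJ R *m g = matJ R by [].
rewrite -!mulmxA mulmxV // mulmx1 mulmxA -adjmxM mulmxV // adjmx1 mul1mx //.
Qed.

Lemma SU21_1 : SU21 (1%:M : M3).
Proof. by split; rewrite ?det1 // adjmx1 mulmx1 mul1mx. Qed.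

Lemma SU21_mulr_iff (g h : M3) : SU21 h -> SU21 (h *m g) <-> SU21 g.
Proof.
move=> hG; split; last exact: SU21_mul.
by move=> hgG; rewrite -(mulKmx (SU21_unit hG) g); apply: SU21_mul => //; exact: SU21_inv.
Qed.

Definition mxder m n (F : R -> 'M[C]_(m, n)) (t : R) (D : 'M[C]_(m, n)) :=
  forall a b, cder (fun t => F t a b) t (D a b).

Lemma mxder_mul m n p (F : R -> 'M[C]_(m, n)) (G : R -> 'M[C]_(n, p)) t D E :
  mxder F t D -> mxder G t E -> mxder (fun t => F t *m G t) t (D *m G t + F t *m E).
Proof.
move=> FD GE a b; apply: (@cder_ext _ (fun t => \sum_j F t a j * G t j b)).
  rewrite !mxE -big_split /=; apply: cder_sum => j; exact: cderM.
by move=> x; rewrite mxE.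
Qed.

Lemma mxder_cst m n (A : 'M[C]_(m, n)) t : mxder (fun=> A) t 0.
Proof. by move=> a b; rewrite mxE; exact: cder_cst. Qed.

Lemma mxder_adj n (F : R -> 'M[C]_n) t D :
  mxder F t D -> mxder (fun t => adjmx (F t)) t (adjmx D).
Proof.
move=> FD a b; rewrite adjmxE; apply: (@cder_ext _ (fun t => (F t b a)^*)).
  exact: cder_conj.
by move=> x; rewrite adjmxE.
Qed.

Lemma mxder_exp (X : M3) t : mxder (fun t => expmx (t%:C%C *: X)) t
  (X *m expmx (t%:C%C *: X)).
Proof. by move=> a b; exact: expmx_cder. Qed.

Lemma mxder0_cst m n (F : R -> 'M[C]_(m, n)) :
  (forall t, mxder F t 0) -> forall t, F t = F 0.
Proof.
move=> FD t; apply/matrixP => a b; apply: (@cder0_cst _ (fun t => F t a b)) => s.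
by have := FD s a b; rewrite mxE.
Qed.

Lemma det_cder (F : R -> M3) t X : mxder F t (X *m F t) ->
  cder (fun t => \det (F t)) t (\tr X * \det (F t)).
Proof.
move=> FD; apply: (@cder_ext _ (fun x =>
  F x 0 0 * (F x 1 1 * F x 2 2 + -1 * (F x 1 2 * F x 2 1)) +
  -1 * (F x 0 1 * (F x 1 0 * F x 2 2 + -1 * (F x 1 2 * F x 2 0)))
  + F x 0 2 * (F x 1 0 * F x 2 1 + -1 * (F x 1 1 * F x 2 0)))).
  apply: cder_eq.
    by repeat first [apply: cderD | apply: cderZ | apply: cderM | apply: FD].
  by rewrite /mxtrace det33 !mxE !sum3 /=; ring.
by move=> x; rewrite det33; ring.
Qed.

(** With g = exp(tX), the derivative of g^* J g is g^* (X^* J + J X) g = 0, and that of det g is tr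
    X det g = 0. *)
Lemma expmx_SU21 (X : M3) (t : R) : su21 X -> SU21 (expmx (t%:C%C *: X)).
Proof.
move=> [X1 X2].
have E0 : expmx ((0 : R)%:C%C *: X) = 1%:M by rewrite scale0r expmx0.
split.
  pose F t := adjmx (expmx (t%:C%C *: X)) *m matJ R *m expmx (t%:C%C *: X).
  have : forall t, mxder F t 0.
    move=> s; have e := mxder_exp X s.
    have h := mxder_mul (mxder_mul (mxder_adj e) (mxder_cst (matJ R) s)) e.
    move=> a b; apply: (cder_eq (h a b)); congr (fun_of_matrix _ a b).
    rewrite mulmx0 addr0 adjmxM -!mulmxA -mulmxDr (mulmxA (adjmx X)).
    by rewrite (mulmxA (matJ R)) -mulmxDl X1 mul0mx mulmx0.
  by move=> /mxder0_cst/(_ t); rewrite /F E0 adjmx1 mulmx1 mul1mx.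
have := @cder0_cst _ (fun t => \det (expmx (t%:C%C *: X))) _ t.
rewrite E0 det1; apply => s.
by apply: cder_eq; [exact: det_cder (mxder_exp X s) | rewrite X2 mul0r].
Qed.

Lemma expmx_eigen (X : M3) (v : 'cV[C]_3) z (t : R) : X *m v = z *: v ->
  expmx (t%:C%C *: X) *m v = cexp (z * t%:C%C) *: v.
Proof.
move=> Xv; apply/matrixP => a b; rewrite [RHS]mxE.
have := @cder_linear_ode _ (fun t => (expmx (t%:C%C *: X) *m v) a b) z _ t.
rewrite scale0r expmx0 mul1mx; apply => s.
apply: (cder_eq (mxder_mul (mxder_exp X s) (mxder_cst v s) a b)).
rewrite mulmx0 addr0 expmx_comm -mulmxA Xv -scalemxAr.
by rewrite [LHS]mxE.
Qed.

Definition v0 : 'cV[C]_3 := \col_j [:: 1; 0; 1]`_j.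

Lemma v0E : (v0 0 0 = 1) * (v0 1 0 = 0) * (v0 2 0 = 1).
Proof. by rewrite !mxE. Qed.

Definition pt (g : M3) : 'cV[C]_3 := g *m v0.

Lemma ptE (g : M3) a : pt g a 0 = g a 0 + g a 2.
Proof. by rewrite mxE sum3 !mxE /= !mulr1 mulr0 addr0. Qed.

Lemma colP3 (u v : 'cV[C]_3) : u 0 0 = v 0 0 -> u 1 0 = v 1 0 -> u 2 0 = v 2 0 -> u = v.
Proof. by move=> *; apply/colP; apply: ord3P. Qed.

Definition null (u : 'cV[C]_3) :=
  u 0 0 * (u 0 0)^* + u 1 0 * (u 1 0)^* = u 2 0 * (u 2 0)^*.

Definition hform (u v : 'cV[C]_3) : C :=
  (u 0 0)^* * v 0 0 + (u 1 0)^* * v 1 0 - (u 2 0)^* * v 2 0.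

Lemma hformE (g : M3) u v : SU21 g -> hform (g *m u) (g *m v) = hform u v.
Proof.
have E (x y : 'cV[C]_3) : hform x y = ((map_mx Num.conj x)^T *m matJ R *m y) 0 0.
  by rewrite mulmx_entry sum3 !mulmx_entry !sum3 !matJE /= !mxE /= /hform; ring.
move=> [g1 _]; rewrite !E map_mxM trmx_mul.
transitivity (((map_mx Num.conj u)^T *m (adjmx g *m matJ R *m g) *m v) 0 0).
  by rewrite !mulmxA.
by rewrite g1.
Qed.

Lemma pt_null (g : M3) : SU21 g -> null (pt g).
Proof.
move=> gG; have := hformE v0 v0 gG; rewrite /hform -/(pt g) /null => H.
apply/eqP; rewrite -subr_eq0; apply/eqP.
transitivity (((v0 0 0)^* * v0 0 0 + (v0 1 0)^* * v0 1 0 - (v0 2 0)^* * v0 2 0)).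
  by rewrite -H; ring.
by rewrite !mxE /= conjC1 conjC0; ring.
Qed.

Lemma conj_mul_eq0 (x y : C) : x * x^* + y * y^* = 0 -> x = 0 /\ y = 0.
Proof.
move=> H; have x0 : 0 <= x * x^* by rewrite mul_conjC_ge0.
have y0 : 0 <= y * y^* by rewrite mul_conjC_ge0.
move/eqP: H; rewrite paddr_eq0 // !mul_conjC_eq0 => /andP[/eqP -> /eqP ->] //.
Qed.

(** A null vector whose third coordinate vanishes is zero, whereas g is invertible. This makes
    negative powers of u_3 legitimate on the group. *)
Lemma pt_neq0 (g : M3) : SU21 g -> pt g 2 0 != 0.
Proof.
move=> gG; apply/eqP => h; have := pt_null gG; rewrite /null h mul0r => /conj_mul_eq0[h0 h1].
have : pt g = 0 by apply: colP3; rewrite ?h ?h0 ?h1 mxE.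
rewrite /pt => /(congr1 (mulmx (invmx g))); rewrite mulKmx ?SU21_unit // mulmx0.
by move=> /matrixP/(_ 0 0); rewrite !mxE /= => /eqP; rewrite oner_eq0.
Qed.

Lemma mx3E (s : seq (seq C)) (i j : 'I_3) : mx3 s i j = (nth [::] s i)`_j.
Proof. by rewrite mxE. Qed.

Lemma mulmx33 (A B : M3) i j : (A *m B) i j = A i 0 * B 0 j + A i 1 * B 1 j + A i 2 * B 2 j.
Proof. by rewrite mxE sum3. Qed.

Lemma ReCi (w : R) : ('i%C * w%:C%C)^* = - ('i%C * w%:C%C) :> C.
Proof. by rewrite conjE; apply: complexP; rewrite ?cReM ?cImM ?cReN ?cImN ?cReM ?cImM /=; ring. Qed.

Lemma lieN_su21 (X : M3) : lieN X -> su21 X.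
Proof.
move=> [z [w ->]]; set iw := 'i%C * w%:C%C; set Y := mx3 _.
have iwJ : iw^* = - iw by exact: ReCi.
split.
  have e i j : (adjmx Y *m matJ R + matJ R *m Y) i j =
     (adjmx Y *m matJ R) i j + (matJ R *m Y) i j by rewrite [LHS]mxE.
  apply: mx33P; rewrite e !mulmx33 !adjmxE !matJE /= !mx3E /= mxE
    ?rmorphN /= ?iwJ ?conjCK ?conjC0; ring.
by rewrite /mxtrace sum3 !mx3E /=; ring.
Qed.

Lemma lieN_v0 (X : M3) : lieN X -> X *m v0 = 0.
Proof.
move=> [z [w ->]]; set iw := 'i%C * w%:C%C.
apply: colP3; rewrite mxE sum3 !mxE /=; ring.
Qed.

Lemma expmx_lieN_v0 (X : M3) : lieN X -> expmx X *m v0 = v0.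
Proof.
move=> XN; have := @expmx_eigen X v0 0 1.
rewrite scale0r mul0r cexp0 !scale1r; apply; exact: lieN_v0.
Qed.

Lemma groupN_SU21 (n : M3) : groupN n -> SU21 n.
Proof.
move=> [s [sN ->]]; elim: s sN => [|X s IH] sN; first by rewrite big_nil; exact: SU21_1.
rewrite big_cons; apply: SU21_mul.
  rewrite -[X]scale1r; apply: (@expmx_SU21 X 1).
  by apply: lieN_su21; apply: sN; rewrite mem_head.
by apply: IH => Y Ys; apply: sN; rewrite inE Ys orbT.
Qed.

Lemma groupN_v0 (n : M3) : groupN n -> n *m v0 = v0.
Proof.
move=> [s [sN ->]]; elim: s sN => [|X s IH] sN; first by rewrite big_nil mul1mx.
rewrite big_cons -[_ * _]/(_ *m _) -mulmxA IH.
  by apply: expmx_lieN_v0; apply: sN; rewrite mem_head.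
by move=> Y Ys; apply: sN; rewrite inE Ys orbT.
Qed.

(* An element fixing [v0] also fixes the covector of [v0] under the hermitian
   form, which determines it up to z and w. *)
Lemma stab_v0 (h : M3) : SU21 h -> h *m v0 = v0 -> groupN h.
Proof.
move=> hG hv; have [h1 h2] := hG.
have r (a : 'I_3) : h a 0 + h a 2 = v0 a 0.
  by rewrite -ptE /pt hv.
have c (v : 'cV[C]_3) : (h *m v) 0 0 - (h *m v) 2 0 = v 0 0 - v 2 0.
  by have := hformE v0 v hG; rewrite hv /hform !v0E conjC1 conjC0 !mul1r !mul0r !addr0.
have cj j : h 0 j - h 2 j = (j == 0)%:R - (j == 2)%:R.
  have := c (\col_i (i == j)%:R).
  rewrite !mxE !sum3 !mxE.
  by elim/ord3P: j; rewrite /= ?(mulr1, mulr0, add0r, addr0).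
have r0 : h 0 2 = 1 - h 0 0 by have := r 0; rewrite !mxE /= => <-; ring.
have r1 : h 1 2 = - h 1 0 by have := r 1; rewrite !mxE /= => /eqP; rewrite addrC addr_eq0 => /eqP.
have r2 : h 2 2 = 1 - h 2 0 by have := r 2; rewrite !mxE /= => <-; ring.
have c0 : h 2 0 = h 0 0 - 1 by have := cj 0; rewrite /= subr0 => /eqP; rewrite subr_eq => /eqP ->; ring.
have c1 : h 2 1 = h 0 1 by have := cj 1; rewrite /= subr0 => /eqP; rewrite subr_eq0 => /eqP.
(* Under the row relations [r0], [r1], [r2] and the column relations [c0], [c1] the determinant
   collapses to h_11. *)
have m1 : h 1 1 = 1 by rewrite -h2 det33 r0 r1 r2 c0 c1; ring.
have f i j : \sum_a \sum_b (h a i)^* * matJ R a b * h b j = matJ R i j.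
  rewrite -[in RHS]h1 mulmx_entry exchange_big; apply: eq_bigr => b _; rewrite mulmx_entry mulr_suml.
  by apply: eq_bigr => a _; rewrite adjmxE.
have f01 : h 1 0 = - (h 0 1)^*.
  have := f 1 0; rewrite !sum3 !matJE /= c0 c1 m1 conjC1 => H.
  by apply/eqP; rewrite -subr_eq0 -H; apply/eqP; ring.
have f00 : h 0 0 + (h 0 0)^* = 2 - h 0 1 * (h 0 1)^*.
  have := f 0 0; rewrite !sum3 !matJE /= c0 f01 rmorphN rmorphB /= conjCK conjC1 => H.
  apply/eqP; rewrite -subr_eq0; apply/eqP; rewrite -[RHS](subrr (1 : C)) -[X in X - 1]H; ring.
set z := h 0 1 in c1 f01 f00 *.
(* The corner entry of exp X for X in [lieN] is 1 + iw - |z|^2 / 2, so x is the only candidate for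
   iw; [f00] shows that it is purely imaginary. *)
pose x := h 0 0 - 1 + 2^-1 * (z * z^*).
have xJ : x^* = - x.
  have c2 : (2^-1 : C)^* = 2^-1 by rewrite fmorphV rmorph_nat.
  rewrite /x rmorphD rmorphB rmorphM rmorphM /= conjCK c2 conjC1.
  apply/eqP; rewrite -subr_eq0 opprK; apply/eqP.
  transitivity ((h 0 0 + (h 0 0)^*) - 2 + z * z^*); first by field.
  by rewrite f00; ring.
have xE : 'i%C * (Im x)%:C%C = x.
  move: xJ; rewrite conjE => /(congr1 (fun z => Re z)); rewrite cReN /= => xr.
  have {}xr : Re x = 0 by lra.
  by apply: complexP; rewrite ?cReM ?cImM /= ?xr; ring.
pose X : M3 := mx3 [:: [:: x; z; - x]; [:: - z^*; 0; z^*]; [:: x; z; - x]].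
have X2 : X ^+ 2 = mx3 [:: [:: - (z * z^*); 0; z * z^*]; [:: 0; 0; 0];
    [:: - (z * z^*); 0; z * z^*]].
  rewrite expr2 -[X * X]/(X *m X).
  by apply: mx33P; rewrite !mulmx33 !mx3E /=; ring.
have X3 : X ^+ 3 = 0.
  rewrite exprS X2 -[X * _]/(X *m _).
  by apply: mx33P; rewrite !mulmx33 !mx3E /= mxE; ring.
exists [:: X]; split.
  by move=> Y; rewrite inE => /eqP ->; exists z, (Im x); rewrite xE.
rewrite big_seq1 expmx_nilp // X2.
by apply: mx33P; rewrite !mxE /= ?r0 ?r1 ?r2 ?c0 ?c1 ?m1 ?f01 -/z /x /=; field.
Qed.

End Group.

(** * Homogeneous functions on the null cone *)

Section ConeFunctions.
Variable R : realType.
Local Notation C := R[i].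
Local Notation M3 := 'M[C]_3.
Variables A B : int.

Definition pder (f : R -> {poly C}) (t : R) (d : {poly C}) :=
  forall i, cder (fun t => (f t)`_i) t d`_i.

Lemma pder_eq f t d d' : pder f t d -> d = d' -> pder f t d'.
Proof. by move=> ? <-. Qed.

Lemma pder_ext f g t d : pder f t d -> f =1 g -> pder g t d.
Proof. by move=> + /funext <-. Qed.

Lemma pderD f g t d e : pder f t d -> pder g t e -> pder (fun t => f t + g t) t (d + e).
Proof.
move=> fd ge i; apply: (@cder_ext _ (fun t => (f t)`_i + (g t)`_i)).
  by rewrite coefD; exact: cderD.
by move=> x; rewrite coefD.
Qed.

Lemma pderM f g t d e : pder f t d -> pder g t e ->
  pder (fun t => f t * g t) t (d * g t + f t * e).
Proof.
move=> fd ge i; apply: (@cder_ext _ (fun t => \sum_(j < i.+1) (f t)`_j * (g t)`_(i - j))).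
  by rewrite coefD !coefM -big_split; apply: cder_sum => j; exact: cderM.
by move=> x; rewrite coefM.
Qed.

Lemma pderC (c : R -> C) t d : cder c t d -> pder (fun t => (c t)%:P) t d%:P.
Proof.
move=> cd i; apply: (@cder_ext _ (fun t => if i == 0%N then c t else 0)).
  by rewrite coefC; case: eqP => _ //; exact: cder_cst.
by move=> x; rewrite coefC.
Qed.

Lemma pderX f t d n : pder f t d -> pder (fun x => f x ^+ n) t (n%:R * f t ^+ n.-1 * d).
Proof.
move=> fd; elim: n => [|n IH].
  rewrite !mul0r; apply: (pder_eq (pderC (cder_cst 1 t))); by rewrite polyC0.
apply: (@pder_ext (fun x => f x * f x ^+ n)).
  apply: (pder_eq (pderM fd IH)).
  case: n {IH} => [|n]; first by rewrite /= !expr0; ring.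
  by rewrite /= exprS -[n.+2]addn1 natrD; ring.
by move=> x; rewrite exprS.
Qed.

Implicit Types (u eta theta : 'cV[C]_3) (a b n : nat).

Definition lin_al eta : {poly C} := (eta 0 0)%:P + (eta 1 0)%:P * 'X.
Definition lin_be theta : {poly C} := - (theta 1 0)%:P + (theta 0 0)%:P * 'X.
Definition cvconj u : 'cV[C]_3 := map_mx Num.conj u.
Definition al u := lin_al u.
Definition be u := lin_be (cvconj u).
Definition MM a b u : {poly C} := al u ^+ a * be u ^+ b.
(** The exponents compensate the degrees a and b of [MM], so that every label yields the same
    homogeneity, of degree -(B+1) in u and -(A+1) in conj u. *)
Definition Pexp a : int := - (B + 1 + a%:Z).
Definition Qexp b : int := - (A + 1 + b%:Z).
Definition radH a b u : C := (u 2 0) ^ (Pexp a) * ((u 2 0)^*) ^ (Qexp b).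
Definition Hp a b u : {poly C} := (radH a b u)%:P * MM a b u.
(* In the notation of the statement, [lambda + delta = 2 B],
   [lambda - delta = 2 A], and the functions [F a b n], [n <= a + b], span the
   K-type [(k, l) = (a + b, b - a)]. *)
Definition F a b n : funG R := fun g => if `[< SU21 g >] then (Hp a b (pt g))`_n else 0.

(** The differential of [Hp] in Wirtinger form: [eta] is the variation of u and [theta] that of conj
    u. They are kept independent so that matrix units, which lie outside the real Lie algebra, can
    be inserted. *)
Definition DHp a b u eta theta : {poly C} :=
  ((Pexp a)%:~R * (u 2 0)^-1 * eta 2 0
   + (Qexp b)%:~R * ((u 2 0)^*)^-1 * theta 2 0)%:P * Hp a b u
  + (radH a b u)%:P * (a%:R * al u ^+ a.-1 * lin_al eta * be u ^+ b
                      + al u ^+ a * (b%:R * be u ^+ b.-1 * lin_be theta)).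

Lemma exprzB1 (K : fieldType) (x : K) (m : int) : x != 0 -> x ^ (m - 1) = x ^ m * x^-1.
Proof. by move=> x0; rewrite expfzDr // exprN1. Qed.

Lemma Hp_der a b (u : R -> 'cV[C]_3) t eta : mxder u t eta -> u t 2 0 != 0 ->
  pder (fun t => Hp a b (u t)) t (DHp a b (u t) eta (cvconj eta)).
Proof.
move=> ud u0.
have u0c : (u t 2 0)^* != 0 by rewrite conjC_eq0.
have pX : pder (fun=> 'X) t 0.
  by move=> i; rewrite coef0; exact: cder_cst.
have ald : pder (fun t => al (u t)) t (lin_al eta).
  apply: (pder_eq (pderD (pderC (ud 0 0)) (pderM (pderC (ud 1 0)) pX))).
  by rewrite mulr0 addr0.
have bed : pder (fun t => be (u t)) t (lin_be (cvconj eta)).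
  apply: (@pder_ext (fun t => (-1)%:P * ((u t 1 0)^*)%:P + ((u t 0 0)^*)%:P * 'X)).
    have m1 : pder (fun=> (-1)%:P) t 0 by move=> i; rewrite coef0; exact: cder_cst.
    apply: (pder_eq (pderD (pderM m1 (pderC (cder_conj (ud 1 0))))
       (pderM (pderC (cder_conj (ud 0 0))) pX))).
    by rewrite mulr0 addr0 mul0r add0r /lin_be !mxE polyCN mulN1r.
  by move=> x; rewrite /be /lin_be !mxE polyCN mulN1r.
have rd : cder (fun t => radH a b (u t)) t
   (((Pexp a)%:~R * (u t 2 0)^-1 * eta 2 0 + (Qexp b)%:~R * ((u t 2 0)^*)^-1 * (cvconj eta) 2 0)
    * radH a b (u t)).
  apply: (cder_eq (cderM (cderXz (Pexp a) u0 (ud 2 0)) (@cderXz _ (fun t => (u t 2 0)^*) _ _ (Qexp b) u0c (cder_conj (ud 2 0))))).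
  by rewrite !exprzB1 // /radH mxE; ring.
apply: (pder_eq (pderM (pderC rd) (pderM (pderX a ald) (pderX b bed)))).
rewrite /DHp /Hp /MM polyCM; ring.
Qed.

Lemma DHp_linear a b u n : exists (c d : 'I_3 -> C), forall eta theta,
  (DHp a b u eta theta)`_n = \sum_i c i * eta i 0 + \sum_i d i * theta i 0.
Proof.
pose r := radH a b u.
pose pa : {poly C} := r%:P * (a%:R * al u ^+ a.-1 * be u ^+ b).
pose pb : {poly C} := r%:P * (al u ^+ a * (b%:R * be u ^+ b.-1)).
exists (fun i => if i == 0 then pa`_n else if i == 1 then ('X * pa)`_n
  else (Pexp a)%:~R * (u 2 0)^-1 * (Hp a b u)`_n),
 (fun i => if i == 0 then ('X * pb)`_n else if i == 1 then - pb`_n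
  else (Qexp b)%:~R * ((u 2 0)^*)^-1 * (Hp a b u)`_n) => eta theta.
have -> : DHp a b u eta theta =
  ((Pexp a)%:~R * (u 2 0)^-1 * eta 2 0
   + (Qexp b)%:~R * ((u 2 0)^*)^-1 * theta 2 0)%:P * Hp a b u
  + ((eta 0 0)%:P * pa + (eta 1 0)%:P * ('X * pa)
  + ((theta 0 0)%:P * ('X * pb) - (theta 1 0)%:P * pb)).
  by rewrite /DHp /pa /pb /lin_al /lin_be /r; ring.
rewrite !sum3 /= !coefD coefN !coefCM; ring.
Qed.

(** The sign in conj X_ij = s_ij X_ji on su(2,1), that is, skew-hermitian symmetry with respect to J
    written entrywise. *)
Definition esign (i j : 'I_3) : C := if (i == 2) (+) (j == 2) then 1 else -1.

(** The complex-linear extension of X -> X u to the matrix unit E_ij: u varies by u_j e_i, and since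
    conj (X u)_j is the sum over i of s_ij X_ij conj u_i, the conjugate varies by s_ij conj u_i
    e_j. *)
Definition EE (i j : 'I_3) a b u : {poly C} :=
  DHp a b u (u j 0 *: delta_mx i 0) ((esign i j * (u i 0)^*) *: delta_mx j 0).

Lemma su21_conj (X : M3) i j : su21 X -> (X i j)^* = esign i j * X j i.
Proof.
move=> [/matrixP X1 _]; have := X1 j i.
rewrite [LHS]mxE [RHS]mxE !mulmx33 !adjmxE !matJE.
by elim/ord3P: i; elim/ord3P: j; rewrite /= /esign /= ?(mulr0, mul0r, mulr1, mul1r, add0r, addr0, mulrN1, mulN1r) => /eqP;
  rewrite ?addr_eq0 ?subr_eq0 ?eqr_opp ?eqr_oppLR => /eqP // ->; rewrite ?opprK.
Qed.

Lemma DHp_su21 a b u n (X : M3) : su21 X ->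
  (DHp a b u (- X *m u) (cvconj (- X *m u)))`_n =
  - \sum_i \sum_j X i j * (EE i j a b u)`_n.
Proof.
move=> Xs; have [c [d cd]] := DHp_linear a b u n.
have e1 i : (- X *m u) i 0 = - (X i 0 * u 0 0 + X i 1 * u 1 0 + X i 2 * u 2 0).
  by rewrite mulNmx !mxE sum3.
have e2 i : (cvconj (- X *m u)) i 0 = - (esign i 0 * X 0 i * (u 0 0)^* +
    esign i 1 * X 1 i * (u 1 0)^* + esign i 2 * X 2 i * (u 2 0)^*).
  rewrite /cvconj mxE e1 rmorphN !rmorphD !rmorphM /=.
  by rewrite !(su21_conj _ _ Xs).
have e3 i j : (EE i j a b u)`_n = c i * u j 0 + d j * (esign i j * (u i 0)^*).
  rewrite /EE cd; congr (_ + _).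
    rewrite (bigD1 i) //= big1 ?addr0; first by rewrite !mxE !eqxx mulr1.
    by move=> l /negPf li; rewrite !mxE li mulr0 mulr0.
  rewrite (bigD1 j) //= big1 ?addr0; first by rewrite !mxE !eqxx mulr1.
  by move=> l /negPf li; rewrite !mxE li mulr0 mulr0.
under [X in _ = - X]eq_bigr do under eq_bigr do rewrite e3.
by rewrite cd !sum3 !e1 !e2 /esign /=; ring.
Qed.

Lemma lieact_cder (X : M3) (f : funG R) g d :
  cder (fun t : R => f (expmx (- t%:C%C *: X) *m g)) 0 d -> lieact X f g = d.
Proof.
move=> [h1 h2]; rewrite /lieact !derive1E.
by apply: complexP => /=; [rewrite (@derive_val _ _ _ _ _ _ _ h1) | rewrite (@derive_val _ _ _ _ _ _ _ h2)].
Qed.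

Lemma su21N (X : M3) : su21 X -> su21 (- X).
Proof.
move=> [X1 X2]; split; last by rewrite raddfN /= X2 oppr0.
have -> : adjmx (- X) = - adjmx X by rewrite /adjmx raddfN /= raddfN.
by rewrite mulNmx mulmxN -opprD X1 oppr0.
Qed.

Lemma expNt (X : M3) (t : R) : expmx (- t%:C%C *: X) = expmx (t%:C%C *: - X).
Proof. by rewrite scaleNr scalerN. Qed.

Definition EF (i j : 'I_3) a b n : funG R :=
  fun g => if `[< SU21 g >] then (EE i j a b (pt g))`_n else 0.

Lemma F_in a b n g : SU21 g -> F a b n g = (Hp a b (pt g))`_n.
Proof. by move=> gG; rewrite /F asboolT. Qed.
Lemma F_out a b n g : ~ SU21 g -> F a b n g = 0.
Proof. by move=> gG; rewrite /F asboolF. Qed.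
Lemma EF_in i j a b n g : SU21 g -> EF i j a b n g = (EE i j a b (pt g))`_n.
Proof. by move=> gG; rewrite /EF asboolT. Qed.
Lemma EF_out i j a b n g : ~ SU21 g -> EF i j a b n g = 0.
Proof. by move=> gG; rewrite /EF asboolF. Qed.

Lemma F_cder (X : M3) a b n g : su21 X ->
  cder (fun t : R => F a b n (expmx (- t%:C%C *: X) *m g)) 0
    (- \sum_i \sum_j X i j * EF i j a b n g).
Proof.
move=> Xs; have XN := su21N Xs.
have G t : SU21 (expmx (- t%:C%C *: X) *m g) <-> SU21 g.
  by rewrite expNt; apply: SU21_mulr_iff; exact: expmx_SU21.
case: (asboolP (SU21 g)) => gG; last first.
  rewrite big1 ?oppr0; last first.
    by move=> i _; rewrite big1 // => j _; rewrite /EF asboolF // mulr0.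
  apply: (cder_ext (cder_cst 0 0)) => t; rewrite /F asboolF //.
  by move=> /G.
apply: (@cder_ext _ (fun t : R => (Hp a b (expmx (t%:C%C *: - X) *m pt g))`_n)); last first.
  move=> t; have gt : SU21 (expmx (- t%:C%C *: X) *m g) by apply/G.
  have e : pt (expmx (- t%:C%C *: X) *m g) = expmx (t%:C%C *: - X) *m pt g.
    by rewrite /pt mulmxA expNt.
  by rewrite /F (asboolT gt) e.
have := mxder_mul (mxder_exp (- X) 0) (mxder_cst (pt g) 0).
rewrite scale0r expmx0 mulmx1 mulmx0 addr0 => ud.
have u0 : (expmx ((0 : R)%:C%C *: - X) *m pt g) 2 0 != 0.
  by rewrite scale0r expmx0 mul1mx pt_neq0.
have := Hp_der a b ud u0 n.
rewrite scale0r expmx0 mul1mx DHp_su21 //.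
move=> h; apply: (cder_eq h); congr (- _); apply: eq_bigr => i _; apply: eq_bigr => j _.
by rewrite /EF asboolT.
Qed.

End ConeFunctions.

(** * Multiplication by coordinates and the matrix units on the generating polynomials *)

Section Pieri.
Variable R : realType.
Local Notation C := R[i].
Variables A B : int.
Implicit Types (u : 'cV[C]_3) (a b n : nat).

(** Kept as a parameter of the multiplication formulas because they are used twice: with the value
    |u_3|^2 on the cone and with the value 1 on the unit sphere. *)
Definition rho u : C := u 0 0 * (u 0 0)^* + u 1 0 * (u 1 0)^*.

Lemma alE u : al u = (u 0 0)%:P + (u 1 0)%:P * 'X. Proof. by []. Qed.
Lemma beE u : be u = - ((u 1 0)^*)%:P + ((u 0 0)^*)%:P * 'X.
Proof. by rewrite /be /lin_be !mxE. Qed.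

Lemma deriv_al u : (al u)^`() = (u 1 0)%:P.
Proof. by rewrite alE derivD derivM !derivC derivX mul0r mulr1 !add0r. Qed.
Lemma deriv_be u : (be u)^`() = ((u 0 0)^*)%:P.
Proof. by rewrite beE derivD derivN derivM !derivC derivX mul0r mulr1 oppr0 !add0r. Qed.

Lemma deriv_MM a b u : (MM a b u)^`() =
  a%:R * (u 1 0)%:P * MM a.-1 b u + b%:R * ((u 0 0)^*)%:P * MM a b.-1 u.
Proof.
rewrite /MM derivM !deriv_exp deriv_al deriv_be; ring.
Qed.

(** The Wronskian of the two linear forms, whose derivatives are u_2 and conj u_1; it is a constant
    polynomial and is the source of all the rules below. *)
Lemma al_be u : ((u 0 0)^*)%:P * al u - (u 1 0)%:P * be u = (rho u)%:P.
Proof. rewrite alE beE /rho polyCD !polyCM; ring. Qed.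

Lemma MMSl a b u : MM a.+1 b u = al u * MM a b u.
Proof. by rewrite /MM exprS; ring. Qed.
Lemma MMSr a b u : MM a b.+1 u = be u * MM a b u.
Proof. by rewrite /MM exprS; ring. Qed.

Local Notation k1 a b := ((a + b).+1%:R).

Lemma nat1E (T : pzRingType) n : n.+1%:R = n%:R + 1 :> T.
Proof. by rewrite -natr1. Qed.

(** A Clebsch-Gordan rule. The derivative on the right is a u_2 M(a-1, b+1) + (b+1) conj u_1 M(a,
    b), and the Wronskian turns u_2 M(a-1, b+1) into conj u_1 M(a, b) - rho M(a-1, b). The multiple
    a + b + 1 of the left side avoids denominators. *)
Lemma pieri_bar0 a b u : k1 a b * (((u 0 0)^*)%:P * MM a b u) =
  (MM a b.+1 u)^`() + a%:R * (rho u)%:P * MM a.-1 b u.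
Proof.
rewrite deriv_MM /= -al_be -addn1 !natrD !nat1E.
case: a => [|a] /=; rewrite ?MMSr ?MMSl ?nat1E; ring.
Qed.

Lemma pieri_bar1 a b u : k1 a b * (((u 1 0)^*)%:P * MM a b u) =
  'X * ((MM a b.+1 u)^`() + a%:R * (rho u)%:P * MM a.-1 b u) - k1 a b * MM a b.+1 u.
Proof.
rewrite -pieri_bar0 MMSr [be u in RHS]beE; ring.
Qed.

Lemma pieri_1 a b u : k1 a b * ((u 1 0)%:P * MM a b u) =
  (MM a.+1 b u)^`() - b%:R * (rho u)%:P * MM a b.-1 u.
Proof.
rewrite deriv_MM /= -al_be -addn1 !natrD !nat1E.
case: b => [|b] /=; rewrite ?MMSr ?MMSl ?nat1E; ring.
Qed.

Lemma pieri_0 a b u : k1 a b * ((u 0 0)%:P * MM a b u) =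
  k1 a b * MM a.+1 b u - 'X * ((MM a.+1 b u)^`() - b%:R * (rho u)%:P * MM a b.-1 u).
Proof.
rewrite -pieri_1 MMSl [al u in RHS]alE; ring.
Qed.

Lemma rad_Sl a b u : u 2 0 != 0 -> radH A B a b u = radH A B a.+1 b u * u 2 0.
Proof.
move=> u0; rewrite /radH (_ : Pexp B a = Pexp B a.+1 + 1) ?expfzDr //; last first.
  by rewrite /Pexp; lia.
by rewrite expr1z; ring.
Qed.

Lemma rad_Sr a b u : u 2 0 != 0 -> radH A B a b u = radH A B a b.+1 u * (u 2 0)^*.
Proof.
move=> u0; rewrite /radH (_ : Qexp A b = Qexp A b.+1 + 1) ?expfzDr ?conjC_eq0 //; last first.
  by rewrite /Qexp; lia.
by rewrite expr1z; ring.
Qed.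

Lemma rad_Vl a b u : u 2 0 != 0 -> radH A B a b u * (u 2 0)^-1 = radH A B a.+1 b u.
Proof. by move=> u0; rewrite (rad_Sl a b u0) mulfK. Qed.

Lemma rad_Vr a b u : u 2 0 != 0 -> radH A B a b u * ((u 2 0)^*)^-1 = radH A B a b.+1 u.
Proof. by move=> u0; rewrite (rad_Sr a b u0) mulfK // conjC_eq0. Qed.

Lemma deriv_Hp a b u : (Hp A B a b u)^`() = (radH A B a b u)%:P * (MM a b u)^`().
Proof. by rewrite /Hp derivM derivC mul0r add0r. Qed.

Lemma scale_deltaE (x : C) (i k : 'I_3) :
  (x *: delta_mx i 0 : 'cV[C]_3) k 0 = if k == i then x else 0.
Proof. by rewrite !mxE eqxx andbT; case: eqP => _; rewrite ?mulr1 ?mulr0. Qed.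

Lemma intrP (n : int) : (n%:~R : C)%:P = n%:~R. Proof. exact: rmorph_int. Qed.

Definition LA (i : 'I_3) (x : C) : {poly C} :=
  if i == 0 then x%:P else if i == 1 then x%:P * 'X else 0.
Definition LB (i : 'I_3) (x : C) : {poly C} :=
  if i == 0 then x%:P * 'X else if i == 1 then - x%:P else 0.

Lemma lin_al_delta i x : lin_al (x *: delta_mx i 0) = LA i x.
Proof.
by rewrite /lin_al !scale_deltaE; elim/ord3P: i; rewrite /LA /= ?polyC0 ?mul0r ?addr0 ?add0r.
Qed.

Lemma lin_be_delta i x : lin_be (x *: delta_mx i 0) = LB i x.
Proof.
by rewrite /lin_be !scale_deltaE; elim/ord3P: i; rewrite /LB /= ?polyC0 ?mul0r ?oppr0 ?addr0 ?add0r.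
Qed.

Lemma EE_split i j a b u : EE A B i j a b u =
  ((Pexp B a)%:~R * (u 2 0)^-1 * (if 2 == i then u j 0 else 0)
   + (Qexp A b)%:~R * ((u 2 0)^*)^-1 * (if 2 == j then esign _ i j * (u i 0)^* else 0))%:P
    * Hp A B a b u
  + (radH A B a b u)%:P * (a%:R * al u ^+ a.-1 * LA i (u j 0) * be u ^+ b
    + al u ^+ a * (b%:R * be u ^+ b.-1 * LB j (esign _ i j * (u i 0)^*))).
Proof. by rewrite /EE /DHp lin_al_delta lin_be_delta !scale_deltaE. Qed.

Ltac evalEE := rewrite EE_split /LA /LB /esign /=.

Ltac genEE A B u a b := move: (alE u) (beE u); move: (al u) (be u) => p q;
  move: (u 0 0) (u 1 0) (u 2 0) (radH A B a b u) => x y z r pE qE.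

Lemma mulV_Hp a b u : u 2 0 != 0 -> ((u 2 0)^-1)%:P * Hp A B a b u = (radH A B a.+1 b u)%:P * MM a b u.
Proof. by move=> u0; rewrite /Hp mulrA -polyCM [_^-1 * _]mulrC rad_Vl. Qed.
Lemma mulVc_Hp a b u : u 2 0 != 0 -> (((u 2 0)^*)^-1)%:P * Hp A B a b u = (radH A B a b.+1 u)%:P * MM a b u.
Proof. by move=> u0; rewrite /Hp mulrA -polyCM [_^-1 * _]mulrC rad_Vr. Qed.

(** The upper-left block and E_22 span the complexified Lie algebra of U(2) x U(1), so the five
    formulas from here on keep the label and act by the standard first-order operators on binary
    forms of degree a + b. *)
Lemma EE00 a b u : EE A B 0 0 a b u = a%:R * Hp A B a b u - 'X * (Hp A B a b u)^`().
Proof.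
evalEE; rewrite deriv_Hp deriv_MM /Hp /MM; genEE A B u a b.
have -> : x%:P = p - y%:P * 'X by rewrite pE; ring.
by case: a => [|a] /=; rewrite ?exprS; ring.
Qed.

Lemma EE11 a b u : EE A B 1 1 a b u = 'X * (Hp A B a b u)^`() - b%:R * Hp A B a b u.
Proof.
evalEE; rewrite deriv_Hp deriv_MM /Hp /MM; genEE A B u a b.
rewrite mulN1r polyCN opprK (_ : (y^*)%:P = (x^*)%:P * 'X - q); last by rewrite qE; ring.
by case: b => [|b] /=; rewrite ?exprS; ring.
Qed.

Lemma EE22 a b u : u 2 0 != 0 -> EE A B 2 2 a b u = (Pexp B a - Qexp A b)%:~R * Hp A B a b u.
Proof.
move=> u0; evalEE; rewrite mulfVK // mulN1r mulrN mulfVK ?conjC_eq0 // -intrN -intrD intrP; ring.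
Qed.

Lemma EE01 a b u : EE A B 0 1 a b u = (Hp A B a b u)^`().
Proof.
evalEE; rewrite deriv_Hp deriv_MM /Hp /MM; genEE A B u a b; ring.
Qed.

Lemma EE10 a b u : EE A B 1 0 a b u = (a + b)%:R * 'X * Hp A B a b u - 'X ^+ 2 * (Hp A B a b u)^`().
Proof.
evalEE; rewrite deriv_Hp deriv_MM /Hp /MM; genEE A B u a b.
have -> : x%:P = p - y%:P * 'X by rewrite pE; ring.
rewrite mulN1r polyCN (_ : (y^*)%:P = (x^*)%:P * 'X - q); last by rewrite qE; ring.
by case: a => [|a]; case: b => [|b] /=; rewrite ?exprS ?natrD; ring.
Qed.

(** Differentiating the power of conj u_3 and applying the multiplication rule contributes -(A + 1 +
    b) a to the label (a-1, b), and the Leibniz term on the a-th power contributes a (a + b + 1);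
    the sum is a (a - A). The null condition is what lets the two be added, as it identifies their
    radial factors. *)
Lemma EE02 a b u : u 2 0 != 0 -> null u -> k1 a b * EE A B 0 2 a b u =
  (a%:Z * (a%:Z - A))%:~R * Hp A B a.-1 b u + (Qexp A b)%:~R * (Hp A B a b.+1 u)^`().
Proof.
move=> u0 un; have rE : rho u = u 2 0 * (u 2 0)^* by exact: un.
evalEE.
transitivity ((Qexp A b)%:~R * ((u 0 0)^*)%:P * k1 a b * ((((u 2 0)^*)^-1)%:P * Hp A B a b u)
   + k1 a b * a%:R * (radH A B a b u * u 2 0)%:P * MM a.-1 b u).
  by rewrite /MM; move: (Hp A B a b u) => h; rewrite -!intrP; genEE A B u a b; ring.
rewrite mulVc_Hp // deriv_Hp.
have -> : (Qexp A b)%:~R * ((u 0 0)^*)%:P * k1 a b * ((radH A B a b.+1 u)%:P * MM a b u) =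
  (Qexp A b)%:~R * (radH A B a b.+1 u)%:P * (k1 a b * (((u 0 0)^*)%:P * MM a b u)) by ring.
rewrite pieri_bar0 rE.
have -> : (radH A B a b u) = radH A B a b.+1 u * (u 2 0)^* by rewrite -rad_Sr.
case: a => [|a]; first by rewrite /= !mul0r; ring.
rewrite /= /Hp (rad_Sl a b u0) (rad_Sr a.+1 b u0) !polyCM /Qexp.
move: (radH A B a.+1 b.+1 u) (MM a b u) (MM a.+1 b.+1 u)^`() (MM a.+1 b.+1 u) (u 2 0) => r m m' m1 z.
rewrite rmorphM rmorphB /= rmorphN !rmorphD /= -!pmulrn -[in k1 _ _]addn1 !natrD !nat1E /=; ring.
Qed.

Lemma EE12 a b u : u 2 0 != 0 -> null u -> k1 a b * EE A B 1 2 a b u =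
  (a%:Z * (a%:Z - A))%:~R * 'X * Hp A B a.-1 b u
  + (Qexp A b)%:~R * ('X * (Hp A B a b.+1 u)^`() - k1 a b * Hp A B a b.+1 u).
Proof.
move=> u0 un; have rE : rho u = u 2 0 * (u 2 0)^* by exact: un.
evalEE.
transitivity ((Qexp A b)%:~R * ((u 1 0)^*)%:P * k1 a b * ((((u 2 0)^*)^-1)%:P * Hp A B a b u)
   + k1 a b * a%:R * 'X * (radH A B a b u * u 2 0)%:P * MM a.-1 b u).
  by rewrite /MM; move: (Hp A B a b u) => h; rewrite -!intrP; genEE A B u a b; ring.
rewrite mulVc_Hp // deriv_Hp.
have -> : (Qexp A b)%:~R * ((u 1 0)^*)%:P * k1 a b * ((radH A B a b.+1 u)%:P * MM a b u) =
  (Qexp A b)%:~R * (radH A B a b.+1 u)%:P * (k1 a b * (((u 1 0)^*)%:P * MM a b u)) by ring.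
rewrite pieri_bar1 rE.
have -> : (radH A B a b u) = radH A B a b.+1 u * (u 2 0)^* by rewrite -rad_Sr.
case: a => [|a]; first by rewrite /= /Hp !mul0r; ring.
rewrite /= /Hp (rad_Sl a b u0) (rad_Sr a.+1 b u0) !polyCM /Qexp.
move: (radH A B a.+1 b.+1 u) (MM a b u) (MM a.+1 b.+1 u)^`() (MM a.+1 b.+1 u) (u 2 0) => r m m' m1 z.
rewrite rmorphM rmorphB /= rmorphN !rmorphD /= -!pmulrn -[in k1 _ _]addn1 !natrD !nat1E /=; ring.
Qed.

Lemma EE20 a b u : u 2 0 != 0 -> null u -> k1 a b * EE A B 2 0 a b u =
  (b%:Z * (b%:Z - B))%:~R * 'X * Hp A B a b.-1 u
  + (Pexp B a)%:~R * (k1 a b * Hp A B a.+1 b u - 'X * (Hp A B a.+1 b u)^`()).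
Proof.
move=> u0 un; have rE : rho u = u 2 0 * (u 2 0)^* by exact: un.
evalEE.
transitivity ((Pexp B a)%:~R * (u 0 0)%:P * k1 a b * (((u 2 0)^-1)%:P * Hp A B a b u)
   + k1 a b * b%:R * 'X * (radH A B a b u * (u 2 0)^*)%:P * MM a b.-1 u).
  by rewrite /MM; move: (Hp A B a b u) => h; rewrite -!intrP; genEE A B u a b; ring.
rewrite mulV_Hp // deriv_Hp.
have -> : (Pexp B a)%:~R * (u 0 0)%:P * k1 a b * ((radH A B a.+1 b u)%:P * MM a b u) =
  (Pexp B a)%:~R * (radH A B a.+1 b u)%:P * (k1 a b * ((u 0 0)%:P * MM a b u)) by ring.
rewrite pieri_0 rE.
have -> : (radH A B a b u) = radH A B a.+1 b u * (u 2 0) by rewrite -rad_Sl.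
case: b => [|b]; first by rewrite /= /Hp !mul0r; ring.
rewrite /= /Hp (rad_Sl a b u0) (rad_Sr a.+1 b u0) !polyCM /Pexp.
move: (radH A B a.+1 b.+1 u) (MM a b u) (MM a.+1 b.+1 u)^`() (MM a.+1 b.+1 u) (u 2 0) => r m m' m1 z.
rewrite rmorphM rmorphB /= rmorphN !rmorphD /= -!pmulrn -[in k1 _ _]addn1 !natrD !nat1E /=; ring.
Qed.

Lemma EE21 a b u : u 2 0 != 0 -> null u -> k1 a b * EE A B 2 1 a b u =
  - (b%:Z * (b%:Z - B))%:~R * Hp A B a b.-1 u + (Pexp B a)%:~R * (Hp A B a.+1 b u)^`().
Proof.
move=> u0 un; have rE : rho u = u 2 0 * (u 2 0)^* by exact: un.
evalEE.
transitivity ((Pexp B a)%:~R * (u 1 0)%:P * k1 a b * (((u 2 0)^-1)%:P * Hp A B a b u)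
   - k1 a b * b%:R * (radH A B a b u * (u 2 0)^*)%:P * MM a b.-1 u).
  by rewrite /MM; move: (Hp A B a b u) => h; rewrite -!intrP; genEE A B u a b; ring.
rewrite mulV_Hp // deriv_Hp.
have -> : (Pexp B a)%:~R * (u 1 0)%:P * k1 a b * ((radH A B a.+1 b u)%:P * MM a b u) =
  (Pexp B a)%:~R * (radH A B a.+1 b u)%:P * (k1 a b * ((u 1 0)%:P * MM a b u)) by ring.
rewrite pieri_1 rE.
have -> : (radH A B a b u) = radH A B a.+1 b u * (u 2 0) by rewrite -rad_Sl.
case: b => [|b]; first by rewrite /= /Hp !mul0r; ring.
rewrite /= /Hp (rad_Sl a b u0) (rad_Sr a.+1 b u0) !polyCM /Pexp.
move: (radH A B a.+1 b.+1 u) (MM a b u) (MM a.+1 b.+1 u)^`() (MM a.+1 b.+1 u) (u 2 0) => r m m' m1 z.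
rewrite rmorphM rmorphB /= rmorphN !rmorphD /= -!pmulrn -[in k1 _ _]addn1 !natrD !nat1E /=; ring.
Qed.

End Pieri.

(** * The action of K *)

Section KAction.
Variable R : realType.
Local Notation C := R[i].
Variables A B : int.
Implicit Types (u : 'cV[C]_3) (a b n : nat) (U : 'M[C]_2).

Lemma KembE U : (Kemb U 0 0 = U 0 0) * (Kemb U 0 1 = U 0 1) * (Kemb U 0 2 = 0) *
  (Kemb U 1 0 = U 1 0) * (Kemb U 1 1 = U 1 1) * (Kemb U 1 2 = 0) *
  (Kemb U 2 0 = 0) * (Kemb U 2 1 = 0) * (Kemb U 2 2 = (\det U)^-1).
Proof.
have e0 : (0 : 'I_3) = lshift 1 (0 : 'I_2) by exact: val_inj.
have e1 : (1 : 'I_3) = lshift 1 (1 : 'I_2) by exact: val_inj.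
have e2 : (2 : 'I_3) = rshift 2 (0 : 'I_1) by exact: val_inj.
have ul (i j : 'I_2) : Kemb U (lshift 1 i) (lshift 1 j) = U i j by exact: block_mxEul.
have ur (i : 'I_2) (j : 'I_1) : Kemb U (lshift 1 i) (rshift 2 j) = 0.
  by apply: etrans (block_mxEur _ _ _ _ _ _) _; rewrite mxE.
have dl (i : 'I_1) (j : 'I_2) : Kemb U (rshift 2 i) (lshift 1 j) = 0.
  by apply: etrans (block_mxEdl _ _ _ _ _ _) _; rewrite mxE.
have dr : Kemb U (rshift 2 0) (rshift 2 0) = (\det U)^-1.
  by apply: etrans (block_mxEdr _ _ _ _ _ _) _; rewrite mxE eqxx mulr1n.
have c2 i j i' j' x : i = i' -> j = j' -> Kemb U i' j' = x -> Kemb U i j = x.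
  by move=> -> ->.
by do !split; [apply: (c2 _ _ _ _ _ e0 e0 (ul 0 0))
  | apply: (c2 _ _ _ _ _ e0 e1 (ul 0 1)) | apply: (c2 _ _ _ _ _ e0 e2 (ur 0 0))
  | apply: (c2 _ _ _ _ _ e1 e0 (ul 1 0)) | apply: (c2 _ _ _ _ _ e1 e1 (ul 1 1))
  | apply: (c2 _ _ _ _ _ e1 e2 (ur 1 0)) | apply: (c2 _ _ _ _ _ e2 e0 (dl 0 0))
  | apply: (c2 _ _ _ _ _ e2 e1 (dl 0 1)) | apply: (c2 _ _ _ _ _ e2 e2 dr)].
Qed.

Lemma pt_Kemb U : (pt (Kemb U) 0 0 = U 0 0) * (pt (Kemb U) 1 0 = U 1 0) *
  (pt (Kemb U) 2 0 = (\det U)^-1).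
Proof. by rewrite !ptE !KembE !addr0 add0r. Qed.

Lemma Kemb_mulE U u : ((Kemb U *m u) 0 0 = U 0 0 * u 0 0 + U 0 1 * u 1 0) *
  ((Kemb U *m u) 1 0 = U 1 0 * u 0 0 + U 1 1 * u 1 0) *
  ((Kemb U *m u) 2 0 = (\det U)^-1 * u 2 0).
Proof. by rewrite !mulmx_entry !sum3 !KembE !mul0r !addr0 !add0r. Qed.

Lemma KembM U V : Kemb U *m Kemb V = Kemb (U *m V).
Proof.
apply: mx33P; rewrite mulmx33 !KembE ?mulmx_entry ?sum2 ?(mul0r, mulr0, addr0, add0r) //.
by rewrite det_mulmx invfM.
Qed.

Lemma Kemb1 : Kemb (1%:M : 'M[C]_2) = 1%:M.
Proof. by apply: mx33P; rewrite KembE ?det1 ?invr1 !mxE. Qed.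

Lemma U2_eqs U : U2 U ->
  [/\ U 0 0 * (U 0 0)^* + U 1 0 * (U 1 0)^* = 1,
      \det U * (U 0 0)^* = U 1 1,
      \det U * (U 1 0)^* = - U 0 1 &
      \det U * (\det U)^* = 1].
Proof.
move=> /matrixP UU.
have e i j : (U 0 i)^* * U 0 j + (U 1 i)^* * U 1 j = (i == j)%:R.
  by have := UU i j; rewrite mulmx_entry sum2 !adjmxE => ->; rewrite mxE.
have e00 : U 0 0 * (U 0 0)^* + U 1 0 * (U 1 0)^* = 1 by rewrite -[RHS](e 0 0); ring.
have e01 : (U 0 0)^* * U 0 1 = - ((U 1 0)^* * U 1 1).
  by apply/eqP; rewrite -addr_eq0; apply/eqP; exact: (e 0 1).
have f1 : \det U * (U 0 0)^* = U 1 1.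
  rewrite det22; transitivity (U 0 0 * (U 0 0)^* * U 1 1 - U 1 0 * ((U 0 0)^* * U 0 1)).
    by ring.
  by rewrite e01 -[RHS]mul1r -e00; ring.
have f2 : \det U * (U 1 0)^* = - U 0 1.
  rewrite det22; transitivity (- (U 1 0 * (U 1 0)^* * U 0 1 + U 0 0 * (- ((U 1 0)^* * U 1 1)))).
    by ring.
  by rewrite -e01 -[in RHS](mul1r (U 0 1)) -e00; ring.
split => //.
rewrite -[RHS]e00 [in RHS]addrC; have := congr1 Num.conj f1; have := congr1 Num.conj f2.
rewrite !rmorphM rmorphN /= !conjCK => g2 g1.
rewrite -[LHS]mulr1 -e00.
have -> : \det U * (\det U)^* * (U 0 0 * (U 0 0)^* + U 1 0 * (U 1 0)^*) =
  \det U * (U 0 0)^* * ((\det U)^* * U 0 0) + \det U * (U 1 0)^* * ((\det U)^* * U 1 0) by ring.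
rewrite f1 f2 g1 g2.
have e11 := e 1 1; rewrite /= in e11.
rewrite [RHS]addrC e00 -[RHS]e11; ring.
Qed.

Lemma U2_det_neq0 U : U2 U -> \det U != 0.
Proof.
by move=> /U2_eqs[_ _ _ dd]; apply/eqP => d0; move/eqP: dd; rewrite d0 mul0r eq_sym oner_eq0.
Qed.

Lemma U2_unit U : U2 U -> U \in unitmx.
Proof. by move=> /U2_det_neq0 d0; rewrite unitmxE unitfE. Qed.

Lemma U2_invE U : U2 U -> invmx U = adjmx U.
Proof.
move=> UU; have Uu := U2_unit UU.
by rewrite -[adjmx U]mulmx1 -(mulmxV Uu) mulmxA UU mul1mx.
Qed.

Lemma U2_inv U : U2 U -> U2 (invmx U).
Proof.
by move=> UU; rewrite /U2 /= {1}U2_invE // adjmxK mulmxV // U2_unit.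
Qed.

Lemma U2_mul U V : U2 U -> U2 V -> U2 (U *m V).
Proof.
by rewrite /U2 /= => UU VV; rewrite adjmxM -mulmxA (mulmxA (adjmx U)) UU mul1mx.
Qed.

Lemma Kemb_inv U : U2 U -> invmx (Kemb U) = Kemb (invmx U).
Proof.
move=> UU; have Uu := U2_unit UU.
have e : Kemb (invmx U) *m Kemb U = 1%:M by rewrite KembM mulVmx // Kemb1.
have [Ku _] := mulmx1_unit e.
have ku : Kemb U \in unitmx by have [] := mulmx1_unit e.
by rewrite -[LHS]mul1mx -e -mulmxA mulmxV // mulmx1.
Qed.

Lemma Kemb_SU21 U : U2 U -> SU21 (Kemb U).
Proof.
move=> UU; have d0 := U2_det_neq0 UU; split; last first.
  by rewrite det33 !KembE !(mulr0, mul0r, subr0, addr0, add0r) !mulrA -mulrBl -det22 mulfV.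
have [_ _ _ dd] := U2_eqs UU.
have e i j : (U 0 i)^* * U 0 j + (U 1 i)^* * U 1 j = (i == j)%:R.
  by move/matrixP: UU => /(_ i j); rewrite mulmx_entry sum2 !adjmxE => ->; rewrite mxE.
apply: mx33P; rewrite !mulmx33 !adjmxE !matJE !KembE /=
  ?(conjC0, mulr0, mul0r, addr0, add0r, mulr1) ?e //.
by rewrite mulrN1 mulNr fmorphV -invfM mulrC dd invr1.
Qed.

Lemma size_linear_exp (v v' : C) n : (size ((v%:P + v'%:P * 'X) ^+ n)%R <= n.+1)%N.
Proof.
elim: n => [|n IH]; first by rewrite expr0 size_poly1.
rewrite exprS; apply: leq_trans (size_polyMleq _ _) _.
have h : (size (v%:P + v'%:P * 'X)%R <= 2)%N.
  apply: leq_trans (size_polyD _ _) _; rewrite geq_max; apply/andP; split.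
    by apply: leq_trans (size_polyC_leq1 _) _.
  apply: leq_trans (size_polyMleq _ _) _; rewrite size_polyX addn2 /=.
  exact: size_polyC_leq1.
lia.
Qed.

Section Homogenize.
Variables (T : comNzRingType) (phi : {rmorphism C -> T}) (s r : T).

(** The binary form of degree k with the coefficients of p, evaluated at (s, r). The ring T is the
    ring of polynomials for the action of K on the basis, and the complex numbers for the values of
    [pirep]. *)
Definition homog k (p : {poly C}) : T := \sum_(m < k.+1) phi p`_m * s ^+ (k - m) * r ^+ m.

Lemma homog_linear (x y : C) k (p : {poly C}) : (size p <= k.+1)%N ->
  homog k.+1 ((x%:P + y%:P * 'X) * p) = (phi x * s + phi y * r) * homog k p.
Proof.
move=> pk.
have cE m : ((x%:P + y%:P * 'X) * p)`_m = x * p`_m + y * (if m is j.+1 then p`_j else 0).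
  by rewrite mulrDl coefD -mulrA !coefCM coefXM; case: m.
rewrite /homog; under eq_bigr do rewrite cE rmorphD !rmorphM !mulrDl.
rewrite big_split /= mulrDl; congr (_ + _).
  rewrite big_ord_recr /= nth_default // rmorph0 mulr0 !mul0r addr0 mulr_sumr.
  by apply: eq_bigr => m _; rewrite subSn ?exprS; [ring | rewrite -ltnS ltn_ord].
rewrite big_ord_recl /= rmorph0 mulr0 !mul0r add0r mulr_sumr.
by apply: eq_bigr => m _; rewrite /bump /= add1n subSS exprS; ring.
Qed.

Lemma homog_MM (x y z w : C) a b :
  (phi x * s + phi y * r) ^+ a * (phi z * s + phi w * r) ^+ b =
  homog (a + b) ((x%:P + y%:P * 'X) ^+ a * (z%:P + w%:P * 'X) ^+ b).
Proof.
elim: a => [|a IH].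
  rewrite !mul1r add0n; elim: b => [|b IH].
    by rewrite /homog big_ord1 !expr0 coef1 rmorph1 !mulr1.
  by rewrite !exprS IH homog_linear ?size_linear_exp.
rewrite addSn !exprS -!mulrA IH homog_linear //.
apply: leq_trans (size_polyMleq _ _) _.
by apply: (@leq_trans (a.+1 + b.+1).-1); [rewrite -!subn1 leq_sub2r // leq_add ?size_linear_exp | rewrite addnS].
Qed.

End Homogenize.

Lemma be_conj u : be u = (- (u 1 0)^*)%:P + ((u 0 0)^*)%:P * 'X.
Proof. by rewrite beE polyCN. Qed.

Lemma size_MM a b u : (size (MM a b u) <= (a + b).+1)%N.
Proof.
rewrite /MM alE be_conj; apply: leq_trans (size_polyMleq _ _) _.
by apply: (@leq_trans (a.+1 + b.+1).-1); [rewrite -!subn1 leq_sub2r // leq_add ?size_linear_exp | rewrite addnS].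
Qed.

Lemma F_over a b n : (a + b < n)%N -> F A B a b n = fun=> 0 :> C.
Proof.
move=> kn; apply/funext => g; rewrite /F; case: asboolP => // _.
by rewrite /Hp coefCM nth_default ?mulr0 //; exact: leq_trans (size_MM _ _ _) _.
Qed.

(** Both linear forms undergo the same linear substitution, the second with the extra factor 1 / det
    U; hence the translate of a coefficient is a combination of coefficients with the same label. *)
Lemma MM_Kemb a b u U : U2 U ->
  MM a b (Kemb U *m u) = ((\det U)^-1 ^+ b)%:P *
   homog (polyC : {rmorphism C -> {poly C}}) ((U 0 0)%:P + (U 1 0)%:P * 'X)
     ((U 0 1)%:P + (U 1 1)%:P * 'X) (a + b) (MM a b u).
Proof.
move=> UU; have d0 := U2_det_neq0 UU; have [_ e1 e2 dd] := U2_eqs UU.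
rewrite {2}/MM alE be_conj -homog_MM /MM.
have -> : al (Kemb U *m u) = (u 0 0)%:P * ((U 0 0)%:P + (U 1 0)%:P * 'X)
   + (u 1 0)%:P * ((U 0 1)%:P + (U 1 1)%:P * 'X).
  by rewrite alE !Kemb_mulE; ring.
have -> : be (Kemb U *m u) = ((\det U)^-1)%:P * ((- (u 1 0)^*)%:P * ((U 0 0)%:P + (U 1 0)%:P * 'X)
   + ((u 0 0)^*)%:P * ((U 0 1)%:P + (U 1 1)%:P * 'X)).
  have c0 : (U 0 0)^* = (\det U)^-1 * U 1 1 by rewrite -e1 mulKf.
  have c1 : (U 1 0)^* = - ((\det U)^-1 * U 0 1) by rewrite -mulrN -e2 mulKf.
  have dV : (\det U)^-1 = (\det U)^* by apply: (mulfI d0); rewrite mulfV.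
  have c2 : (U 1 1)^* = (\det U)^-1 * U 0 0 by rewrite -e1 rmorphM /= conjCK dV.
  have c3 : (U 0 1)^* = - ((\det U)^-1 * U 1 0).
    by rewrite -[U 0 1]opprK -e2 rmorphN rmorphM /= conjCK dV.
  rewrite beE !Kemb_mulE !rmorphD !rmorphM /= c0 c1 c2 c3.
  move: ((\det U)^-1) => d; ring.
by rewrite exprMn rmorphXn /=; ring.
Qed.

Lemma radH_Kemb a b u U : U2 U -> u 2 0 != 0 -> radH A B a b (Kemb U *m u) =
  ((\det U)^-1 ^ Pexp B a * (((\det U)^-1)^*) ^ Qexp A b) * radH A B a b u.
Proof.
move=> UU u0; rewrite /radH Kemb_mulE rmorphM /=.
by rewrite !exprzMl ?unitfE ?conjC_eq0 ?invr_eq0 ?U2_det_neq0 //; ring.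
Qed.

End KAction.

(** * Spans of K-types *)

Section CSpan.
Variable R : realType.
Local Notation C := R[i].
Implicit Types (S T V : set (funG R)).

Definition linset (V : set (funG R)) := V (fun=> 0) /\
  forall (c : C) f h, V f -> V h -> V (fun g => c * f g + h g).

Lemma linset_sum V : linset V -> forall (I : Type) (s : seq I) (c : I -> C) (b : I -> funG R),
  (forall i, V (b i)) -> V (fun g => \sum_(i <- s) c i * b i g).
Proof.
move=> [V0 VD] I s c b Vb; elim: s => [|i s IH].
  by rewrite (_ : (fun g => _) = fun=> 0) //; apply/funext => g; rewrite big_nil.
rewrite (_ : (fun g => _) = fun g => c i * b i g + \sum_(i <- s) c i * b i g).
  exact: VD.
by apply/funext => g; rewrite big_cons.
Qed.

Lemma linsetZ V (c : C) f : linset V -> V f -> V (fun g => c * f g).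
Proof.
move=> [V0 VD] Vf; have := VD c f _ Vf V0; congr (V _).
by apply/funext => g; rewrite addr0.
Qed.

Lemma linsetD V f h : linset V -> V f -> V h -> V (fun g => f g + h g).
Proof.
move=> [V0 VD] Vf Vh; have := VD 1 f _ Vf Vh; congr (V _).
by apply/funext => g; rewrite mul1r.
Qed.

Lemma linsetB V f h : linset V -> V f -> V h -> V (fun g => f g - h g).
Proof.
move=> VL Vf Vh; have := linsetD VL Vf (linsetZ (-1) VL Vh); congr (V _).
by apply/funext => g; rewrite mulN1r.
Qed.

Lemma cspan_lin S : linset (cspan S).
Proof.
split.
  exists 0%N, (fun=> 0), (fun=> fun=> 0); split; first by case.
  by apply/funext => g; rewrite big_ord0.
move=> c f h [m [cf [bf [bfS ->]]]] [m' [ch [bh [bhS ->]]]].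
exists (m + m')%N, (fun i : 'I_(m + m') => match fintype.split i with inl i => c * cf i | inr i => ch i end),
  (fun i : 'I_(m + m') => match fintype.split i with inl i => bf i | inr i => bh i end); split.
  by move=> i; case: (fintype.split i).
apply/funext => g; rewrite big_split_ord mulr_sumr /=; congr (_ + _); apply: eq_bigr => i _.
  by rewrite (unsplitK (inl i)) mulrA.
by rewrite (unsplitK (inr i)).
Qed.

Lemma cspan_incl S : S `<=` cspan S.
Proof.
move=> f Sf; exists 1%N, (fun=> 1), (fun=> f); split => //.
by apply/funext => g; rewrite big_ord1 mul1r.
Qed.

Lemma cspan_min S V : linset V -> S `<=` V -> cspan S `<=` V.
Proof.
move=> VL SV f [m [c [b [bS ->]]]].
by apply: linset_sum => // i; exact: SV.
Qed.

Lemma cspanS S T : S `<=` T -> cspan S `<=` cspan T.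
Proof.
move=> ST; apply: cspan_min; first exact: cspan_lin.
by move=> f Sf; apply: cspan_incl; exact: ST.
Qed.

End CSpan.

(** * Closed sets of labels and stability of their spans *)

Section Labels.
Variable R : realType.
Local Notation C := R[i].
Local Notation M3 := 'M[C]_3.
Variables A B : int.
Implicit Types (a b n : nat) (S T : nat -> nat -> Prop).
Local Notation F := (F (R := R) A B).
Local Notation EF := (EF (R := R) A B).

(** The coefficient of X^n after multiplication by X, with value 0 at n = 0. *)
Definition Fs a b n : funG R := if n is m.+1 then F a b m else fun=> 0.

Definition k1 a b : C := (a + b).+1%:R.

Lemma k1_neq0 a b : k1 a b != 0.
Proof. by rewrite pnatr_eq0. Qed.

Lemma coef_natM (m : nat) (p : {poly C}) n : (m%:R * p)`_n = m%:R * p`_n.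
Proof. by rewrite -(rmorph_nat (polyC : {rmorphism C -> {poly C}})) coefCM. Qed.
Lemma coef_intM (m : int) (p : {poly C}) n : (m%:~R * p)`_n = m%:~R * p`_n.
Proof. by rewrite -(rmorph_int (polyC : {rmorphism C -> {poly C}})) coefCM. Qed.

Lemma coef_Xderiv (p : {poly C}) n : ('X * p^`())`_n = n%:R * p`_n.
Proof.
rewrite coefXM coef_deriv; case: n => [|n]; rewrite ?mul0r //=.
by rewrite mulr_natl.
Qed.

Lemma EF_00 a b n : EF 0 0 a b n = fun g => (a%:R - n%:R) * F a b n g.
Proof.
apply/funext => g; case: (pselect (SU21 g)) => gG; last by rewrite EF_out // !F_out // !mulr0 ?addr0.
rewrite EF_in // !F_in //.
by rewrite EE00 coefB coef_natM coef_Xderiv mulrBl.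
Qed.

Lemma EF_11 a b n : EF 1 1 a b n = fun g => (n%:R - b%:R) * F a b n g.
Proof.
apply/funext => g; case: (pselect (SU21 g)) => gG; last by rewrite EF_out // !F_out // !mulr0 ?addr0.
rewrite EF_in // !F_in //.
by rewrite EE11 coefB coef_natM coef_Xderiv mulrBl.
Qed.

Lemma EF_22 a b n : EF 2 2 a b n = fun g => (Pexp B a - Qexp A b)%:~R * F a b n g.
Proof.
apply/funext => g; case: (pselect (SU21 g)) => gG; last by rewrite EF_out // !F_out // !mulr0 ?addr0.
rewrite EF_in // !F_in //.
by rewrite EE22 ?pt_neq0 // coef_intM.
Qed.

Lemma EF_01 a b n : EF 0 1 a b n = fun g => n.+1%:R * F a b n.+1 g.
Proof.
apply/funext => g; case: (pselect (SU21 g)) => gG; last by rewrite EF_out // !F_out // !mulr0 ?addr0.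
rewrite EF_in // !F_in //.
by rewrite EE01 coef_deriv mulr_natl.
Qed.

Lemma EF_10 a b n : EF 1 0 a b n = fun g => ((a + b)%:R - n%:R + 1) * Fs a b n g.
Proof.
apply/funext => g; case: (pselect (SU21 g)) => gG; last first.
  by case: n => [|n]; rewrite EF_out // /Fs ?F_out // mulr0.
rewrite EF_in // /Fs.
rewrite EE10 expr2 -!mulrA coefB coef_natM coefXM [X in _ - X]coefXM.
case: n => [|n]; rewrite ?subr0 ?mulr0 ?subrr //= F_in //.
by rewrite coef_Xderiv -mulrBl; congr (_ * _); rewrite -[n.+1]addn1 natrD; ring.
Qed.

Lemma EF_02 a b n : EF 0 2 a b n = fun g =>
  (a%:Z * (a%:Z - A))%:~R / k1 a b * F a.-1 b n g
  + (Qexp A b)%:~R * n.+1%:R / k1 a b * F a b.+1 n.+1 g.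
Proof.
apply/funext => g; case: (pselect (SU21 g)) => gG; last by rewrite EF_out // !F_out // !mulr0 ?addr0.
rewrite EF_in // !F_in //.
apply: (mulfI (k1_neq0 a b)); rewrite -coef_natM EE02 ?pt_neq0 //; last exact: pt_null.
rewrite coefD !coef_intM coef_deriv -mulr_natl.
by move: (k1_neq0 a b) => k0; field.
Qed.

Lemma EF_12 a b n : EF 1 2 a b n = fun g =>
  (a%:Z * (a%:Z - A))%:~R / k1 a b * Fs a.-1 b n g
  + (Qexp A b)%:~R * (n%:R - k1 a b) / k1 a b * F a b.+1 n g.
Proof.
apply/funext => g; case: (pselect (SU21 g)) => gG; last first.
  by case: n => [|n]; rewrite EF_out // /Fs !F_out // !mulr0 addr0.
rewrite EF_in // /Fs (F_in _ _ _ _ _ gG).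
apply: (mulfI (k1_neq0 a b)); rewrite -coef_natM EE12 ?pt_neq0 //; last exact: pt_null.
rewrite coefD -mulrA !coef_intM coefB coef_natM coef_Xderiv coefXM -/(k1 a b).
move: (k1_neq0 a b) => k0; case: n => [|n] /=; rewrite ?F_in //; by field.
Qed.

Lemma EF_20 a b n : EF 2 0 a b n = fun g =>
  (b%:Z * (b%:Z - B))%:~R / k1 a b * Fs a b.-1 n g
  + (Pexp B a)%:~R * (k1 a b - n%:R) / k1 a b * F a.+1 b n g.
Proof.
apply/funext => g; case: (pselect (SU21 g)) => gG; last first.
  by case: n => [|n]; rewrite EF_out // /Fs !F_out // !mulr0 addr0.
rewrite EF_in // /Fs (F_in _ _ _ _ _ gG).
apply: (mulfI (k1_neq0 a b)); rewrite -coef_natM EE20 ?pt_neq0 //; last exact: pt_null.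
rewrite coefD -mulrA !coef_intM coefB coef_natM coef_Xderiv coefXM -/(k1 a b).
move: (k1_neq0 a b) => k0; case: n => [|n] /=; rewrite ?F_in //; by field.
Qed.

Lemma EF_21 a b n : EF 2 1 a b n = fun g =>
  - (b%:Z * (b%:Z - B))%:~R / k1 a b * F a b.-1 n g
  + (Pexp B a)%:~R * n.+1%:R / k1 a b * F a.+1 b n.+1 g.
Proof.
apply/funext => g; case: (pselect (SU21 g)) => gG; last by rewrite EF_out // !F_out // !mulr0 ?addr0.
rewrite EF_in // !F_in //.
apply: (mulfI (k1_neq0 a b)); rewrite -coef_natM EE21 ?pt_neq0 //; last exact: pt_null.
rewrite coefD -intrN !coef_intM coef_deriv -mulr_natl intrN.
by move: (k1_neq0 a b) => k0; field.
Qed.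

Definition arrow_closed S := [/\
  forall a b, S a.+1 b -> a.+1%:Z <> A -> S a b,
  forall a b, S a b -> a.+1%:Z <> - B -> S a.+1 b,
  forall a b, S a b.+1 -> b.+1%:Z <> B -> S a b &
  forall a b, S a b -> b.+1%:Z <> - A -> S a b.+1].

Definition Fset S : set (funG R) := [set f | exists a b n, S a b /\ f = F a b n].
Definition Fspan S : set (funG R) := cspan (Fset S).

Lemma F_span S a b n : S a b -> Fspan S (F a b n).
Proof. by move=> Sab; apply: cspan_incl; exists a, b, n. Qed.

Lemma Fs_span S a b n : S a b -> Fspan S (Fs a b n).
Proof. by case: n => [|n] Sab; [exact: (cspan_lin _).1 | exact: F_span]. Qed.

Lemma Fspan_lin S : linset (Fspan S). Proof. exact: cspan_lin. Qed.

(** Each term has to lie in V only when its coefficient is nonzero, which is how the blocked steps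
    of [arrow_closed] are used. *)
Lemma comb2_span (V : set (funG R)) (c d : C) f h : linset V ->
  (c != 0 -> V f) -> (d != 0 -> V h) -> V (fun g => c * f g + d * h g).
Proof.
move=> VL Vf Vh.
have Z e k : (e != 0 -> V k) -> V (fun g => e * k g).
  have [->|e0] := eqVneq e 0; last by move=> /(_ isT) Vk; exact: linsetZ.
  move=> _; rewrite (_ : (fun g => _) = fun=> 0); first exact: VL.1.
  by apply/funext => g; rewrite mul0r.
by apply: linsetD => //; exact: Z.
Qed.

Lemma EF_closed S (i j : 'I_3) a b n : arrow_closed S -> S a b -> Fspan S (EF i j a b n).
Proof.
move=> [Sal Sar Sbl Sbr] Sab.
have l := Fspan_lin S.
(* The factor a excludes a = 0, where the truncated predecessor [a.-1] would not be a genuine step;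
   the factor a - A is the wall. *)
have ka : (a%:Z * (a%:Z - A))%:~R / k1 a b != 0 -> S a.-1 b.
  move=> h; have {h} : a%:Z * (a%:Z - A) != 0 by apply: contraNneq h => ->; rewrite mul0r.
  rewrite mulf_eq0 negb_or subr_eq0 => /andP[a0 aA].
  by case: a a0 aA Sab => // a _ /eqP aA Sab; exact: Sal.
have kb : (b%:Z * (b%:Z - B))%:~R / k1 a b != 0 -> S a b.-1.
  move=> h; have {h} : b%:Z * (b%:Z - B) != 0 by apply: contraNneq h => ->; rewrite mul0r.
  rewrite mulf_eq0 negb_or subr_eq0 => /andP[b0 bB].
  by case: b {ka} b0 bB Sab => // b _ /eqP bB Sab; exact: Sbl.
have kQ (x : C) : (Qexp A b)%:~R * x / k1 a b != 0 -> S a b.+1.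
  move=> h; have {h} : Qexp A b != 0 by apply: contraNneq h => ->; rewrite !mul0r.
  by move=> /eqP h; apply: Sbr => // h'; apply: h; rewrite /Qexp; lia.
have kP (x : C) : (Pexp B a)%:~R * x / k1 a b != 0 -> S a.+1 b.
  move=> h; have {h} : Pexp B a != 0 by apply: contraNneq h => ->; rewrite !mul0r.
  by move=> /eqP h; apply: Sar => // h'; apply: h; rewrite /Pexp; lia.
elim/ord3P: i; elim/ord3P: j.
- by rewrite EF_00; apply: linsetZ => //; exact: F_span.
- by rewrite EF_01; apply: linsetZ => //; exact: F_span.
- by rewrite EF_02; apply: comb2_span => // h; apply: F_span; [exact: ka | exact: kQ h].
- by rewrite EF_10; apply: linsetZ => //; exact: Fs_span.
- by rewrite EF_11; apply: linsetZ => //; exact: F_span.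
- by rewrite EF_12; apply: comb2_span => // h; [apply: Fs_span; exact: ka | apply: F_span; exact: kQ h].
- by rewrite EF_20; apply: comb2_span => // h; [apply: Fs_span; exact: kb | apply: F_span; exact: kP h].
- rewrite EF_21; apply: comb2_span => // h; apply: F_span; last exact: kP h.
  by apply: kb; apply: contraNneq h; rewrite mulNr => ->; rewrite oppr0.
- by rewrite EF_22; apply: linsetZ => //; exact: F_span.
Qed.

(* [lieact] is linear only on functions of this kind. *)
Definition Ldiff : set (funG R) := [set f | forall (X : M3) g, su21 X -> exists d,
  cder (fun t : R => f (expmx (- t%:C%C *: X) *m g)) 0 d].

Lemma Ldiff_lin : linset Ldiff.
Proof.
split; first by move=> X g _; exists 0; exact: cder_cst.
move=> c f h fL hL X g Xs; have [d fd] := fL X g Xs; have [e he] := hL X g Xs.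
by exists (c * d + e); apply: cderD => //; exact: cderZ.
Qed.

Lemma lieactD (X : M3) c f h : su21 X -> Ldiff f -> Ldiff h ->
  lieact X (fun g => c * f g + h g) = fun g => c * lieact X f g + lieact X h g.
Proof.
move=> Xs fL hL; apply/funext => g.
have [d fd] := fL X g Xs; have [e he] := hL X g Xs.
rewrite (lieact_cder fd) (lieact_cder he); apply: lieact_cder.
by apply: cderD => //; exact: cderZ.
Qed.

Lemma lieact0 (X : M3) : lieact X (fun=> 0 : C) = fun=> 0.
Proof. by apply/funext => g; apply: lieact_cder; exact: cder_cst. Qed.

Lemma F_Ldiff a b n : Ldiff (F a b n).
Proof. by move=> X g Xs; eexists; exact: F_cder. Qed.

Lemma Fspan_Ldiff S : Fspan S `<=` Ldiff.
Proof.
apply: cspan_min; first exact: Ldiff_lin.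
by move=> f [a [b [n [_ ->]]]]; exact: F_Ldiff.
Qed.

Lemma lieactF (X : M3) a b n : su21 X ->
  lieact X (F a b n) = fun g => - \sum_i \sum_j X i j * EF i j a b n g.
Proof. by move=> Xs; apply/funext => g; apply: lieact_cder; exact: F_cder. Qed.

Lemma Fspan_lieact S X f : arrow_closed S -> su21 X -> Fspan S f -> Fspan S (lieact X f).
Proof.
(* Membership in the span is carried along because it gives the differentiability on which linearity
   of [lieact] depends. *)
move=> Sc Xs; pose V := [set f | Fspan S f /\ Fspan S (lieact X f)].
suff : Fspan S `<=` V by move=> h /h[].
apply: cspan_min.
  split; first by split; [exact: (Fspan_lin S).1 | rewrite lieact0; exact: (Fspan_lin S).1].
  move=> c h h' [h1 h2] [h1' h2']; split; first exact: (Fspan_lin S).2.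
  by rewrite lieactD //; [exact: (Fspan_lin S).2 | exact: Fspan_Ldiff h1 | exact: Fspan_Ldiff h1'].
move=> _ [a [b [n [Sab ->]]]]; split; first exact: F_span.
rewrite lieactF //; have l := Fspan_lin S.
rewrite (_ : (fun g => _) = fun g => -1 * (\sum_i 1 * (\sum_j X i j * EF i j a b n g))).
  apply: linsetZ => //; apply: (linset_sum l) => i; apply: (linset_sum l) => j.
  exact: EF_closed.
by apply/funext => g; rewrite mulN1r; congr (- _); apply: eq_bigr => i _; rewrite mul1r.
Qed.

Lemma Kact_F k a b n : K k -> exists e : 'I_(a + b).+1 -> C,
  Kact k (F a b n) = fun g => \sum_m e m * F a b m g.
Proof.
move=> [U UU <-]; have Vu := U2_inv UU; set V := invmx U in Vu.
pose c := ((\det V)^-1 ^ Pexp B a * (((\det V)^-1)^*) ^ Qexp A b) * (\det V)^-1 ^+ b.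
pose s := (V 0 0)%:P + (V 1 0)%:P * 'X; pose r := (V 0 1)%:P + (V 1 1)%:P * 'X.
exists (fun m => c * (s ^+ (a + b - m) * r ^+ m)`_n); apply/funext => g.
rewrite /Kact Kemb_inv // -/V.
have GG : SU21 (Kemb V *m g) <-> SU21 g by apply: SU21_mulr_iff; exact: Kemb_SU21.
case: (pselect (SU21 g)) => gG; last first.
  rewrite F_out; last by move=> /GG.
  by rewrite big1 // => m _; rewrite F_out ?mulr0.
rewrite F_in; last exact/GG.
under eq_bigr do rewrite F_in //.
have -> : pt (Kemb V *m g) = Kemb V *m pt g by rewrite /pt mulmxA.
rewrite /Hp MM_Kemb // radH_Kemb ?pt_neq0 // mulrA -polyCM coefCM /homog coef_sum mulr_sumr.
apply: eq_bigr => m _; rewrite -/s -/r [in RHS]coefCM -[_ * s ^+ _ * _]mulrA.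
by rewrite [X in _ * X = _]coefCM /c; ring.
Qed.

Lemma Fspan_Kact S k f : K k -> Fspan S f -> Fspan S (Kact k f).
Proof.
move=> kK; suff : Fspan S `<=` [set f | Fspan S (Kact k f)] by apply.
apply: cspan_min.
  by split; [exact: (Fspan_lin S).1 | move=> c h h'; exact: (Fspan_lin S).2].
move=> _ [a [b [n [Sab ->]]]] /=; have [e ->] := Kact_F a b n kK.
by apply: (linset_sum (Fspan_lin S)) => m; exact: F_span.
Qed.

Lemma Kfinite_lin : linset [set f : funG R | Kfinite f].
Proof.
split.
  exists 0%N, (fun=> fun=> 0) => k _; exact: (cspan_lin _).1.
move=> c f h [m [bf fK]] [m' [bh hK]].
exists (m + m')%N, (fun i : 'I_(m + m') => match fintype.split i with inl i => bf i | inr i => bh i end) => k kK.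
apply: (cspan_lin _).2.
  apply: cspanS (fK k kK) => _ [i _ <-]; exists (lshift _ i) => //=.
  by rewrite (unsplitK (inl i)).
apply: cspanS (hK k kK) => _ [i _ <-]; exists (rshift _ i) => //=.
by rewrite (unsplitK (inr i)).
Qed.

Lemma Fspan_Kfinite S f : Fspan S f -> Kfinite f.
Proof.
apply: cspan_min f; first exact: Kfinite_lin.
move=> _ [a [b [n [_ ->]]]].
exists (a + b).+1, (fun m : 'I__ => F a b m) => k kK; have [e ->] := Kact_F a b n kK.
by apply: linset_sum; [exact: cspan_lin | move=> m; apply: cspan_incl; exists m].
Qed.

End Labels.

(** * Submodules are sums of K-types *)

Section Independence.
Variable R : realType.
Local Notation C := R[i].
Local Notation M3 := 'M[C]_3.
Variables A B : int.
Implicit Types (a b n : nat) (S T : nat -> nat -> Prop).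
Local Notation F := (F (R := R) A B).
Local Notation EF := (EF (R := R) A B).
Local Notation Fspan := (Fspan (R := R) A B).

Definition label := (nat * nat * nat)%type.
Implicit Types (x y : label) (s : seq label) (c : label -> C).

Definition FF x : funG R := F x.1.1 x.1.2 x.2.
Definition valid x := (x.2 <= x.1.1 + x.1.2)%N.
Definition comb s c : funG R := fun g => \sum_(x <- s) c x * FF x g.

Lemma comb_widen s s' c : uniq s -> uniq s' -> {subset s <= s'} ->
  (forall x, x \notin s -> c x = 0) -> comb s c = comb s' c.
Proof.
move=> us us' ss' c0; apply/funext => g; rewrite /comb [RHS](bigID (mem s)) /=.
rewrite [X in _ + X]big1 ?addr0; last by move=> x xs; rewrite c0 // mul0r.
rewrite -[RHS]big_filter; apply: perm_big; apply: uniq_perm; rewrite ?filter_uniq //.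
by move=> x; rewrite mem_filter /=; case: (boolP (x \in s)) => // /ss' ->.
Qed.

Lemma Fspan_comb S f : Fspan S f -> exists s c, [/\ uniq s,
  forall x, x \in s -> valid x /\ S x.1.1 x.1.2,
  forall x, x \notin s -> c x = 0 & f = comb s c].
Proof.
set W := [set f : funG R | exists s c, [/\ uniq s,
  forall x, x \in s -> valid x /\ S x.1.1 x.1.2,
  forall x, x \notin s -> c x = 0 & f = comb s c]].
suff : Fspan S `<=` W by apply.
apply: cspan_min.
  split.
    exists [::], (fun=> 0); split => //.
    by apply/funext => g; rewrite /comb big_nil.
  move=> e _ _ [s [c [us sv sc ->]]] [s' [c' [us' sv' sc' ->]]].
  exists (undup (s ++ s')), (fun x => e * c x + c' x); split.
  - exact: undup_uniq.
  - by move=> x; rewrite mem_undup mem_cat => /orP[/sv|/sv'].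
  - by move=> x; rewrite mem_undup mem_cat negb_or => /andP[xs xs']; rewrite sc // sc' // mulr0 addr0.
  have s1 : {subset s <= undup (s ++ s')} by move=> x xs; rewrite mem_undup mem_cat xs.
  have s2 : {subset s' <= undup (s ++ s')} by move=> x xs; rewrite mem_undup mem_cat xs orbT.
  rewrite (comb_widen us (undup_uniq _) s1 sc) (comb_widen us' (undup_uniq _) s2 sc').
  apply/funext => g; rewrite /comb mulr_sumr -big_split /=; apply: eq_bigr => x _; ring.
move=> _ [a [b [n [Sab ->]]]]; have [kn|nk] := ltnP (a + b) n.
  exists [::], (fun=> 0); split => //; rewrite F_over //.
  by apply/funext => g; rewrite /comb big_nil.
exists [:: (a, b, n)], (fun x => (x == (a, b, n))%:R); split => //.
- by move=> x; rewrite inE => /eqP ->.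
- by move=> x; rewrite inE => /negPf ->.
by apply/funext => g; rewrite /comb big_seq1 eqxx mul1r.
Qed.

(** The common ground of submodules and of the sets [Ug X], for which only stability under the Lie
    algebra is immediate. *)
Definition gmod (V : set (funG R)) := [/\ V `<=` Fspan (fun _ _ => True), linset V &
  forall X f, su21 X -> V f -> V (lieact X f)].

(* The complexification of the real Lie algebra acts through the real and
   imaginary parts of the matrix units. *)
Definition su_re (i j : 'I_3) : M3 := delta_mx i j + esign R i j *: delta_mx j i.
Definition su_im (i j : 'I_3) : M3 := 'i%C *: delta_mx i j - (esign R i j * 'i%C) *: delta_mx j i.

(** E_ij equals (su_re - i su_im) / 2; the minus sign undoes the one in [lieact], which
    differentiates along exp(-tX). *)
Definition op (i j : 'I_3) (f : funG R) : funG R := fun g =>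
  - 2^-1 * (lieact (su_re i j) f g - 'i%C * lieact (su_im i j) f g).

Lemma conj_i : ('i%C : C)^* = - 'i%C.
Proof. by rewrite conjE; apply: complexP; rewrite /= ?oppr0. Qed.

Lemma i_sqr : ('i%C : C) * 'i%C = -1.
Proof. by rewrite -expr2 sqr_i. Qed.

Lemma esign_conj i j : (esign R i j)^* = esign R i j.
Proof. by rewrite /esign; case: ifP => _; rewrite ?rmorphN ?rmorph1. Qed.

Lemma esign_sym i j : esign R i j = esign R j i.
Proof. by rewrite /esign addbC. Qed.

Lemma esign_sqr i j : esign R i j * esign R i j = 1.
Proof. by rewrite /esign; case: ifP => _; rewrite ?mulrNN mulr1. Qed.

Lemma su21P (X : M3) : (forall i j, (X i j)^* = esign R i j * X j i) -> \tr X = 0 -> su21 X.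
Proof.
move=> XJ X0; split => //; apply/matrixP => i j.
rewrite [LHS]mxE !mulmx33 !adjmxE !XJ !matJE mxE /esign.
by elim/ord3P: i; elim/ord3P: j; rewrite /=; ring.
Qed.

Lemma tr_delta (i j : 'I_3) : \tr (delta_mx i j : M3) = (i == j)%:R.
Proof.
rewrite /mxtrace sum3 !mxE.
by elim/ord3P: i; elim/ord3P: j; rewrite /= ?addr0 ?add0r.
Qed.

Lemma X1_su21 i j : i != j -> su21 (su_re i j).
Proof.
move=> ij; have ji : j != i by rewrite eq_sym.
apply: su21P; last first.
  rewrite /su_re raddfD /= linearZ /= !tr_delta /= (negPf ij) (negPf ji) ?mulr0n mulr0 addr0 //.
move=> k l; rewrite /su_re !mxE !rmorphD rmorphM /= esign_conj !conjC_nat mulrDr.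
rewrite addrC; congr (_ + _).
  rewrite [(l == i) && _]andbC; case: (boolP ((k == j) && (l == i))) => [/andP[/eqP -> /eqP ->]|_].
    by rewrite esign_sym.
  by rewrite /= ?mulr0n !mulr0.
rewrite [(k == i) && _]andbC; case: (boolP ((l == j) && (k == i))) => [/andP[/eqP -> /eqP ->]|_].
  by rewrite /= mulr1n mulr1 esign_sqr.
by rewrite /= ?mulr0n !mulr0.
Qed.

Lemma X2_su21 i j : i != j -> su21 (su_im i j).
Proof.
move=> ij; have ji : j != i by rewrite eq_sym.
apply: su21P; last first.
  by rewrite /su_im raddfB /= !mxtraceZ !tr_delta (negPf ij) (negPf ji) !mulr0 subrr.
move=> k l; rewrite /su_im !mxE rmorphB !rmorphM /= esign_conj !conjC_nat conj_i mulrBr.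
rewrite addrC; congr (_ + _).
  rewrite [(l == i) && _]andbC; case: (boolP ((k == j) && (l == i))) => [/andP[/eqP -> /eqP ->]|_].
    by rewrite esign_sym; ring.
  by rewrite /= ?mulr0n !mulr0 ?oppr0.
rewrite [(k == i) && _]andbC; case: (boolP ((l == j) && (k == i))) => [/andP[/eqP -> /eqP ->]|_].
  by rewrite /= mulr1n -[- 'i%C]mul1r -(esign_sqr i j); ring.
by rewrite /= ?mulr0n !mulr0 ?oppr0.
Qed.

Lemma delta_sum (z : C) (i j : 'I_3) (H : 'I_3 -> 'I_3 -> C) :
  \sum_k \sum_l ((z *: delta_mx i j : M3) k l) * H k l = z * H i j.
Proof.
rewrite !sum3 !mxE.
by elim/ord3P: i; elim/ord3P: j; rewrite /= ?mulr1n ?mulr0n; ring.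
Qed.

Lemma op_F i j a b n : i != j -> op i j (F a b n) = EF i j a b n.
Proof.
move=> ij; have ji : j != i by rewrite eq_sym.
apply/funext => g; rewrite /op !lieactF; [|exact: X2_su21|exact: X1_su21].
have S1 (x y : C) : \sum_k \sum_l ((x *: delta_mx i j + y *: delta_mx j i : M3) k l) * EF k l a b n g =
   x * EF i j a b n g + y * EF j i a b n g.
  have S2 z i' j' := delta_sum z i' j' (fun k l => EF k l a b n g).
  rewrite -S2 -[in RHS]S2 -big_split; apply: eq_bigr => k _.
  by rewrite -big_split; apply: eq_bigr => l _; rewrite mxE mulrDl.
have -> : su_re i j = 1 *: delta_mx i j + esign R i j *: delta_mx j i by rewrite scale1r.
have -> : su_im i j = 'i%C *: delta_mx i j + (- (esign R i j * 'i%C)) *: delta_mx j i.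
  by rewrite scaleNr.
rewrite !S1; move: (EF i j a b n g) (EF j i a b n g) (esign R i j) => p q e.
transitivity (2^-1 * ((1 - 'i%C * 'i%C) * p + e * (1 + 'i%C * 'i%C) * q)); first by ring.
by rewrite i_sqr; field.
Qed.

Lemma D_su21 i : su21 ('i%C *: (delta_mx i i - delta_mx 2 2) : M3).
Proof.
apply: su21P; last by rewrite mxtraceZ raddfB /= !tr_delta !eqxx subrr mulr0.
move=> k l; rewrite !mxE rmorphM rmorphB /= !conjC_nat conj_i /esign.
rewrite (andbC (l == i)) (andbC (l == 2)).
have [->|kl] := eqVneq k l; first by rewrite andbb addbb; ring.
have e m : (k == m) && (l == m) = false.
  by apply/andP => -[/eqP km /eqP lm]; move: kl; rewrite km lm eqxx.
by rewrite !e; ring.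
Qed.

Definition opD (i : 'I_3) (f : funG R) : funG R := fun g =>
  'i%C * lieact ('i%C *: (delta_mx i i - delta_mx 2 2)) f g.

Lemma opD_F i a b n : opD i (F a b n) = fun g => EF i i a b n g - EF 2 2 a b n g.
Proof.
apply/funext => g; rewrite /opD lieactF; last exact: D_su21.
have S2 z i' := delta_sum z i' i' (fun k l => EF k l a b n g).
rewrite scalerBr -scaleNr.
have -> : \sum_k \sum_l (('i%C *: delta_mx i i + (- 'i%C) *: delta_mx 2 2 : M3) k l) * EF k l a b n g
   = 'i%C * EF i i a b n g + (- 'i%C) * EF 2 2 a b n g.
  rewrite -!S2 -big_split; apply: eq_bigr => k _.
  by rewrite -big_split; apply: eq_bigr => l _; rewrite mxE mulrDl.
move: (EF i i a b n g) (EF 2 2 a b n g) => p q.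
transitivity (- ('i%C * 'i%C) * (p - q)); first by ring.
by rewrite i_sqr; ring.
Qed.

Lemma FF_Ldiff x : @Ldiff R (FF x). Proof. exact: F_Ldiff. Qed.

Lemma op_lin i j (c : C) f h : i != j -> @Ldiff R f -> @Ldiff R h ->
  op i j (fun g => c * f g + h g) = fun g => c * op i j f g + op i j h g.
Proof.
move=> ij fL hL; apply/funext => g.
rewrite /op (lieactD c (X1_su21 ij) fL hL) (lieactD c (X2_su21 ij) fL hL).
move: (lieact (su_re i j) f g) (lieact (su_re i j) h g) (lieact (su_im i j) f g)
  (lieact (su_im i j) h g) => p q r t; ring.
Qed.

Lemma opD_lin i (c : C) f h : @Ldiff R f -> @Ldiff R h ->
  opD i (fun g => c * f g + h g) = fun g => c * opD i f g + opD i h g.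
Proof.
move=> fL hL; apply/funext => g; rewrite /opD (lieactD c (D_su21 i) fL hL).
by rewrite mulrDr mulrCA.
Qed.

Lemma lin_comb (P : funG R -> funG R) (W : set (funG R)) :
  (forall (c : C) f h, W f -> W h -> P (fun g => c * f g + h g) = fun g => c * P f g + P h g) ->
  linset W -> P (fun=> 0) = (fun=> 0) ->
  forall (I : Type) (r : seq I) (c : I -> C) (G : I -> funG R), (forall i, W (G i)) ->
  P (fun g => \sum_(i <- r) c i * G i g) = fun g => \sum_(i <- r) c i * P (G i) g.
Proof.
move=> PD WL P0 I r c G WG; elim: r => [|i r IH].
  transitivity (P (fun=> 0)).
    by congr P; apply/funext => g; rewrite big_nil.
  by rewrite P0; apply/funext => g; rewrite big_nil.
transitivity (P (fun g => c i * G i g + \sum_(i <- r) c i * G i g)).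
  by congr P; apply/funext => g; rewrite big_cons.
rewrite PD //; last exact: linset_sum.
by apply/funext => g; rewrite big_cons IH.
Qed.

Lemma op0 i j : op i j (fun=> 0) = fun=> 0.
Proof. by apply/funext => g; rewrite /op !lieact0 mulr0 subr0 mulr0. Qed.
Lemma opD0 i : opD i (fun=> 0) = fun=> 0.
Proof. by apply/funext => g; rewrite /opD lieact0 mulr0. Qed.

Lemma op_scale i j (c : C) f : i != j -> @Ldiff R f ->
  op i j (fun g => c * f g) = fun g => c * op i j f g.
Proof.
move=> ij fL; transitivity (op i j (fun g => c * f g + 0)).
  by congr op; apply/funext => g; rewrite addr0.
rewrite (op_lin _ ij fL (Ldiff_lin R).1) op0.
by apply/funext => g; rewrite addr0.
Qed.

Lemma gmod_op V i j f : gmod V -> i != j -> V f -> V (op i j f).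
Proof.
move=> [_ VL Vg] ij Vf; have v1 := Vg _ _ (X1_su21 ij) Vf.
have v2 := Vg _ _ (X2_su21 ij) Vf.
exact: (linsetZ _ VL (linsetB VL v1 (linsetZ _ VL v2))).
Qed.

Lemma gmod_opD V i f : gmod V -> V f -> V (opD i f).
Proof.
by move=> [_ VL Vg] Vf; exact: (linsetZ _ VL (Vg _ _ (D_su21 i) Vf)).
Qed.

(** [mu1], [mu2] and [mu3] are the eigenvalues on the basis function labelled x of E_00 - E_22, E_11
    - E_22 and E_01 E_10, with the sign conventions of [opD] and [op]. *)
Definition mu1 x : int := x.1.1%:Z *+ 2 - x.1.2%:Z - x.2%:Z + B - A.
Definition mu2 x : int := x.1.1%:Z - x.1.2%:Z *+ 2 + x.2%:Z + B - A.
Definition mu3 x : int := x.2%:Z * (x.1.1%:Z + x.1.2%:Z - x.2%:Z + 1).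

(** The two weights determine a - n and b - n. Once these agree, the third eigenvalues differ by (n
    - n') (a + b - n + 1 + n'), whose second factor is positive because n <= a + b. *)
Lemma mu_sep x y : valid x -> valid y -> mu1 x = mu1 y -> mu2 x = mu2 y -> mu3 x = mu3 y -> x = y.
Proof.
case: x => [[a b] n]; case: y => [[a' b'] n']; rewrite /valid /mu1 /mu2 /mu3 /= => v v' e1 e2 e3.
have ea : a%:Z - n%:Z = a'%:Z - n'%:Z by lia.
have eb : b%:Z - n%:Z = b'%:Z - n'%:Z by lia.
have : (n%:Z - n'%:Z) * (a%:Z + b%:Z - n%:Z + 1 + n'%:Z) = 0.
  have e : a'%:Z + b'%:Z - n'%:Z = a%:Z + b%:Z - n%:Z - n%:Z + n'%:Z by lia.
  move: e3; rewrite e => e3.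
  rewrite -[RHS](subrr (n%:Z * (a%:Z + b%:Z - n%:Z + 1))) [X in _ = _ - X]e3; ring.
move=> /eqP; rewrite mulf_eq0 => /orP[/eqP h|/eqP h]; last by lia.
have nn : n = n' by lia.
by have -> : a = a'; [lia | have -> : b = b' by lia]; rewrite nn.
Qed.

Lemma op_casimir x : op 0 1 (op 1 0 (FF x)) = fun g => (mu3 x)%:~R * FF x g.
Proof.
case: x => [[a b] n]; have n01 : (0 : 'I_3) != 1 by []. have n10 : (1 : 'I_3) != 0 by [].
rewrite /FF op_F // EF_10 op_scale //; last first.
  by case: n => [|n]; [exact: (Ldiff_lin R).1 | exact: F_Ldiff].
case: n => [|n] /=.
  by rewrite op0 /mu3 /=; apply/funext => g; rewrite !mul0r mulr0.
rewrite op_F // EF_01 /mu3; apply/funext => g; rewrite /= natrD; ring.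
Qed.

Lemma comb_mu V s c : gmod V -> V (comb s c) ->
  [/\ V (comb s (fun x => (mu1 x)%:~R * c x)), V (comb s (fun x => (mu2 x)%:~R * c x))
    & V (comb s (fun x => (mu3 x)%:~R * c x))].
Proof.
move=> Vg Vc; have FL x := FF_Ldiff x.
split.
- have := gmod_opD 0 Vg Vc; rewrite (lin_comb (@opD_lin 0) (@Ldiff_lin R) (opD0 0)) //.
  congr (V _); apply/funext => g; apply: eq_bigr => -[[a b] n] _.
  rewrite /FF opD_F EF_00 EF_22 /mu1 /Pexp /Qexp /=; ring.
- have := gmod_opD 1 Vg Vc; rewrite (lin_comb (@opD_lin 1) (@Ldiff_lin R) (opD0 1)) //.
  congr (V _); apply/funext => g; apply: eq_bigr => -[[a b] n] _.
  rewrite /FF opD_F EF_11 EF_22 /mu2 /Pexp /Qexp /=; ring.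
have n01 : (0 : 'I_3) != 1 by []. have n10 : (1 : 'I_3) != 0 by [].
have := gmod_op Vg n01 (gmod_op Vg n10 Vc).
rewrite (lin_comb (fun (e : C) f h => @op_lin 1 0 e f h n10) (@Ldiff_lin R) (op0 1 0)) //.
rewrite (lin_comb (fun (e : C) f h => @op_lin 0 1 e f h n01) (@Ldiff_lin R) (op0 0 1)); last first.
  move=> [[a b] n]; rewrite /FF op_F // EF_10; apply: (linsetZ _ (@Ldiff_lin R)).
  by case: n => [|n] /=; [exact: (Ldiff_lin R).1 | exact: F_Ldiff].
congr (V _); apply/funext => g; apply: eq_bigr => -[[a b] n] _.
by rewrite op_casimir; ring.
Qed.

(** Spectral projection by elimination: for each other label y some operator has distinct
    eigenvalues at x and y, and subtracting its eigenvalue at y kills the coefficient of y while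
    multiplying that of x by a nonzero number. *)
Lemma comb_extract V s c x : gmod V -> uniq s -> {in s, forall x, valid x} ->
  V (comb s c) -> x \in s -> c x != 0 -> V (FF x).
Proof.
move=> Vg us sv Vc xs cx; have VL : linset V by case: Vg.
have key (r : seq label) : {subset r <= s} -> x \notin r ->
    exists c', [/\ V (comb s c'), c' x != 0 & forall y, y \in r -> c' y = 0].
  elim: r => [|y r IH] rs xr; first by exists c.
  move: xr; rewrite inE negb_or => /andP[xy xr].
  have [c' [Vc' c'x c'r]] := IH (fun z zr => rs z (mem_behead (s := y :: r) zr)) xr.
  have ys : y \in s by apply: rs; rewrite mem_head.
  have step (mu : label -> int) : mu x != mu y ->
     V (comb s (fun z => (mu z)%:~R * c' z)) ->
     exists c'', [/\ V (comb s c''), c'' x != 0 & forall z, z \in y :: r -> c'' z = 0].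
    move=> mxy Vm; exists (fun z => (mu z - mu y)%:~R * c' z); split.
    - have := linsetB VL Vm (linsetZ (mu y)%:~R VL Vc'); congr (V _).
      apply/funext => g; rewrite /comb mulr_sumr -sumrB; apply: eq_bigr => z _.
      by rewrite intrB; ring.
    - by rewrite mulf_neq0 // intr_eq0 subr_eq0.
    - by move=> z; rewrite inE => /orP[/eqP ->|/c'r ->]; rewrite ?subrr ?mul0r ?mulr0.
  have [V1 V2 V3] := comb_mu Vg Vc'.
  have [e1|n1] := eqVneq (mu1 x) (mu1 y); last exact: step n1 V1.
  have [e2|n2] := eqVneq (mu2 x) (mu2 y); last exact: step n2 V2.
  have [e3|n3] := eqVneq (mu3 x) (mu3 y); last exact: step n3 V3.
  by move: xy; rewrite (mu_sep (sv _ xs) (sv _ ys) e1 e2 e3) eqxx.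
have [||c' [Vc' c'x c'r]] := key (rem x s).
- by move=> z; exact: mem_rem.
- exact/negbT/mem_rem_uniqF.
have e : comb s c' = fun g => c' x * FF x g.
  apply/funext => g; rewrite /comb (bigD1_seq x) //= big1_seq ?addr0 //.
  by move=> z /andP[zx zs]; rewrite c'r ?mul0r // mem_rem_uniq // inE zx.
have := linsetZ (c' x)^-1 VL Vc'; congr (V _); apply/funext => g.
by rewrite e mulKf.
Qed.

End Independence.

(** * Linear independence and classification of submodules by closed label sets *)

Section Classification.
Variable R : realType.
Local Notation C := R[i].
Variables A B : int.
Implicit Types (a b n : nat) (S T : nat -> nat -> Prop).
Implicit Types (x y : label) (s : seq label) (c : label -> C).
Local Notation F := (F (R := R) A B).
Local Notation Fspan := (Fspan (R := R) A B).
Local Notation FF := (FF (R := R) A B).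
Local Notation cmb := (@comb R A B).
Local Notation gmod := (@gmod R A B).

Definition half_sqrt : C := (sqrtC 2)^-1.

Lemma half_sqrt_conj : half_sqrt^* = half_sqrt.
Proof. by rewrite /half_sqrt fmorphV /= geC0_conj // sqrtC_ge0 ler0n. Qed.

Lemma half_sqrt_sqr : half_sqrt * half_sqrt = 2^-1.
Proof. by rewrite /half_sqrt -invfM -expr2 sqrtCK. Qed.

Lemma half_sqrt_neq0 : half_sqrt != 0.
Proof.
apply/eqP => h; have := half_sqrt_sqr; rewrite h mul0r => /esym/eqP.
by rewrite invr_eq0 pnatr_eq0.
Qed.

(** Rotation by 45 degrees. Both entries of its first column are nonzero, which makes it a test
    point for nonvanishing; it is later one of the two rotations in [Xf_sum]. *)
Definition rot45 : 'M[C]_2 :=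
  \matrix_(i, j) (if (i == 0) && (j == 1) then - half_sqrt else half_sqrt).

Lemma half_half : 2^-1 + 2^-1 = 1 :> C.
Proof. by field. Qed.

Lemma rot45_U2 : U2 rot45.
Proof.
have h := half_sqrt_sqr.
by apply: mx22P; rewrite mulmx_entry sum2 !adjmxE !mxE /= ?rmorphN /= !half_sqrt_conj
  ?mulrN ?mulNr ?opprK ?h ?subrr ?addNr ?half_half.
Qed.

Lemma rot45_det : \det rot45 = 1.
Proof. by rewrite det22 !mxE /= mulNr opprK half_sqrt_sqr half_half. Qed.

Lemma natr_subS1 (k n : nat) : (n <= k)%N -> k%:R - n.+1%:R + 1 = (k - n)%:R :> C.
Proof. by move=> nk; rewrite natrB // -[n.+1]addn1 natrD; ring. Qed.

(** The constant coefficient is u_1^a (- conj u_2)^b up to the radial factor, nonzero at [rot45].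
    For the others, E_10 sends the function with index n+1 to a + b - n times the one with index n,
    so vanishing would descend to n = 0. *)
Lemma F_neq0 a b n : (n <= a + b)%N -> F a b n <> fun=> 0.
Proof.
elim: n => [|n IH] nk.
  move=> /(congr1 (fun f => f (Kemb rot45))); rewrite F_in; last first.
    exact: Kemb_SU21 rot45_U2.
  rewrite /Hp coefCM /MM coef0M -!horner_coef0 !horner_exp !horner_coef0.
  rewrite alE beE !coefD coefN !coefCM !coefC !coefX !mulr0 !addr0 /=.
  rewrite /radH !pt_Kemb rot45_det invr1 conjC1 !exp1rz !mxE /=.
  move=> /eqP; rewrite !mulf_eq0 oner_eq0 /= !expf_eq0 oppr_eq0 conjC_eq0.
  by rewrite (negPf half_sqrt_neq0) !andbF.
move=> F0; apply: (IH (ltnW nk)).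
have n10 : (1 : 'I_3) != 0 by [].
have := op_F R A B a b n.+1 n10; rewrite F0 op0 EF_10 => e.
apply/funext => g; have /esym/eqP := congr1 (fun f => f g) e.
rewrite mulf_eq0 => /orP[|/eqP //] h; exfalso; move: h.
rewrite natr_subS1; last exact: ltnW.
by rewrite pnatr_eq0 subn_eq0 leqNgt nk.
Qed.

Lemma zero_gmod : gmod (@zeroF R).
Proof.
split.
- by move=> f ->; exact: (@Fspan_lin R A B _).1.
- by split => // c f h -> ->; apply/funext => g; rewrite mulr0 addr0.
- by move=> X f _ ->; rewrite lieact0.
Qed.

(** Linear independence is extraction applied to the zero submodule, which contains no basis
    function. *)
Lemma comb_eq0 s c x : uniq s -> {in s, forall x, valid x} ->
  cmb s c = (fun=> 0) -> x \in s -> c x = 0.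
Proof.
move=> us sv c0 xs; have [//|cx] := eqVneq (c x) 0.
have := comb_extract zero_gmod us sv c0 xs cx => /F_neq0; case; exact: sv.
Qed.

Lemma comb_inj s s' c c' : uniq s -> uniq s' -> {in s, forall x, valid x} ->
  {in s', forall x, valid x} -> (forall x, x \notin s -> c x = 0) ->
  (forall x, x \notin s' -> c' x = 0) -> cmb s c = cmb s' c' -> c =1 c'.
Proof.
move=> us us' sv sv' sc sc' e x.
pose r := undup (s ++ s').
have s1 : {subset s <= r} by move=> y ys; rewrite mem_undup mem_cat ys.
have s2 : {subset s' <= r} by move=> y ys; rewrite mem_undup mem_cat ys orbT.
have ur : uniq r by exact: undup_uniq.
rewrite (comb_widen A B us ur s1 sc) (comb_widen A B us' ur s2 sc') in e.
have rv : {in r, forall x, valid x}.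
  by move=> y; rewrite mem_undup mem_cat => /orP[/sv|/sv'].
have [xr|xr] := boolP (x \in r); last first.
  move: xr; rewrite mem_undup mem_cat negb_or => /andP[/sc -> /sc' ->] //.
apply/eqP; rewrite -subr_eq0; apply/eqP.
apply: (@comb_eq0 r (fun y => c y - c' y)) => //; apply/funext => g.
rewrite -[RHS](subrr (cmb r c' g)) -[in X in _ = X - _]e /comb -sumrB.
by apply: eq_bigr => y _; rewrite mulrBl.
Qed.

Lemma comb_mem V s c : linset V -> (forall x, x \in s -> c x != 0 -> V (FF x)) ->
  V (cmb s c).
Proof.
move=> VL cV; pose G x : funG R := if (x \in s) && (c x != 0) then FF x else fun=> 0.
rewrite (_ : cmb s c = fun g => \sum_(x <- s) c x * G x g).
  apply: linset_sum => // x; rewrite /G; case: ifP => [/andP[xs cx]|_]; first exact: cV.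
  exact: VL.1.
apply/funext => g; apply: eq_big_seq => x xs; rewrite /G xs /=.
by case: eqP => [->|]; rewrite ?mul0r.
Qed.

Lemma Fspan_label S a b n : (n <= a + b)%N -> Fspan S (F a b n) -> S a b.
Proof.
move=> nk /Fspan_comb[s [c [us sv sc e]]].
pose x : label := (a, b, n).
have ex : cmb [:: x] (fun y => (y == x)%:R) = cmb s c.
  by rewrite -e; apply/funext => g; rewrite /comb big_seq1 eqxx mul1r.
have := comb_inj _ us _ (fun y ys => (sv y ys).1) _ sc ex x.
rewrite eqxx => h; have cx : 1 = c x.
  by apply: h => // y; rewrite inE; [move=> /eqP -> | move=> /negPf ->].
have [xs|/sc] := boolP (x \in s); first exact: (sv x xs).2.
by rewrite -cx => /eqP; rewrite oner_eq0.
Qed.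

Lemma FspanS S T : (forall a b, S a b -> T a b) -> Fspan S `<=` Fspan T.
Proof.
by move=> ST; apply: cspanS => f [a [b [n [Sab ->]]]]; exists a, b, n; split => //; exact: ST.
Qed.

Lemma eq_Fspan S T : (forall a b, S a b <-> T a b) -> Fspan S = Fspan T.
Proof. by move=> ST; apply/seteqP; split; apply: FspanS => a b /ST. Qed.

Lemma Fspan_sub S T : Fspan S `<=` Fspan T -> forall a b, S a b -> T a b.
Proof.
move=> ST a b Sab; apply: (@Fspan_label _ a b 0) => //.
by apply: ST; exact: F_span.
Qed.

Lemma Fspan_cap S T : Fspan S `&` Fspan T = Fspan (fun a b => S a b /\ T a b).
Proof.
apply/seteqP; split; last first.
  by move=> f h; split; apply: FspanS h => a b [].
move=> f [/Fspan_comb[s [c [us sv sc e]]] /Fspan_comb[s' [c' [us' sv' sc' e']]]].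
have cc : c =1 c'.
  apply: (comb_inj us us') => //; [by move=> x /sv[]|by move=> x /sv'[]|by rewrite -e].
rewrite e; apply: comb_mem; first exact: Fspan_lin.
move=> x xs cx; apply: F_span; split; first exact: (sv x xs).2.
have [/sv'[]//|/sc'] := boolP (x \in s').
by rewrite -cc => /eqP; rewrite (negPf cx).
Qed.

Lemma Fspan_cup S T : sumF (Fspan S) (Fspan T) = Fspan (fun a b => S a b \/ T a b).
Proof.
apply/seteqP; split.
  move=> _ [f [h [Sf Th ->]]]; apply: linsetD; first exact: Fspan_lin.
    by apply: FspanS Sf => a b; left.
  by apply: FspanS Th => a b; right.
apply: cspan_min.
  split.
    exists (fun=> 0), (fun=> 0); split; [exact: (@Fspan_lin R A B _).1 | exact: (@Fspan_lin R A B _).1 |].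
    by apply/funext => g; rewrite addr0.
  move=> c _ _ [f [h [Sf Th ->]]] [f' [h' [Sf' Th' ->]]].
  exists (fun g => c * f g + f' g), (fun g => c * h g + h' g); split.
  - exact: (@Fspan_lin R A B _).2.
  - exact: (@Fspan_lin R A B _).2.
  - by apply/funext => g; ring.
move=> _ [a [b [n [[Sab|Tab] ->]]]].
  exists (F a b n), (fun=> 0); split; [exact: F_span|exact: (@Fspan_lin R A B _).1|].
  by apply/funext => g; rewrite addr0.
exists (fun=> 0), (F a b n); split; [exact: (@Fspan_lin R A B _).1|exact: F_span|].
by apply/funext => g; rewrite add0r.
Qed.

Lemma Fspan0 : Fspan (fun _ _ => False) = @zeroF R.
Proof.
apply/seteqP; split; last by move=> f ->; exact: (@Fspan_lin R A B _).1.
apply: cspan_min; first by have [] := zero_gmod.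
by move=> f [? [? [? []]]].
Qed.

Section Closure.
Variable V : set (funG R).
Hypothesis Vg : gmod V.

Let VL : linset V. Proof. by case: Vg. Qed.
Let n01 : (0 : 'I_3) != 1. Proof. by []. Qed.
Let n10 : (1 : 'I_3) != 0. Proof. by []. Qed.
Let n02 : (0 : 'I_3) != 2. Proof. by []. Qed.
Let n21 : (2 : 'I_3) != 1. Proof. by []. Qed.

Lemma gmod_unZ (e : C) f : e != 0 -> V (fun g => e * f g) -> V f.
Proof.
move=> e0 /(linsetZ e^-1 VL); congr (V _); apply/funext => g.
by rewrite mulKf.
Qed.

Lemma gmod_lower a b n : (n <= a + b)%N -> V (F a b n) -> V (F a b 0).
Proof.
elim: n => // n IH nk Vn; apply: IH; first exact: ltnW.
have := gmod_op Vg n10 Vn; rewrite op_F // EF_10; apply: gmod_unZ.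
rewrite natr_subS1; last exact: ltnW.
by rewrite pnatr_eq0 subn_eq0 leqNgt nk.
Qed.

Lemma gmod_raise a b n : V (F a b 0) -> V (F a b n).
Proof.
move=> V0; elim: n => // n IH.
have := gmod_op Vg n01 IH; rewrite op_F // EF_01; apply: gmod_unZ.
by rewrite pnatr_eq0.
Qed.

Lemma gmod_split x y (e d : C) : valid x -> valid y -> x != y ->
  V (fun g => e * FF x g + d * FF y g) -> (e != 0 -> V (FF x)) /\ (d != 0 -> V (FF y)).
Proof.
move=> xv yv xy Vxy; have yx : (y == x) = false by rewrite eq_sym (negPf xy).
pose c z := if z == x then e else d.
have us : uniq [:: x; y] by rewrite /= inE xy.
have sv : {in [:: x; y], forall z, valid z}.
  by move=> z; rewrite !inE => /orP[/eqP ->|/eqP ->].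
have Vc : V (cmb [:: x; y] c).
  move: Vxy; congr (V _); apply/funext => g.
  by rewrite /comb big_cons big_seq1 /c eqxx yx.
split => ne.
  by apply: (comb_extract Vg us sv Vc); rewrite ?mem_head // /c eqxx.
by apply: (comb_extract Vg us sv Vc); rewrite ?inE ?eqxx ?orbT // /c yx.
Qed.

(** Applied to the constant coefficients, E_02 and E_21 reach all four neighbours: the lowered label
    appears with index 0 and the raised one with index 1. Extraction separates the two terms, and
    [gmod_lower] brings index 1 back to 0. *)
Lemma gmod_arrow : arrow_closed A B (fun a b => V (F a b 0)).
Proof.
have kn a b : (k1 R a b)^-1 != 0 by rewrite invr_eq0 k1_neq0.
split => a b Vab ne.
- have := gmod_op Vg n02 Vab; rewrite op_F // EF_02 => h.
  have [] := @gmod_split (a, b, 0%N) (a.+1, b.+1, 1%N) _ _ isT isT _ h.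
    by apply/eqP => -[]; lia.
  move=> + _; apply; rewrite !mulf_neq0 ?kn // intr_eq0 mulf_neq0 ?subr_eq0 //.
  exact/eqP.
- have := gmod_op Vg n21 Vab; rewrite op_F // EF_21 => h.
  have [] := @gmod_split (a, b.-1, 0%N) (a.+1, b, 1%N) _ _ isT isT _ h.
    by apply/eqP => -[]; lia.
  move=> _ h'; apply: (@gmod_lower _ _ 1) => //; apply: h'.
  rewrite !mulf_neq0 ?kn ?pnatr_eq0 // intr_eq0 /Pexp oppr_eq0.
  by apply/eqP => e; apply: ne; lia.
- have := gmod_op Vg n21 Vab; rewrite op_F // EF_21 => h.
  have [] := @gmod_split (a, b, 0%N) (a.+1, b.+1, 1%N) _ _ isT isT _ h.
    by apply/eqP => -[]; lia.
  move=> + _; apply; rewrite !mulf_neq0 ?kn // oppr_eq0 intr_eq0 mulf_neq0 ?subr_eq0 //.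
  exact/eqP.
- have := gmod_op Vg n02 Vab; rewrite op_F // EF_02 => h.
  have v : valid (a, b.+1, 1%N) by rewrite /valid /= addnS.
  have [] := @gmod_split (a.-1, b, 0%N) (a, b.+1, 1%N) _ _ isT v _ h.
    by apply/eqP => -[]; lia.
  move=> _ h'; apply: (@gmod_lower _ _ 1) => //; apply: h'.
  rewrite !mulf_neq0 ?kn ?pnatr_eq0 // intr_eq0 /Qexp oppr_eq0.
  by apply/eqP => e; apply: ne; lia.
Qed.

(** Extraction puts every basis function occurring in an element of V into V, and E_10 and E_01 move
    through its K-type; so V is determined by the labels whose constant coefficient it contains. *)
Lemma gmod_Fspan : V = Fspan (fun a b => V (F a b 0)).
Proof.
apply/seteqP; split; last first.
  by apply: cspan_min => // _ [a [b [n [Vab ->]]]]; exact: gmod_raise.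
move=> f Vf; have [VS _ _] := Vg; have [s [c [us sv sc e]]] := Fspan_comb (VS _ Vf).
rewrite e in Vf *; apply: comb_mem; first exact: Fspan_lin.
move=> x xs cx; have Vx := comb_extract Vg us (fun y ys => (sv y ys).1) Vf xs cx.
apply: F_span; apply: gmod_lower Vx; exact: (sv x xs).1.
Qed.

End Closure.

End Classification.

(** * Smoothness *)

Section Smoothness.
Variable R : realType.
Local Notation C := R[i].
Local Notation Re := complex.Re.
Local Notation Im := complex.Im.
Local Notation V2 := ('M[R]_3 * 'M[R]_3)%type.
Implicit Types (P v : V2) (f h : V2 -> C).

Lemma near_eq_differentiable (V W : normedModType R) (F G : V -> W) x :
  (\near x, F x = G x) -> differentiable F x -> differentiable G x.
Proof.
move=> FG dF; have FGx : F x = G x := nbhs_singleton FG.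
have e : G \o shift x = cst (G x) + 'd F x +o_ 0 id.
  apply/eqaddoP => _/posnumP[eps]; have /eqaddoP/(_ _ (gt0 eps)) := diff_locally dF.
  rewrite FGx; move: FG; rewrite (near_shift 0) subr0 => FG h; near=> y.
  have E : F (y + x) = G (y + x) by near: y.
  have : `|(F \o shift x - (cst (G x) + 'd F x)) y| <= eps%:num * `|id y| by near: y.
  by rewrite !fctE /= E.
have dG : 'd G x = 'd F x :> (V -> W).
  by apply: diff_unique e; exact: diff_continuous.
by apply/diff_locallyP; rewrite dG; split => //; exact: diff_continuous.
Unshelve. all: by end_near. Qed.

Lemma derive_line (V W : normedModType R) (F : V -> W) (x v : V) :
  'D_v F x = 'D_1 (fun t : R => F (t *: v + x)) 0.
Proof.
rewrite /derive; apply: (congr1 (fun k => lim (k @ 0^'))); apply/funext => t /=.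
by rewrite scale0r add0r addr0 [t *: 1]mulr1.
Qed.

Definition uco (j : 'I_3) P : C := pt (cmx P) j 0.

Lemma ucoE j P : uco j P = Complex (P.1 j 0 + P.1 j 2) (P.2 j 0 + P.2 j 2).
Proof. by rewrite /uco ptE !mxE. Qed.

Definition Uset : set V2 := [set P | uco 2 P != 0].

(** A syntactic class of functions closed under directional derivatives, matching the recursion of
    [Cn_on]. The only denominator is u_3, so all of them are regular on the open set [Uset], which
    contains the group. *)
Inductive smooth_term : (V2 -> C) -> Prop :=
| smooth_term_cst c : smooth_term (fun=> c)
| smooth_term_uco j : smooth_term (uco j)
| smooth_term_conj f : smooth_term f -> smooth_term (fun P => (f P)^*)
| smooth_term_add f h : smooth_term f -> smooth_term h -> smooth_term (fun P => f P + h P)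
| smooth_term_mul f h : smooth_term f -> smooth_term h -> smooth_term (fun P => f P * h P)
| smooth_term_inv : smooth_term (fun P => (uco 2 P)^-1).

Definition cdiff f P := differentiable (fun P => Re (f P)) P /\
  differentiable (fun P => Im (f P)) P.

Lemma entry1_differentiable i j P : differentiable (fun P : V2 => P.1 i j : R) P.
Proof.
have @f : {linear V2 -> R}.
  by exists (fun P : V2 => P.1 i j); do 2![eexists]; do ?[constructor];
     rewrite ?mxE// => ? *; rewrite ?mxE//; move=> ?; rewrite !mxE.
rewrite (_ : (fun _ => _) = f) //; apply/linear_differentiable => Q.
have h : (fun P : V2 => P.1) @ Q --> Q.1 by exact: cvg_fst.
exact: (continuous_comp h (@coord_continuous _ _ _ i j Q.1)).
Qed.

Lemma entry2_differentiable i j P : differentiable (fun P : V2 => P.2 i j : R) P.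
Proof.
have @f : {linear V2 -> R}.
  by exists (fun P : V2 => P.2 i j); do 2![eexists]; do ?[constructor];
     rewrite ?mxE// => ? *; rewrite ?mxE//; move=> ?; rewrite !mxE.
rewrite (_ : (fun _ => _) = f) //; apply/linear_differentiable => Q.
have h : (fun P : V2 => P.2) @ Q --> Q.2 by exact: cvg_snd.
exact: (continuous_comp h (@coord_continuous _ _ _ i j Q.2)).
Qed.

Lemma uco_cdiff j P : cdiff (uco j) P.
Proof.
split.
  rewrite (_ : (fun P => _) = (fun P : V2 => P.1 j 0) + (fun P : V2 => P.1 j 2)).
    by apply: differentiableD; exact: entry1_differentiable.
  by apply/funext => Q; rewrite ucoE.
rewrite (_ : (fun P => _) = (fun P : V2 => P.2 j 0) + (fun P : V2 => P.2 j 2)).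
  by apply: differentiableD; exact: entry2_differentiable.
by apply/funext => Q; rewrite ucoE.
Qed.

Lemma inv_complexE (z : C) : z^-1 = Complex (Re z / (Re z ^+ 2 + Im z ^+ 2))
  (- Im z / (Re z ^+ 2 + Im z ^+ 2)).
Proof.
case: z => a b /=; change ((Complex a b)^-1) with (invc (Complex a b)).
by rewrite /invc /= mulNr.
Qed.

Lemma normsq_neq0 (z : C) : z != 0 -> Re z ^+ 2 + Im z ^+ 2 != 0.
Proof.
apply: contraNneq => /eqP; rewrite paddr_eq0 ?sqr_ge0 // !sqrf_eq0 => /andP[/eqP a /eqP b].
by apply/eqP; exact: complexP.
Qed.

Lemma smooth_term_cdiff f P : smooth_term f -> Uset P -> cdiff f P.
Proof.
move=> fs UP; elim: fs => [c|j|{}f _ [f1 f2]|{}f h _ [f1 f2] _ [h1 h2]|{}f h _ [f1 f2] _ [h1 h2]|].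
- by split; exact: differentiable_cst.
- exact: uco_cdiff.
- split.
    by rewrite (_ : (fun P => _) = (fun P => Re (f P))) //; apply/funext => Q; rewrite conjE.
  rewrite (_ : (fun P => _) = - (fun P => Im (f P))); first exact: differentiableN.
  by apply/funext => Q; rewrite conjE.
- split.
    rewrite (_ : (fun P => _) = (fun P => Re (f P)) + (fun P => Re (h P))).
      exact: differentiableD.
    by apply/funext => Q; rewrite cReD.
  rewrite (_ : (fun P => _) = (fun P => Im (f P)) + (fun P => Im (h P))).
    exact: differentiableD.
  by apply/funext => Q; rewrite cImD.
- split.
    rewrite (_ : (fun P => _) = (fun P => Re (f P)) * (fun P => Re (h P))
       - (fun P => Im (f P)) * (fun P => Im (h P))).
      by apply: differentiableB; exact: differentiableM.
    by apply/funext => Q; rewrite cReM.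
  rewrite (_ : (fun P => _) = (fun P => Re (f P)) * (fun P => Im (h P))
     + (fun P => Im (f P)) * (fun P => Re (h P))).
    by apply: differentiableD; exact: differentiableM.
  by apply/funext => Q; rewrite cImM.
- have [d1 d2] := uco_cdiff 2 P.
  pose N (Q : V2) : R := Re (uco 2 Q) ^+ 2 + Im (uco 2 Q) ^+ 2.
  have dN : differentiable N P.
rewrite (_ : N = (fun P => Re (uco 2 P)) * (fun P => Re (uco 2 P))
    + (fun P => Im (uco 2 P)) * (fun P => Im (uco 2 P))); last first.
  by apply/funext => Q; rewrite /N !expr2.
by apply: differentiableD; exact: differentiableM.
  have N0 : N P != 0 by exact: normsq_neq0.
  have dV : differentiable (fun Q => (N Q)^-1) P by exact: differentiableV.
  split.
    rewrite (_ : (fun P => _) = (fun P => Re (uco 2 P)) * (fun Q => (N Q)^-1)).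
      exact: differentiableM.
    by apply/funext => Q; rewrite inv_complexE.
  rewrite (_ : (fun P => _) = - (fun P => Im (uco 2 P)) * (fun Q => (N Q)^-1)).
    by apply: differentiableM => //; exact: differentiableN.
  by apply/funext => Q; rewrite inv_complexE.
Qed.

Lemma uco_line j (v P : V2) (t : R) : uco j (t *: v + P) = t%:C%C * uco j v + uco j P.
Proof.
by rewrite !ucoE; apply: complexP; rewrite ?cReD ?cImD ?RerM ?ImrM /= !mxE; ring.
Qed.

Lemma smooth_term_line f v : smooth_term f -> exists2 f', smooth_term f' & forall P, Uset P ->
  cder (fun t : R => f (t *: v + P)) 0 (f' P).
Proof.
elim => [c|j|{}f fs [f' f's fd]|{}f h fs [f' f's fd] hs [h' h's hd]|{}f h fs [f' f's fd] hs [h' h's hd]|].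
- by exists (fun=> 0); [exact: smooth_term_cst | move=> P _; exact: cder_cst].
- exists (fun=> uco j v); first exact: smooth_term_cst.
  move=> P _; apply: (@cder_ext _ (fun t : R => uco j v * t%:C%C + uco j P)); last first.
    by move=> t; rewrite uco_line mulrC.
  have id1 : cder (fun t : R => t%:C%C : C) 0 1.
    by apply: (cder_real (d := 1)); exact: is_derive_id.
  by apply: (cder_eq (cderD (cderZ (uco j v) id1) (cder_cst _ _))); rewrite mulr1 addr0.
- exists (fun P => (f' P)^*); first exact: smooth_term_conj.
  by move=> P UP; apply: cder_conj; exact: fd.
- exists (fun P => f' P + h' P); first exact: smooth_term_add.
  by move=> P UP; apply: cderD; [exact: fd | exact: hd].
- exists (fun P => f' P * h P + f P * h' P).
    by apply: smooth_term_add; exact: smooth_term_mul.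
  move=> P UP; have := cderM (fd P UP) (hd P UP).
  by rewrite scale0r add0r.
- exists (fun P => - uco 2 v * ((uco 2 P)^-1 * (uco 2 P)^-1)).
    by apply: smooth_term_mul; [exact: smooth_term_cst | apply: smooth_term_mul; exact: smooth_term_inv].
  move=> P UP.
  have id1 : cder (fun t : R => t%:C%C : C) 0 1.
    by apply: (cder_real (d := 1)); exact: is_derive_id.
  have e : cder (fun t : R => uco 2 (t *: v + P)) 0 (uco 2 v).
    apply: (@cder_ext _ (fun t : R => uco 2 v * t%:C%C + uco 2 P)); last first.
      by move=> t; rewrite uco_line mulrC.
    by apply: (cder_eq (cderD (cderZ (uco 2 v) id1) (cder_cst _ _))); rewrite mulr1 addr0.
  have n0 : uco 2 (0 *: v + P) != 0 by rewrite scale0r add0r.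
  apply: (cder_eq (@cderV _ (fun t : R => uco 2 (t *: v + P)) _ _ n0 e)).
  by rewrite scale0r add0r expr2 invfM.
Qed.

Lemma Uset_open : open Uset.
Proof.
pose N (Q : V2) : R := Re (uco 2 Q) ^+ 2 + Im (uco 2 Q) ^+ 2.
have -> : Uset = N @^-1` [set x | x != 0].
  apply/seteqP; split => Q /=; first exact: normsq_neq0.
  by apply: contraNneq => u0; rewrite /N u0 /= expr0n addr0.
apply: open_comp; last exact: open_neq.
move=> P _; apply: differentiable_continuous.
have [d1 d2] := uco_cdiff 2 P.
rewrite (_ : N = (fun P => Re (uco 2 P)) * (fun P => Re (uco 2 P))
    + (fun P => Im (uco 2 P)) * (fun P => Im (uco 2 P))); last first.
  by apply/funext => Q; rewrite /N !expr2.
by apply: differentiableD; exact: differentiableM.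
Qed.

(** F has to agree with the term on [Uset] only: the induction passes to ['D_v F], whose values
    outside that set are not controlled. *)
Lemma smooth_term_Cn n (F : V2 -> R) f : smooth_term f -> (forall P, Uset P -> F P = Re (f P)) -> Cn_on n Uset F.
Proof.
elim: n F f => [|n IH] F f fs Ff.
  move=> P UP; apply: differentiable_continuous.
  apply: (near_eq_differentiable _ (smooth_term_cdiff fs UP).1).
  by apply: filterS (open_nbhs_nbhs (conj Uset_open UP)) => Q UQ; rewrite Ff.
split.
  move=> P UP; apply: (near_eq_differentiable _ (smooth_term_cdiff fs UP).1).
  by apply: filterS (open_nbhs_nbhs (conj Uset_open UP)) => Q UQ; rewrite Ff.
move=> v; have [f' f's fd] := smooth_term_line v fs.
apply: (IH _ f' f's) => P UP.
have [h1 _] := fd P UP; rewrite -(@derive_val _ _ _ _ _ _ _ h1) -(derive_line (fun P => Re (f P)) P v).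
(* Transport of a derivative along local equality requires a nonzero direction. *)
have [->|v0] := eqVneq v 0; first by rewrite !derive0.
apply: near_eq_derive => //.
by apply: filterS (open_nbhs_nbhs (conj Uset_open UP)) => Q UQ; rewrite Ff.
Qed.

Lemma smooth_term_Cinfty f : smooth_term f -> Cinfty_on Uset (fun P => Re (f P)) /\ Cinfty_on Uset (fun P => Im (f P)).
Proof.
move=> fs; split => n; first by apply: (smooth_term_Cn _ fs).
apply: (@smooth_term_Cn n _ (fun P => f P * - 'i%C)); first by apply: smooth_term_mul => //; exact: smooth_term_cst.
by move=> P _; rewrite cReM /=; ring.
Qed.

End Smoothness.

(** * The inducing character as homogeneity on the cone, and membership of the basis functions *)

Section PrincipalSeries.
Variable R : realType.
Local Notation C := R[i].
Local Notation Re := complex.Re.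
Local Notation Im := complex.Im.
Local Notation M3 := 'M[C]_3.
Local Notation V2 := ('M[R]_3 * 'M[R]_3)%type.
Variables A B : int.
Implicit Types (a b n : nat).
Local Notation F := (F (R := R) A B).
Local Notation Fspan := (Fspan (R := R) A B).

Lemma polar_sphere (c d : R) : c ^+ 2 + d ^+ 2 = 1 -> exists t : R, cos t = c /\ sin t = d.
Proof.
move=> cd.
have c1 : -1 <= c <= 1.
  have : `|c| ^+ 2 <= 1 by rewrite real_normK ?num_real // -cd lerDl sqr_ge0.
  by rewrite expr_le1 // ler_norml.
have dd : Num.sqrt (1 - c ^+ 2) = `|d| by rewrite -cd addrC addKr sqrtr_sqr.
have [d0|d0] := leP 0 d.
  by exists (acos c); rewrite acosK ?in_itv //= sin_acos // dd ger0_norm.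
exists (- acos c); rewrite cosN sinN acosK ?in_itv //= sin_acos // dd.
by rewrite ltr0_norm // opprK.
Qed.

Lemma unit_complex (z : C) : z * z^* = 1 -> exists t : R, cexp ('i%C * t%:C%C) = z.
Proof.
move=> zz; have [|t [ct st]] := @polar_sphere (Re z) (Im z).
  by move: zz => /(congr1 (fun z => Re z)); rewrite cReM conjE /= => <-; ring.
exists t; have -> : 'i%C * t%:C%C = Complex 0 t.
  by apply: complexP; rewrite ?cReM ?cImM /=; ring.
by rewrite cexpE /= expR0 !mul1r ct st; case: z {zz ct st}.
Qed.

Lemma cexp_surj (z : C) : z != 0 -> exists t s : R, cexp (s%:C%C + 'i%C * t%:C%C) = z.
Proof.
move=> z0; pose r := Re `|z|.
have rz : r%:C%C = `|z| by rewrite RRe_real // normr_real.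
have r0 : 0 < r by rewrite -ltcR rz normr_gt0.
have [|t tz] := @unit_complex (z / `|z|).
  rewrite rmorphM fmorphV /= [(`|z|)^*]conj_Creal ?normr_real //.
  rewrite mulrACA -normCK -invfM -expr2 mulfV // expf_neq0 // normr_eq0 //.
exists t, (ln r); rewrite cexpD tz.
have -> : cexp (ln r)%:C%C = `|z|.
  rewrite cexpE /= cos0 sin0 mulr1 mulr0 lnK ?posrE //.
by rewrite mulrCA mulfV ?mulr1 // normr_eq0.
Qed.

(** The homogeneity of cone functions under u -> z u; at z = e^(s + it) it is the inducing
    character. *)
Definition charz (z : C) : C := z ^ (- (B + 1)) * (z^*) ^ (- (A + 1)).

Lemma charz_exp (t s : R) :
  cexp (- 'i%C * (B - A)%:~R * t%:C%C - ((A + B)%:~R + 2) * s%:C%C) =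
  charz (cexp (s%:C%C + 'i%C * t%:C%C)).
Proof.
rewrite /charz -cexp_conj -!cexpMz -cexpD; congr cexp.
have -> : (s%:C%C + 'i%C * t%:C%C : C)^* = s%:C%C - 'i%C * t%:C%C.
  by rewrite conjE; apply: complexP; rewrite ?(cReD, cImD, cReN, cImN, cReM, cImM) /=; ring.
by rewrite !intrN !intrB !intrD /=; ring.
Qed.

Lemma F_charz a b n (g g' : M3) (z : C) : SU21 g -> SU21 g' -> z != 0 ->
  pt g' = z *: pt g -> F a b n g' = charz z * F a b n g.
Proof.
move=> gG gG' z0 e; rewrite !F_in // /Hp !coefCM e.
have c0 : z^* != 0 by rewrite conjC_eq0.
have ea : al (z *: pt g) = z%:P * al (pt g).
  by rewrite !alE ![(z *: pt g) _ _]mxE !polyCM; ring.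
have eb : be (z *: pt g) = (z^*)%:P * be (pt g).
  by rewrite !beE ![(z *: pt g) _ _]mxE !rmorphM /=; ring.
have -> : (MM a b (z *: pt g))`_n = z ^+ a * (z^*) ^+ b * (MM a b (pt g))`_n.
  by rewrite /MM ea eb !exprMn mulrACA -!polyC_exp -polyCM coefCM.
have -> : radH A B a b (z *: pt g) = z ^ (Pexp B a) * (z^*) ^ (Qexp A b) * radH A B a b (pt g).
  rewrite /radH ![(z *: pt g) _ _]mxE rmorphM !exprzMl ?unitfE ?conjC_eq0 ?pt_neq0 //.
  by rewrite mulrACA.
have -> : charz z = z ^ (Pexp B a) * z ^+ a * ((z^*) ^ (Qexp A b) * (z^*) ^+ b).
  have eX (w : C) (m : int) (k : nat) : w != 0 -> w ^ m * w ^+ k = w ^ (m + k%:Z).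
    by move=> w0; rewrite expfzDr.
  by rewrite !eX // /charz /Pexp /Qexp; congr (_ ^ _ * _ ^ _); lia.
by move: (radH _ _ _ _ _) (MM _ _ _)`_n => x y; ring.
Qed.

Definition charM : M3 := matU0 R - 3 *: matU3 R.

Lemma charM_diag : charM = diag3 (- 'i%C) (2 * 'i%C) (- 'i%C).
Proof.
rewrite /charM /matU0 /matU3 /diag3.
by apply: mx33P; rewrite !mxE /= ?mulr1n ?mulr0n; field.
Qed.

Lemma diag3E (x y z : C) (i j : 'I_3) : diag3 x y z i j = if i == j then [:: x; y; z]`_j else 0.
Proof. by rewrite /diag3 !mxE; case: eqP => [->|_]; rewrite ?mulr1n ?mulr0n. Qed.

Lemma charM_su21 : su21 charM.
Proof.
rewrite charM_diag; apply: su21P; last first.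
  by rewrite /mxtrace sum3 !diag3E /=; ring.
have cN : (- 'i%C : C)^* = 'i%C by rewrite rmorphN /= conj_i opprK.
have c2 : (2 * 'i%C : C)^* = - (2 * 'i%C) by rewrite rmorphM /= conj_i rmorph_nat mulrN.
move=> i j; rewrite !diag3E /esign.
elim/ord3P: i; elim/ord3P: j; rewrite /= ?conjC0 ?cN ?c2; ring.
Qed.

Lemma matHE (i j : 'I_3) : matH R i j = ((i == 0) && (j == 2) || (i == 2) && (j == 0))%:R.
Proof.
rewrite /matH !mxE; elim/ord3P: i; elim/ord3P: j; rewrite //= ?addr0 ?add0r //.
Qed.

Lemma matH_su21 : su21 (matH R).
Proof.
apply: su21P; last first.
  by rewrite /mxtrace sum3 !matHE /= !addr0.
by move=> i j; rewrite !matHE conjC_nat /esign; elim/ord3P: i; elim/ord3P: j; rewrite /= ?mulr0 ?mulr1.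
Qed.

Lemma pt_mul (g m a n : M3) (x y : C) : m *m v0 R = y *: v0 R -> a *m v0 R = x *: v0 R ->
  n *m v0 R = v0 R -> pt (g *m m *m a *m n) = (x * y) *: pt g.
Proof.
move=> mv av nv; rewrite /pt -(mulmxA _ n) nv -(mulmxA _ a) av -scalemxAr -(mulmxA _ m) mv.
by rewrite -scalemxAr scalerA.
Qed.

(** The base vector is an eigenvector of every factor: U_0 - 3 U_3 = diag(-i, 2i, -i) has eigenvalue
    -i on it, E_13 + E_31 has eigenvalue 1, and N fixes it. *)
Lemma pt_char (g : M3) (t s : R) (n : M3) : groupN n ->
  pt (g *m expmx (- t%:C%C *: charM) *m expmx (s%:C%C *: matH R) *m n) =
  cexp (s%:C%C + 'i%C * t%:C%C) *: pt g.
Proof.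
move=> nN; rewrite cexpD; apply: pt_mul; last exact: groupN_v0.
  rewrite expNt; apply: expmx_eigen; rewrite mulNmx charM_diag.
  by apply: colP3; rewrite [LHS]mxE mulmx_entry sum3 !diag3E [RHS]mxE !v0E /=; ring.
rewrite -[X in cexp X]mul1r; apply: expmx_eigen.
by apply: colP3; rewrite mulmx_entry sum3 !matHE [RHS]mxE !v0E /=; ring.
Qed.

Lemma SU21_char (g : M3) (t s : R) (n : M3) : SU21 g -> groupN n ->
  SU21 (g *m expmx (- t%:C%C *: charM) *m expmx (s%:C%C *: matH R) *m n).
Proof.
move=> gG nN; apply: SU21_mul; last exact: groupN_SU21.
apply: SU21_mul; last exact: expmx_SU21 matH_su21.
by apply: SU21_mul => //; rewrite expNt; apply: expmx_SU21; apply: su21N; exact: charM_su21.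
Qed.

(** Write z = e^(s + it) and let h be g0 times the corresponding element of the torus. Then h and g
    have the same point, so h^-1 g fixes the base vector and lies in N by [stab_v0]; the
    transformation law of f applies. *)
Lemma princ_charz f (g g0 : M3) (z : C) : princ (B - A) (A + B)%:~R f ->
  SU21 g -> SU21 g0 -> z != 0 -> pt g = z *: pt g0 -> f g = charz z * f g0.
Proof.
move=> [_ _ _ fE] gG g0G z0 e; have [t [s ts]] := cexp_surj z0.
pose h := g0 *m expmx (- t%:C%C *: charM) *m expmx (s%:C%C *: matH R).
have N1 : groupN (1%:M : M3) by exists [::]; split => //; rewrite big_nil.
have hG : SU21 h by rewrite -[h]mulmx1; exact: SU21_char.
have hp : pt h = pt g by rewrite -[h]mulmx1 (pt_char _ _ _ N1) ts e.
have nN : groupN (invmx h *m g).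
  apply: stab_v0; first by apply: SU21_mul => //; exact: SU21_inv.
  by rewrite -mulmxA -/(pt g) -hp /pt mulKmx // SU21_unit.
have e2 : f (h *m (invmx h *m g)) = cexp
    (- 'i%C * (B - A)%:~R * t%:C%C - ((A + B)%:~R + 2) * s%:C%C) * f g0.
  exact: (fE g0 t s _ g0G nN).
by rewrite mulKVmx ?SU21_unit // charz_exp ts in e2.
Qed.

Definition smooth_poly (p : V2 -> {poly C}) := forall n, smooth_term (fun P => (p P)`_n).

Lemma eq_smooth_term (f h : V2 -> C) : f =1 h -> smooth_term f -> smooth_term h.
Proof. by move=> /funext ->. Qed.

Lemma smooth_term_sum (I : Type) (s : seq I) (G : I -> V2 -> C) : (forall i, smooth_term (G i)) ->
  smooth_term (fun P => \sum_(i <- s) G i P).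
Proof.
move=> Gs; elim: s => [|i s IH].
  by apply: (@eq_smooth_term (fun=> 0)); [move=> P; rewrite big_nil | exact: smooth_term_cst].
apply: (@eq_smooth_term (fun P => G i P + \sum_(i <- s) G i P)); first by move=> P; rewrite big_cons.
exact: smooth_term_add.
Qed.

Lemma smooth_polyM p q : smooth_poly p -> smooth_poly q -> smooth_poly (fun P => p P * q P).
Proof.
move=> ps qs n; apply: (@eq_smooth_term (fun P => \sum_(j < n.+1) (p P)`_j * (q P)`_(n - j))).
  by move=> P; rewrite coefM.
by apply: smooth_term_sum => j; exact: smooth_term_mul.
Qed.

Lemma smooth_polyD p q : smooth_poly p -> smooth_poly q -> smooth_poly (fun P => p P + q P).
Proof.
by move=> ps qs n; apply: (@eq_smooth_term (fun P => (p P)`_n + (q P)`_n)); [move=> P; rewrite coefD | exact: smooth_term_add].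
Qed.

Lemma smooth_poly_cst p : smooth_poly (fun=> p). Proof. by move=> n; exact: smooth_term_cst. Qed.

Lemma smooth_polyC (c : V2 -> C) : smooth_term c -> smooth_poly (fun P => (c P)%:P).
Proof.
move=> cs [|n]; [apply: (@eq_smooth_term c) cs | apply: (@eq_smooth_term (fun=> 0)); last exact: smooth_term_cst].
  by move=> P; rewrite coefC.
by move=> P; rewrite coefC.
Qed.

Lemma smooth_polyX p m : smooth_poly p -> smooth_poly (fun P => p P ^+ m).
Proof.
move=> ps; elim: m => [|m IH]; first exact: smooth_poly_cst.
have h := smooth_polyM ps IH; move=> n; apply: eq_smooth_term (h n) => P; by rewrite exprS.
Qed.

Lemma smooth_termX (c : V2 -> C) m : smooth_term c -> smooth_term (fun P => c P ^+ m).
Proof.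
move=> cs; elim: m => [|m IH]; first exact: smooth_term_cst.
by apply: (@eq_smooth_term (fun P => c P * c P ^+ m)); [move=> P; rewrite exprS | exact: smooth_term_mul].
Qed.

Lemma smooth_term_exprz (m : int) : smooth_term (fun P : V2 => uco 2 P ^ m).
Proof.
case: m => m; first exact: smooth_termX (smooth_term_uco _ _).
apply: (@eq_smooth_term (fun P => (uco 2 P)^-1 ^+ m.+1)); first by move=> P; rewrite exprVn.
exact: smooth_termX (smooth_term_inv _).
Qed.

Lemma smooth_poly_Hp a b : smooth_poly (fun P => Hp A B a b (pt (cmx P))).
Proof.
have conjz (z : C) (m : int) : (z^*) ^ m = (z ^ m)^*.
  case: m => m; first by rewrite -!exprnP rmorphXn.
  by rewrite NegzE -!exprnN fmorphV rmorphXn.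
rewrite /Hp; apply: smooth_polyM.
  apply: smooth_polyC; apply: smooth_term_mul; first exact: smooth_term_exprz.
  apply: (@eq_smooth_term (fun P => (uco 2 P ^ (Qexp A b))^*)); first by move=> P; rewrite conjz.
  by apply: smooth_term_conj; exact: smooth_term_exprz.
apply: smooth_polyM; apply: smooth_polyX.
  apply: smooth_polyD; first by apply: smooth_polyC; exact: (smooth_term_uco _ 0).
  by apply: smooth_polyM; [apply: smooth_polyC; exact: (smooth_term_uco _ 1) | exact: smooth_poly_cst].
have h : smooth_poly (fun P : V2 => (-1)%:P * ((uco 1 P)^*)%:P + ((uco 0 P)^*)%:P * 'X).
  apply: smooth_polyD.
    by apply: smooth_polyM; [exact: smooth_poly_cst | apply: smooth_polyC; apply: smooth_term_conj; exact: smooth_term_uco].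
  by apply: smooth_polyM; [apply: smooth_polyC; apply: smooth_term_conj; exact: smooth_term_uco | exact: smooth_poly_cst].
by move=> n; apply: eq_smooth_term (h n) => P; rewrite beE polyCN mulN1r.
Qed.

Lemma Fspan_smooth_term S f : Fspan S f -> exists2 e, smooth_term e & forall P, SU21 (cmx P) -> f (cmx P) = e P.
Proof.
pose W := [set f : funG R | exists2 e, smooth_term e & forall P, SU21 (cmx P) -> f (cmx P) = e P].
suff : Fspan S `<=` W by apply.
apply: cspan_min.
  split; first by exists (fun=> 0) => //; exact: smooth_term_cst.
  move=> c h h' [e es he] [e' es' he']; exists (fun P => c * e P + e' P).
    by apply: smooth_term_add => //; apply: smooth_term_mul => //; exact: smooth_term_cst.
  by move=> P PG; rewrite he // he'.
move=> _ [a [b [n [_ ->]]]]; exists (fun P => (Hp A B a b (pt (cmx P)))`_n).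
  exact: smooth_poly_Hp.
by move=> P PG; rewrite F_in.
Qed.

Lemma Fspan_princ S : Fspan S `<=` princ (B - A) (A + B)%:~R.
Proof.
move=> f Sf; split.
- move=> g gG; have : Fspan S `<=` [set f | f g = 0]; last by apply.
  apply: cspan_min; last by move=> _ [a [b [n [_ ->]]]] /=; rewrite F_out.
  by split => // c h h' /= -> ->; rewrite mulr0 addr0.
- move=> P PG; have [e es he] := Fspan_smooth_term Sf; have [s1 s2] := smooth_term_Cinfty es.
  exists (@Uset R), (fun P => Re (e P)), (fun P => Im (e P)); split => //.
  - exact: Uset_open.
  - exact: pt_neq0.
  - by move=> Q _ QG; rewrite he //; case: (e Q).
- exact: Fspan_Kfinite Sf.
move=> g t s n gG nN; rewrite charz_exp; set z := cexp (s%:C%C + _).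
pose g' := g *m expmx (- t%:C%C *: charM) *m expmx (s%:C%C *: matH R) *m n.
change (f g' = charz z * f g).
have gG' : SU21 g' by exact: SU21_char.
have e : pt g' = z *: pt g by exact: pt_char.
move: g' gG' e => g' gG' e.
have : Fspan S `<=` [set f | f g' = charz z * f g]; last by apply.
apply: cspan_min; last first.
  by move=> _ [a [b [m [_ ->]]]] /=; apply: F_charz => //; exact: cexp_neq0.
split => [|c h h' /= -> ->]; first by rewrite /= mulr0.
by rewrite mulrDr mulrCA.
Qed.

End PrincipalSeries.

(** * Finite-dimensional spaces of functions on which a circle acts *)

Section FiniteDim.
Variable R : realType.
Local Notation C := R[i].
Variable T : Type.
Implicit Types (E : set (T -> C)).

Definition flin E := E (fun=> 0) /\ forall (c : C) f h, E f -> E h -> E (fun x => c * f x + h x).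

Lemma flin_sum E : flin E -> forall (I : Type) (s : seq I) (c : I -> C) (b : I -> T -> C),
  (forall i, E (b i)) -> E (fun x => \sum_(i <- s) c i * b i x).
Proof.
move=> [E0 ED] I s c b Eb; elim: s => [|i s IH].
  by rewrite (_ : (fun x => _) = fun=> 0) //; apply/funext => x; rewrite big_nil.
rewrite (_ : (fun x => _) = fun x => c i * b i x + \sum_(i <- s) c i * b i x).
  exact: ED.
by apply/funext => x; rewrite big_cons.
Qed.

(** A system of functions in E dual to points has at most m members, by the rank of its matrix of
    values; one of maximal size interpolates all of E. Coordinates thus become point evaluations,
    and a group acting on E has matrix entries that are values of functions in E. *)
Lemma dual_basis E m (b : 'I_m -> T -> C) : flin E ->
  (forall f, E f -> exists c : 'I_m -> C, f = fun x => \sum_i c i * b i x) ->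
  exists r (phi : 'I_r -> T -> C) (p : 'I_r -> T), [/\ forall i, E (phi i),
    forall i j, phi i (p j) = (i == j)%:R &
    forall f, E f -> f = fun x => \sum_i f (p i) * phi i x].
Proof.
move=> EL Eb.
pose Q r := exists (phi : 'I_r -> T -> C) (p : 'I_r -> T), (forall i, E (phi i)) /\
  forall i j, phi i (p j) = (i == j)%:R.
have Q0 : exists r, `[< Q r >].
  have p0 : 'I_0 -> T by case.
  by exists 0%N; apply/asboolP; exists (fun=> fun=> 0), p0; split; case.
have Qm r : `[< Q r >] -> (r <= m)%N.
  move=> /asboolP[phi [p [Ephi dual]]].
  have /(_ _)/cid h i := Eb _ (Ephi i); pose c i := projT1 (h i).
  have cE i : phi i = fun x => \sum_k c i k * b k x := projT2 (h i).
  have e : (\matrix_(i < r, k < m) c i k) *m (\matrix_(k < m, j < r) b k (p j)) = 1%:M.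
    apply/matrixP => i j; rewrite mxE [RHS]mxE -dual cE.
    by apply: eq_bigr => k _; rewrite !mxE.
  by rewrite -(mxrank1 C r) -e; apply: leq_trans (mxrankM_maxr _ _) (rank_leq_row _).
have [r /asboolP[phi [p [Ephi dual]]] rmax] := ex_maxnP Q0 Qm.
exists r, phi, p; split => // f Ef; apply: contrapT => nf.
pose g x := f x - \sum_i f (p i) * phi i x.
have [y gy] : exists y, g y != 0.
  apply: contrapT => ng; apply: nf; apply/funext => x.
  by apply/eqP; rewrite -subr_eq0; apply/negP => gx; apply: ng; exists x; apply/negP.
have Eg : E g.
  have h := EL.2 (-1) _ _ (flin_sum EL (index_enum _) (fun i => f (p i)) Ephi) Ef.
  by congr E: h; apply/funext => x; rewrite /g mulN1r addrC.
have gp j : g (p j) = 0.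
  rewrite /g (bigD1 j) //= dual eqxx mulr1 big1 ?addr0 ?subrr //.
  by move=> i /negPf ij; rewrite dual ij mulr0.
suff : (r.+1 <= r)%N by rewrite ltnn.
apply: rmax; apply/asboolP.
(* The interpolation error g vanishes at every p_j but not at y, so g / g(y) is dual to the new
   point y once each phi_j is corrected to vanish there. *)
exists (fun i => if unlift ord_max i is Some j then fun x => phi j x - phi j y / g y * g x
                 else fun x => (g y)^-1 * g x),
  (fun i => if unlift ord_max i is Some j then p j else y); split.
  move=> i; case: (unlift ord_max i) => [j|].
    have h := EL.2 (- (phi j y / g y)) _ _ Eg (Ephi j).
    by congr E: h; apply/funext => x; rewrite mulNr addrC.
  have h := EL.2 (g y)^-1 _ _ Eg EL.1.
  by congr E: h; apply/funext => x; rewrite addr0.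
move=> i k; case: (unliftP ord_max i) => [i'|] ->; case: (unliftP ord_max k) => [k'|] ->.
- by rewrite gp mulr0 subr0 dual (inj_eq (@lift_inj _ _)).
- by rewrite divfK // subrr eq_sym (negPf (neq_lift _ _)).
- by rewrite gp mulr0 (negPf (neq_lift _ _)).
- by rewrite mulVf // eqxx.
Qed.

End FiniteDim.

(** * Periodic matrix flows are trigonometric *)

Section Circle.
Variable R : realType.
Local Notation C := R[i].
Local Notation Re := complex.Re.
Local Notation Im := complex.Im.
Local Notation tau := (pi *+ 2 : R).

Lemma cos_eq1 (x : R) : cos x = 1 -> exists n : int, x = n%:~R * tau.
Proof.
have tau0 : 0 < tau by rewrite pmulrn_lgt0 // pi_gt0.
move=> cx; pose n := Num.floor (x / tau); exists n.
pose y := x - n%:~R * tau.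
have cosn (k : int) z : cos (z + k%:~R * tau) = cos z.
  case: k => k; first by rewrite mulr_natl (periodicn (@cosD2pi R)).
  rewrite NegzE mulrNz mulNr -[in RHS](subrK (k.+1%:R * tau) z).
  by rewrite mulr_natl (periodicn (@cosD2pi R)).
have cy : cos y = 1 by rewrite -cx -[in RHS](subrK (n%:~R * tau) x) cosn.
have [y0 y1] : 0 <= y /\ y < tau.
  have /andP[h1 h2] := floor_itv (x / tau); rewrite -/n in h1 h2.
  have e : x / tau * tau = x by rewrite divfK // gt_eqF.
  split; first by rewrite subr_ge0 -[leRHS]e ler_pM2r.
  have : x / tau * tau < (n + 1)%:~R * tau by rewrite ltr_pM2r.
  by rewrite e intrD mulrDl mul1r ltrBlDr [tau + _]addrC.
have [y00|yn] := eqVneq y 0; first by apply/eqP; rewrite -subr_eq0 -/y y00.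
have yp : 0 < y by rewrite lt_neqAle eq_sym yn.
have s0 : 0 < sin (y / 2).
  apply: sin_gt0_pi; rewrite divr_gt0 //= ltr_pdivrMr // mulr_natr //.
have := cos_mulr2n (y / 2); rewrite -[y / 2 *+ 2]mulr_natr divfK // cy cos2sin2.
move=> h; have : sin (y / 2) ^+ 2 = 0 by lra.
by move=> /eqP; rewrite sqrf_eq0 gt_eqF.
Qed.

Lemma cexp_i (t : R) : cexp ('i%C * t%:C%C) = Complex (cos t) (sin t).
Proof.
have -> : 'i%C * t%:C%C = Complex 0 t.
  by apply: complexP; rewrite ?cReM ?cImM /=; ring.
by rewrite cexpE /= expR0 !mul1r.
Qed.

Lemma cexp_2pi : cexp ('i%C * tau%:C%C) = 1.
Proof. by rewrite cexp_i cos2pi sin2pi. Qed.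

Lemma cexp_period (al : C) : cexp (al * tau%:C%C) = 1 -> exists n : int, al = 'i%C * n%:~R.
Proof.
have tau0 : 0 < tau by rewrite pmulrn_lgt0 // pi_gt0.
rewrite cexpE => e.
have Rea : Re (al * tau%:C%C) = Re al * tau by rewrite cReM /= mulr0 subr0.
have Ima : Im (al * tau%:C%C) = Im al * tau by rewrite cImM /= mulr0 add0r.
have e1 : expR (Re al * tau) * cos (Im al * tau) = 1.
  by rewrite -Rea -Ima; have := congr1 (fun z => Re z) e.
have e2 : expR (Re al * tau) * sin (Im al * tau) = 0.
  by rewrite -Rea -Ima; have := congr1 (fun z => Im z) e.
set E := expR _ in e1 e2; have E0 : 0 < E by exact: expR_gt0.
have s0 : sin (Im al * tau) = 0.
  by move/eqP: e2; rewrite mulf_eq0 gt_eqF //= => /eqP.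
have c1 : cos (Im al * tau) = 1.
  have := sin0cos1 s0; have [c0|c0] := ltP 0 (cos (Im al * tau)).
    by rewrite gtr0_norm.
  have : E * cos (Im al * tau) <= 0 by rewrite pmulr_rle0.
  by rewrite e1 ler10.
have [n hn] := cos_eq1 c1; exists n.
have taun : tau != 0 by rewrite gt_eqF.
have aI : Im al = n%:~R by exact: (mulIf taun).
have aR : Re al = 0.
  have : E = expR 0 by rewrite expR0 -e1 c1 mulr1.
  by move=> /expR_inj/eqP; rewrite mulf_eq0 (negPf taun) orbF => /eqP.
have -> : (n%:~R : C) = (n%:~R : R)%:C%C by rewrite rmorph_int.
by apply: complexP; rewrite ?cReM ?cImM /= ?aR ?aI; ring.
Qed.

Variables (r : nat) (rho : R -> 'M[C]_r).
Hypothesis rhoD : forall s t, rho (s + t) = rho s *m rho t.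
Hypothesis rho0 : rho 0 = 1%:M.
Hypothesis rho_tau : rho tau = 1%:M.
Variable A : 'M[C]_r.
Hypothesis rho_der : mxder rho 0 A.

Lemma mxder_group t : mxder rho t (A *m rho t).
Proof.
have h : mxder (fun s => rho (s - t) *m rho t) t (A *m rho t).
  have h0 : mxder (fun s => rho (s - t)) t A.
    move=> a b; have [d1 d2] := rho_der a b.
    have sh : is_derive t 1 (fun s : R => s - t) 1.
      by rewrite -[X in is_derive _ _ _ X]subr0; apply: is_deriveB; exact: is_derive_id.
    rewrite -(subrr t) in d1 d2; split.
      by have := @is_derive1_comp _ (fun x => Re (rho x a b)) (fun s => s - t) t _ _ d1 sh; rewrite mulr1.
    by have := @is_derive1_comp _ (fun x => Im (rho x a b)) (fun s => s - t) t _ _ d2 sh; rewrite mulr1.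
  by have := mxder_mul h0 (mxder_cst (rho t) t); rewrite mulmx0 addr0.
move=> a b; apply: (cder_ext (h a b)) => s.
by rewrite -rhoD subrK.
Qed.

Lemma eigen_flow (w : 'rV[C]_r) al : w *m A = al *: w ->
  forall t, w *m rho t = cexp (al * t%:C%C) *: w.
Proof.
move=> wA t; apply/matrixP => a b; rewrite [RHS]mxE.
have := @cder_linear_ode _ (fun t => (w *m rho t) a b) al _ t.
rewrite rho0 mulmx1; apply => s.
apply: (cder_eq (mxder_mul (mxder_cst w s) (mxder_group s) a b)).
by rewrite mul0mx add0r mulmxA wA -scalemxAl mxE.
Qed.

(* A Jordan block of size 2 would make the flow grow linearly, which is
   impossible for a periodic flow. *)
Lemma periodic_flow (w v : 'rV[C]_r) al : w *m (A - al%:M) = v -> v *m A = al *: v ->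
  cexp (al * tau%:C%C) *: (w + tau%:C%C *: v) = w.
Proof.
move=> wv vA; have vf := eigen_flow vA.
have key t : w *m rho t = cexp (al * t%:C%C) *: (w + t%:C%C *: v).
  apply/matrixP => a b.
  pose h t := cexp (- al * t%:C%C) * (w *m rho t) a b + - (t%:C%C * v a b).
  have hd s : cder h s 0.
    have d1 := cderM (cder_cexp (- al) s) (mxder_mul (mxder_cst w s) (mxder_group s) a b).
    have d3 := cderM (cder_real (@is_derive_id _ _ s 1)) (cder_cst (v a b) s).
    have d4 := cderZ (-1) d3.
    apply: (@cder_ext _ (fun s => cexp (- al * s%:C%C) * (w *m rho s) a b + -1 * (s%:C%C * v a b))).
      apply: (cder_eq (cderD d1 d4)).
      have wA : w *m A = v + al *: w.
        by rewrite -wv mulmxBr -scalemx1 -scalemxAr mulmx1 subrK.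
      have -> : (0 *m rho s + w *m (A *m rho s)) a b =
         cexp (al * s%:C%C) * v a b + al * (w *m rho s) a b.
        by rewrite mul0mx add0r mulmxA wA mulmxDl vf -scalemxAl !mxE.
      have ce : cexp (- al * s%:C%C) * cexp (al * s%:C%C) = 1.
        by rewrite -cexpD mulNr addNr cexp0.
      transitivity ((cexp (- al * s%:C%C) * cexp (al * s%:C%C) - 1) * v a b); last by rewrite ce subrr mul0r.
      by rewrite /=; ring.
    by move=> x; rewrite /h mulN1r.
  have := cder0_cst hd t; rewrite /h rho0 mulmx1 mulr0 cexp0 mul0r mul1r oppr0 addr0.
  move=> /eqP; rewrite subr_eq => /eqP e.
  rewrite [RHS]mxE [(w + _) a b]mxE [(t%:C%C *: v) a b]mxE -e mulrA -cexpD.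
  by rewrite mulNr subrr cexp0 mul1r.
by rewrite -key rho_tau mulmx1.
Qed.

(** Induction on the annihilating linear factors. By induction w (A - al) is a sum of eigenvectors;
    those with eigenvalue other than al are divided out of w. The remainder w' satisfies w' (A - al)
    = v with v in the al-eigenspace; periodicity forces v = 0, and then w' = 0 or al = i n with n an
    integer. *)
Lemma trig_decomp (l : seq C) (w : 'rV[C]_r) :
  w *m (\prod_(al <- l) (A - al%:M) : 'M[C]_r) = 0 ->
  exists s : seq (int * 'rV[C]_r), w = \sum_(k <- s) k.2 /\
    forall k, k \in s -> k.2 *m A = ('i%C * k.1%:~R) *: k.2.
Proof.
elim: l w => [|al l IH] w.
  rewrite big_nil [w *m _]mulmx1 => ->; exists [::]; split => //.
  by rewrite big_nil.
rewrite big_cons [X in w *m X](_ : _ = (A - al%:M) *m \prod_(al <- l) (A - al%:M)) //.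
rewrite mulmxA => /IH[s [ws sA]].
pose s1 := [seq (k.1, ('i%C * k.1%:~R - al)^-1 *: k.2) | k <- s & 'i%C * k.1%:~R != al].
pose w' := w - \sum_(k <- s1) k.2.
pose v := \sum_(k <- s | 'i%C * k.1%:~R == al) k.2.
have s1A k : k \in s1 -> k.2 *m A = ('i%C * k.1%:~R) *: k.2.
  move=> /mapP[k' + ->] /=; rewrite mem_filter => /andP[_ /sA k'A].
  by rewrite -scalemxAl k'A !scalerA mulrC.
have w'v : w' *m (A - al%:M) = v.
  rewrite /w' mulmxBl ws (bigID (fun k : int * 'rV[C]_r => 'i%C * k.1%:~R == al)) /=.
  rewrite -/v -[RHS]addr0 -addrA; congr (_ + _); apply/eqP; rewrite subr_eq0; apply/eqP.
  rewrite /s1 big_map big_filter mulmx_suml big_seq_cond [RHS]big_seq_cond.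
  apply: eq_bigr => k /andP[/sA kA kal] /=.
  rewrite -scalemxAl mulmxBr kA -scalemx1 -scalemxAr mulmx1 -scalerBl scalerA.
  by rewrite mulVf ?subr_eq0 // scale1r.
have vA : v *m A = al *: v.
  rewrite /v mulmx_suml scaler_sumr big_seq_cond [RHS]big_seq_cond.
  by apply: eq_bigr => k /andP[/sA kA /eqP <-].
have per := periodic_flow w'v vA.
have tau0 : (tau%:C%C : C) != 0.
  have : 0 < tau by rewrite pmulrn_lgt0 // pi_gt0.
  by rewrite -ltcR; exact: lt0r_neq0.
have v0 : v = 0.
  have [/hasP[k ks /eqP kal]|nk] := boolP (has (fun k : int * 'rV[C]_r => 'i%C * k.1%:~R == al) s).
    have e1 : cexp (al * tau%:C%C) = 1.
      rewrite -kal (_ : _ * tau%:C%C = k.1%:~R * ('i%C * tau%:C%C)); last by ring.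
      by rewrite cexpMz cexp_2pi exp1rz.
    move: per; rewrite e1 scale1r => /eqP; rewrite -subr_eq0 addrAC subrr add0r.
    by rewrite scaler_eq0 (negPf tau0) => /eqP.
  rewrite /v big_seq_cond big_pred0 // => k; apply/negP => /andP[ks kal].
  by move/hasPn: nk => /(_ k ks); rewrite kal.
have w'A : w' *m A = al *: w'.
  move: w'v; rewrite v0 mulmxBr => /eqP; rewrite subr_eq0 => /eqP ->.
  by rewrite -scalemx1 -scalemxAr mulmx1.
have wE : w = w' + \sum_(k <- s1) k.2 by rewrite subrK.
have [w'0|w'n] := eqVneq w' 0.
  by exists s1; split => //; rewrite wE w'0 add0r.
move: per; rewrite v0 scaler0 addr0 => per.
have e1 : cexp (al * tau%:C%C) = 1.
  apply/eqP; rewrite -subr_eq0; have : (cexp (al * tau%:C%C) - 1) *: w' = 0.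
    by rewrite scalerBl per scale1r subrr.
  by move/eqP; rewrite scaler_eq0 (negPf w'n) orbF.
have [n nal] := cexp_period e1.
exists ((n, w') :: s1); split; first by rewrite big_cons.
by move=> k; rewrite inE => /orP[/eqP -> /=|/s1A //]; rewrite -nal.
Qed.

(** The characteristic polynomial splits over the complex numbers and annihilates A, so the
    decomposition applies to every row vector. *)
Lemma trig_flow (w : 'rV[C]_r) : exists s : seq (int * 'rV[C]_r),
  forall t, w *m rho t = \sum_(k <- s) cexp ('i%C * k.1%:~R * t%:C%C) *: k.2.
Proof.
have [l lE] : exists l : seq C, (\prod_(al <- l) (A - al%:M) : 'M[C]_r) = 0.
  have [l /esym e] := closed_field_poly_normal (char_poly A).
  rewrite (monicP (char_poly_monic A)) scale1r in e.
  exists l; case: r A e => [|r'] A' e; first by apply/matrixP => -[].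
  rewrite -(Cayley_Hamilton A') -e rmorph_prod; apply: eq_bigr => al _.
  by rewrite rmorphB /= horner_mx_X horner_mx_C.
have [|s [ws sA]] := @trig_decomp l w; first by rewrite lE mulmx0.
exists s => t; rewrite ws mulmx_suml; apply: eq_big_seq => k ks.
exact: eigen_flow (sA _ ks) t.
Qed.

End Circle.

(** * Functions on the unit sphere *)

Section Sphere.
Variable R : realType.
Local Notation C := R[i].
Local Notation M3 := 'M[C]_3.
Variables A B : int.
Implicit Types (a b n : nat) (U V : 'M[C]_2).
Local Notation F := (F (R := R) A B).
Local Notation Fspan := (Fspan (R := R) A B).
Local Notation Fall := (Fspan (fun _ _ => True)).

Definition sph (v : 'cV[C]_2) : bool := v 0 0 * (v 0 0)^* + v 1 0 * (v 1 0)^* == 1.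
Definition sphere := {v : 'cV[C]_2 | sph v}.
Implicit Types (v : sphere).

Definition Asu (v : 'cV[C]_2) : 'M[C]_2 :=
  \matrix_(i, j) (if j == 0 then v i 0 else if i == 0 then - (v 1 0)^* else (v 0 0)^*).

Lemma Asu_U2 v : U2 (Asu (val v)).
Proof.
have /eqP e := valP v.
apply: mx22P; rewrite mulmx_entry sum2 !adjmxE !mxE /= ?rmorphN /= ?conjCK.
- by rewrite -[RHS]e; ring.
- ring.
- ring.
- by rewrite -[RHS]e; ring.
Qed.

Lemma Asu_det v : \det (Asu (val v)) = 1.
Proof. by have /eqP e := valP v; rewrite det22 !mxE /= -[RHS]e; ring. Qed.

(** A section over the slice u_3 = 1 of the cone: the element of SU(2) with first column v. On it
    all radial factors equal 1. *)
Definition gS v : M3 := Kemb (Asu (val v)).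

Lemma gS_SU21 v : SU21 (gS v).
Proof. exact: Kemb_SU21 (Asu_U2 v). Qed.

Lemma pt_gS v : (pt (gS v) 0 0 = val v 0 0) * (pt (gS v) 1 0 = val v 1 0) * (pt (gS v) 2 0 = 1).
Proof. by rewrite /gS !pt_Kemb Asu_det invr1 !mxE. Qed.

(** The default value v is returned when U v is off the sphere, which never happens for unitary
    U. *)
Definition act U v : sphere := insubd v (U *m val v).

Lemma sph_act U (v : 'cV[C]_2) : U2 U -> sph v -> sph (U *m v).
Proof.
move=> /matrixP UU /eqP e.
have f i j : (U 0 i)^* * U 0 j + (U 1 i)^* * U 1 j = (i == j)%:R.
  by have := UU i j; rewrite mulmx_entry sum2 !adjmxE => ->; rewrite mxE.
apply/eqP; rewrite !mulmx_entry !sum2 !rmorphD !rmorphM /=.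
transitivity (((U 0 0)^* * U 0 0 + (U 1 0)^* * U 1 0) * (v 0 0 * (v 0 0)^*)
  + ((U 0 1)^* * U 0 1 + (U 1 1)^* * U 1 1) * (v 1 0 * (v 1 0)^*)
  + ((U 0 0)^* * U 0 1 + (U 1 0)^* * U 1 1) * (v 1 0 * (v 0 0)^*)
  + ((U 0 1)^* * U 0 0 + (U 1 1)^* * U 1 0) * (v 0 0 * (v 1 0)^*)); first by ring.
by rewrite !f /= !mul0r !addr0 !mul1r.
Qed.

Lemma val_act U v : U2 U -> val (act U v) = U *m val v.
Proof. by move=> UU; rewrite val_insubd sph_act // (valP v). Qed.

Lemma actM U V v : U2 U -> U2 V -> act U (act V v) = act (U *m V) v.
Proof.
move=> UU VV; apply: val_inj; rewrite !val_act //; last exact: U2_mul.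
by rewrite mulmxA.
Qed.

Lemma U2_1 : U2 (1%:M : 'M[C]_2).
Proof. by rewrite /U2 /= adjmx1 mul1mx. Qed.

Lemma act1 v : act 1%:M v = v.
Proof. by apply: val_inj; rewrite val_act ?mul1mx //; exact: U2_1. Qed.

(** The lemmas below show that these restrictions contain 1 and are stable under multiplication by
    x, y and their conjugates, hence contain every polynomial on the sphere, and that they are
    stable under rotation. *)
Definition spherical (psi : sphere -> C) := exists2 f : funG R, Fall f & forall v, psi v = f (gS v).

Lemma spherical_ext (psi psi' : sphere -> C) : psi =1 psi' -> spherical psi -> spherical psi'.
Proof. by move=> /funext ->. Qed.

Lemma spherical_flin : flin [set psi | spherical psi].
Proof.
split; first by exists (fun=> 0) => //; exact: (@Fspan_lin R A B _).1.
move=> c f h [f' Ff' fE] [h' Fh' hE]; exists (fun g => c * f' g + h' g).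
  exact: (@Fspan_lin R A B _).2.
by move=> v; rewrite fE hE.
Qed.

Lemma sphericalD psi psi' : spherical psi -> spherical psi' -> spherical (fun v => psi v + psi' v).
Proof.
move=> h h'; apply: spherical_ext (spherical_flin.2 1 _ _ h h') => v; by rewrite mul1r.
Qed.

Lemma sphericalZ (c : C) psi : spherical psi -> spherical (fun v => c * psi v).
Proof.
move=> h; apply: spherical_ext (spherical_flin.2 c _ _ h spherical_flin.1) => v; by rewrite addr0.
Qed.

Lemma spherical0 : spherical (fun=> 0). Proof. exact: spherical_flin.1. Qed.

Lemma F_gS a b n v : F a b n (gS v) = (MM a b (pt (gS v)))`_n.
Proof.
rewrite F_in; last exact: gS_SU21.
by rewrite /Hp coefCM /radH pt_gS conjC1 !exp1rz !mul1r.
Qed.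

Lemma spherical_MM a b n : spherical (fun v => (MM a b (pt (gS v)))`_n).
Proof. by exists (F a b n); [exact: F_span | move=> v; rewrite F_gS]. Qed.

Lemma spherical_MMs a b n : spherical (fun v => ('X * MM a b (pt (gS v)))`_n).
Proof.
case: n => [|n].
  by apply: spherical_ext spherical0 => v; rewrite coefXM.
by apply: spherical_ext (spherical_MM a b n) => v; rewrite coefXM.
Qed.

Lemma rho_gS v : rho (pt (gS v)) = 1.
Proof. by have /eqP e := valP v; rewrite /rho !pt_gS. Qed.

Lemma spherical_mul (x : sphere -> C) :
  (forall a b n, spherical (fun v => x v * (MM a b (pt (gS v)))`_n)) ->
  forall psi, spherical psi -> spherical (fun v => x v * psi v).
Proof.
move=> xM psi [f Ff fE].
suff : Fall `<=` [set f | spherical (fun v => x v * f (gS v))].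
  by move=> /(_ f Ff); apply: spherical_ext => v; rewrite fE.
apply: cspan_min; last first.
  move=> _ [a [b [n [_ ->]]]] /=; apply: spherical_ext (xM a b n) => v; by rewrite F_gS.
split; first by apply: spherical_ext spherical0 => v; rewrite mulr0.
move=> c h h' hP hP'; apply: spherical_ext (spherical_flin.2 c _ _ hP hP') => v /=; by ring.
Qed.

Lemma spherical_k1 a b (h : sphere -> {poly C}) (p : sphere -> {poly C}) n :
  (forall v, (a + b).+1%:R * h v = p v) -> spherical (fun v => (p v)`_n) -> spherical (fun v => (h v)`_n).
Proof.
move=> hp /(sphericalZ (k1 R a b)^-1); apply: spherical_ext => v.
by rewrite -hp coef_natM mulKf // k1_neq0.
Qed.

Lemma spherical_deriv a b n : spherical (fun v => (MM a b (pt (gS v)))^`()`_n).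
Proof.
apply: spherical_ext (sphericalZ n.+1%:R (spherical_MM a b n.+1)) => v.
by rewrite coef_deriv mulr_natl.
Qed.

Lemma spherical_Xderiv a b n : spherical (fun v => ('X * (MM a b (pt (gS v)))^`())`_n).
Proof.
by apply: spherical_ext (sphericalZ n%:R (spherical_MM a b n)) => v; rewrite coef_Xderiv.
Qed.

(** The multiplication rule with [rho] = 1. It mixes labels, but on the sphere the radial factors no
    longer distinguish them. *)
Lemma spherical_x psi : spherical psi -> spherical (fun v => val v 0 0 * psi v).
Proof.
apply: spherical_mul => a b n.
apply: (@spherical_ext (fun v => ((pt (gS v) 0 0)%:P * MM a b (pt (gS v)))`_n)).
  by move=> v; rewrite coefCM pt_gS.
apply: (spherical_k1 (fun v => pieri_0 a b (pt (gS v)))).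
apply: (@spherical_ext (fun v => (a + b).+1%:R * (MM a.+1 b (pt (gS v)))`_n +
   (-1 * ('X * (MM a.+1 b (pt (gS v)))^`())`_n + b%:R * ('X * MM a b.-1 (pt (gS v)))`_n))).
  move=> v; rewrite rho_gS polyC1 mulr1.
  rewrite (_ : _ - 'X * _ = (a + b).+1%:R * MM a.+1 b (pt (gS v))
    + (- ('X * (MM a.+1 b (pt (gS v)))^`()) + b%:R * ('X * MM a b.-1 (pt (gS v))))).
    by rewrite !coefD coefN !coef_natM mulN1r.
  by move: (MM a.+1 b (pt (gS v)))^`() (MM a.+1 b (pt (gS v))) (MM a b.-1 (pt (gS v))) => p q r; ring.
apply: sphericalD; first exact: sphericalZ (spherical_MM _ _ _).
by apply: sphericalD; apply: sphericalZ; [exact: spherical_Xderiv | exact: spherical_MMs].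
Qed.

Lemma spherical_y psi : spherical psi -> spherical (fun v => val v 1 0 * psi v).
Proof.
apply: spherical_mul => a b n.
apply: (@spherical_ext (fun v => ((pt (gS v) 1 0)%:P * MM a b (pt (gS v)))`_n)).
  by move=> v; rewrite coefCM pt_gS.
apply: (spherical_k1 (fun v => pieri_1 a b (pt (gS v)))).
apply: (@spherical_ext (fun v => (MM a.+1 b (pt (gS v)))^`()`_n +
   - b%:R * (MM a b.-1 (pt (gS v)))`_n)).
  by move=> v; rewrite rho_gS polyC1 mulr1 coefB coef_natM mulNr.
by apply: sphericalD; [exact: spherical_deriv | apply: sphericalZ; exact: spherical_MM].
Qed.

Lemma spherical_xc psi : spherical psi -> spherical (fun v => (val v 0 0)^* * psi v).
Proof.
apply: spherical_mul => a b n.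
apply: (@spherical_ext (fun v => (((pt (gS v) 0 0)^*)%:P * MM a b (pt (gS v)))`_n)).
  by move=> v; rewrite coefCM pt_gS.
apply: (spherical_k1 (fun v => pieri_bar0 a b (pt (gS v)))).
apply: (@spherical_ext (fun v => (MM a b.+1 (pt (gS v)))^`()`_n +
   a%:R * (MM a.-1 b (pt (gS v)))`_n)).
  by move=> v; rewrite rho_gS polyC1 mulr1 coefD coef_natM.
by apply: sphericalD; [exact: spherical_deriv | apply: sphericalZ; exact: spherical_MM].
Qed.

Lemma spherical_yc psi : spherical psi -> spherical (fun v => (val v 1 0)^* * psi v).
Proof.
apply: spherical_mul => a b n.
apply: (@spherical_ext (fun v => (((pt (gS v) 1 0)^*)%:P * MM a b (pt (gS v)))`_n)).
  by move=> v; rewrite coefCM pt_gS.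
apply: (spherical_k1 (fun v => pieri_bar1 a b (pt (gS v)))).
apply: (@spherical_ext (fun v => ('X * (MM a b.+1 (pt (gS v)))^`())`_n +
   (a%:R * ('X * MM a.-1 b (pt (gS v)))`_n + - (a + b).+1%:R * (MM a b.+1 (pt (gS v)))`_n))).
  move=> v; rewrite rho_gS polyC1 mulr1.
  rewrite (_ : 'X * _ - _ = 'X * (MM a b.+1 (pt (gS v)))^`()
    + (a%:R * ('X * MM a.-1 b (pt (gS v))) - (a + b).+1%:R * MM a b.+1 (pt (gS v)))).
    by rewrite !coefD coefN !coef_natM mulNr.
  by move: (MM a b.+1 (pt (gS v)))^`() (MM a b.+1 (pt (gS v))) (MM a.-1 b (pt (gS v))) => p q r; ring.
apply: sphericalD; first exact: spherical_Xderiv.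
by apply: sphericalD; apply: sphericalZ; [exact: spherical_MMs | exact: spherical_MM].
Qed.

Lemma spherical_one : spherical (fun=> 1).
Proof.
by apply: spherical_ext (spherical_MM 0 0 0) => v; rewrite /MM !expr0 mulr1 coef1.
Qed.

Lemma spherical_iter (x : sphere -> C) psi n : (forall psi, spherical psi -> spherical (fun v => x v * psi v)) ->
  spherical psi -> spherical (fun v => x v ^+ n * psi v).
Proof.
move=> xP; elim: n psi => [|n IH] psi h; first by apply: spherical_ext h => v; rewrite mul1r.
by apply: spherical_ext (xP _ (IH _ h)) => v; rewrite exprS mulrA.
Qed.

Lemma cube_root (z : C) : exists d : C, d ^+ 3 = z.
Proof.
have /closed_rootP[d /rootP e] : size ('X^3 - z%:P) != 1%N by rewrite size_XnsubC.
by exists d; move: e; rewrite !hornerE => /eqP; rewrite subr_eq0 => /eqP.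
Qed.

(* The action of U on the sphere is realised in K by U / d with d^3 = det U. *)
Lemma act_Kemb U : U2 U -> exists (d : C) (V : 'M[C]_2), [/\ d != 0, U2 V &
  forall v, pt (Kemb V *m gS v) = d *: pt (gS (act U v))].
Proof.
move=> UU; have [d d3] := cube_root (\det U).
have [_ _ _ dd] := U2_eqs UU; have D0 := U2_det_neq0 UU.
have d0 : d != 0 by apply: contraNneq D0 => d0; rewrite -d3 d0 expr0n.
have dJ : d * d^* = 1.
  have h : (d * d^*) ^+ 3 = 1 by rewrite exprMn d3 -rmorphXn d3.
  have h0 : 0 <= d * d^* by rewrite mul_conjC_ge0.
  by apply/eqP; rewrite -(@pexpr_eq1 _ _ 3) //; apply/eqP.
exists d^-1, (d^-1 *: U); split; first by rewrite invr_eq0.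
  have adjZ : adjmx (d^-1 *: U) = (d^-1)^* *: adjmx U.
    by apply/matrixP => i j; rewrite adjmxE !mxE rmorphM.
  rewrite /U2 /= adjZ -scalemxAl -scalemxAr scalerA (UU : adjmx U *m U = 1%:M).
  by rewrite fmorphV /= -invfM mulrC dJ invr1 scale1r.
move=> v.
have e : pt (Kemb (d^-1 *: U) *m gS v) = Kemb (d^-1 *: U) *m pt (gS v) by rewrite /pt mulmxA.
have w k l : (d^-1 *: U) k l = d^-1 * U k l by rewrite mxE.
(* det (U / d) = d^-2 d^3 = d, so the third coordinate is scaled by 1/d exactly as the first two;
   this is why a cube root is taken. *)
have dW : (\det (d^-1 *: U))^-1 = d^-1 by rewrite detZ -d3; congr (_^-1); field.
have vE k : val (act U v) k 0 = U k 0 * val v 0 0 + U k 1 * val v 1 0.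
  by rewrite val_act // mulmx_entry sum2.
rewrite e; have aux (p q : 'cV[C]_3) : p 0 0 = val v 0 0 -> p 1 0 = val v 1 0 -> p 2 0 = 1 ->
    q 0 0 = val (act U v) 0 0 -> q 1 0 = val (act U v) 1 0 -> q 2 0 = 1 ->
    Kemb (d^-1 *: U) *m p = d^-1 *: q.
  move=> p0 p1 p2 q0 q1 q2.
  have s k : (d^-1 *: q) k 0 = d^-1 * q k 0 by rewrite mxE.
  apply: colP3; rewrite s.
  - by rewrite (Kemb_mulE _ p) p0 p1 q0 vE !w mulrDr !mulrA.
  - by rewrite (Kemb_mulE _ p) p0 p1 q1 vE !w mulrDr !mulrA.
  - by rewrite (Kemb_mulE _ p) p2 q2 dW.
by apply: aux; rewrite pt_gS.
Qed.

Lemma spherical_act U psi : U2 U -> spherical psi -> spherical (fun v => psi (act U v)).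
Proof.
move=> UU [f Ff fE]; have [d [V [d0 VV e]]] := act_Kemb UU.
have fp := @Fspan_princ R A B _ f Ff.
have KV : K (Kemb (invmx V)) by exists (invmx V) => //; exact: U2_inv.
exists (fun g => (charz A B d)^-1 * Kact (Kemb (invmx V)) f g).
  by apply: linsetZ; [exact: Fspan_lin | exact: Fspan_Kact].
have c0 : charz A B d != 0 by rewrite /charz mulf_neq0 // expfz_neq0 // conjC_eq0.
move=> v; rewrite fE /Kact Kemb_inv; last exact: U2_inv.
rewrite invmxK (princ_charz fp _ (gS_SU21 (act U v)) d0 (e v)); last first.
  by apply: SU21_mul; [exact: Kemb_SU21 | exact: gS_SU21].
by rewrite mulKf.
Qed.

End Sphere.

(** * Laurent polynomials in polar coordinates on the sphere *)

Section Laurent.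
Variable R : realType.
Local Notation C := R[i].
Local Notation key := (C * ((int * int) * (nat * nat)))%type.

(** A monomial in the polar coordinates x = s1 r1, y = s2 r2: integer powers of the phases and
    natural powers of the radii. In [ok4] the radii may be negative, which makes the sign symmetry
    below available. *)
Definition mono (k : key) (s1 s2 : C) (r1 r2 : R) : C :=
  k.1 * (s1 ^ k.2.1.1 * s2 ^ k.2.1.2 * (r1%:C%C ^+ k.2.2.1 * r2%:C%C ^+ k.2.2.2)).

Definition ok4 (s1 s2 : C) (r1 r2 : R) := [/\ s1 * s1^* = 1, s2 * s2^* = 1 & r1 ^+ 2 + r2 ^+ 2 = 1].

Definition laurent_repr (l : seq key) (G : C -> C -> R -> R -> C) := forall s1 s2 r1 r2,
  ok4 s1 s2 r1 r2 -> G s1 s2 r1 r2 = \sum_(k <- l) mono k s1 s2 r1 r2.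

Definition laurent G := exists l, laurent_repr l G.

Lemma ok4_neq0 s1 s2 r1 r2 : ok4 s1 s2 r1 r2 -> s1 != 0 /\ s2 != 0.
Proof.
move=> [h1 h2 _]; split; apply/eqP => e.
  by move/eqP: h1; rewrite e mul0r eq_sym oner_eq0.
by move/eqP: h2; rewrite e mul0r eq_sym oner_eq0.
Qed.

Lemma laurent_ext G G' : (forall s1 s2 r1 r2, ok4 s1 s2 r1 r2 -> G s1 s2 r1 r2 = G' s1 s2 r1 r2) ->
  laurent G -> laurent G'.
Proof. by move=> e [l h]; exists l => s1 s2 r1 r2 o; rewrite -e // h. Qed.

Lemma LM0 : laurent (fun _ _ _ _ => 0).
Proof. by exists [::] => s1 s2 r1 r2 _; rewrite big_nil. Qed.

Lemma LMD G G' : laurent G -> laurent G' -> laurent (fun s1 s2 r1 r2 => G s1 s2 r1 r2 + G' s1 s2 r1 r2).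
Proof. by move=> [l h] [l' h']; exists (l ++ l') => s1 s2 r1 r2 o; rewrite big_cat h // h'. Qed.

Lemma laurent_sum N (G : 'I_N -> C -> C -> R -> R -> C) : (forall i, laurent (G i)) ->
  laurent (fun s1 s2 r1 r2 => \sum_i G i s1 s2 r1 r2).
Proof.
move=> h; elim: (index_enum _) => [|i s IH].
  by apply: laurent_ext LM0 => *; rewrite big_nil.
by apply: laurent_ext (LMD (h i) IH) => *; rewrite big_cons.
Qed.

Lemma laurent_mono k G : laurent G -> laurent (fun s1 s2 r1 r2 => mono k s1 s2 r1 r2 * G s1 s2 r1 r2).
Proof.
move=> [l h]; exists [seq (k.1 * k'.1, ((k.2.1.1 + k'.2.1.1, k.2.1.2 + k'.2.1.2),
   ((k.2.2.1 + k'.2.2.1)%N, (k.2.2.2 + k'.2.2.2)%N))) | k' <- l] => s1 s2 r1 r2 o.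
have [n1 n2] := ok4_neq0 o.
rewrite h // mulr_sumr big_map; apply: eq_bigr => k' _.
rewrite /mono /= !expfzDr // !exprD.
move: (s1 ^ k.2.1.1) (s1 ^ k'.2.1.1) (s2 ^ k.2.1.2) (s2 ^ k'.2.1.2) => a b c d; ring.
Qed.

Lemma mono_cst c s1 s2 r1 r2 : mono (c, ((0, 0), (0%N, 0%N))) s1 s2 r1 r2 = c.
Proof. by rewrite /mono /= !expr0z !expr0 !mulr1. Qed.

Lemma mono_s1 n s1 s2 r1 r2 : mono (1, ((n, 0), (0%N, 0%N))) s1 s2 r1 r2 = s1 ^ n.
Proof. by rewrite /mono /= !expr0z !expr0 !mulr1 mul1r. Qed.

Lemma mono_s2 n s1 s2 r1 r2 : mono (1, ((0, n), (0%N, 0%N))) s1 s2 r1 r2 = s2 ^ n.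
Proof. by rewrite /mono /= !expr0z !expr0 !mulr1 !mul1r. Qed.

Lemma laurent_cst c : laurent (fun _ _ _ _ => c).
Proof.
by exists [:: (c, ((0, 0), (0%N, 0%N)))] => s1 s2 r1 r2 _; rewrite big_seq1 mono_cst.
Qed.

Lemma laurent_rot (e : C) n : laurent (fun _ _ r1 r2 => (r1%:C%C + e * r2%:C%C) ^+ n).
Proof.
elim: n => [|n IH]; first exact: laurent_cst.
have h1 := laurent_mono (1, ((0, 0), (1%N, 0%N))) IH.
have h2 := laurent_mono (e, ((0, 0), (0%N, 1%N))) IH.
apply: laurent_ext (LMD h1 h2) => s1 s2 r1 r2 _.
by rewrite /mono /= !expr0z !expr0 !expr1 exprS; ring.
Qed.

Definition odd1 (k : key) := odd (`|k.2.1.1| + k.2.2.1)%N.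
Definition odd2 (k : key) := odd (`|k.2.1.2| + k.2.2.2)%N.

Lemma exprz_sign (n : int) : (-1 : C) ^ n = (-1) ^+ odd `|n|%N.
Proof.
case: n => n /=; first by rewrite signr_odd.
rewrite NegzE -exprnN -exprVn invrN1; exact: (esym (signr_odd C n.+1)).
Qed.

Lemma mono_sign1 k s1 s2 r1 r2 : s1 != 0 ->
  mono k (- s1) s2 (- r1) r2 = (-1) ^+ odd1 k * mono k s1 s2 r1 r2.
Proof.
move=> n1; rewrite /mono rmorphN /= -(mulN1r s1) exprzMl ?unitfE ?oppr_eq0 ?oner_eq0 // (exprNn r1%:C%C).
rewrite exprz_sign /odd1 oddD signr_addb !signr_odd; ring.
Qed.

Lemma mono_sign2 k s1 s2 r1 r2 : s2 != 0 ->
  mono k s1 (- s2) r1 (- r2) = (-1) ^+ odd2 k * mono k s1 s2 r1 r2.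
Proof.
move=> n2; rewrite /mono rmorphN /= -(mulN1r s2) exprzMl ?unitfE ?oppr_eq0 ?oner_eq0 // (exprNn r2%:C%C).
rewrite exprz_sign /odd2 oddD signr_addb !signr_odd; ring.
Qed.

(* Averaging over a sign change that leaves G invariant keeps exactly the
   monomials of even parity. *)
Lemma laurent_average (l : seq key) (G : C -> C -> R -> R -> C) (o : key -> bool) :
  laurent_repr l G ->
  (forall s1 s2 r1 r2, ok4 s1 s2 r1 r2 ->
     G s1 s2 r1 r2 = \sum_(k <- l) (-1) ^+ o k * mono k s1 s2 r1 r2) ->
  laurent_repr [seq k <- l | ~~ o k] G.
Proof.
move=> h h' s1 s2 r1 r2 ok.
have -> : G s1 s2 r1 r2 = 2^-1 * (G s1 s2 r1 r2 + G s1 s2 r1 r2) by field.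
rewrite {1}(h _ _ _ _ ok) (h' _ _ _ _ ok) -big_split /= mulr_sumr big_filter [RHS]big_mkcond.
apply: eq_bigr => k _; case: (o k) => /=; first by rewrite expr1; field.
by rewrite expr0; field.
Qed.

(** The two invariances express that (s, r) and (-s, -r) name the same coordinate; averaging over
    each in turn leaves the monomials in which phase and radius have exponents of equal parity, for
    both coordinates. *)
Lemma laurent_even G : laurent G ->
  (forall s1 s2 r1 r2, ok4 s1 s2 r1 r2 -> G (- s1) s2 (- r1) r2 = G s1 s2 r1 r2) ->
  (forall s1 s2 r1 r2, ok4 s1 s2 r1 r2 -> G s1 (- s2) r1 (- r2) = G s1 s2 r1 r2) ->
  exists l, laurent_repr l G /\ forall k, k \in l -> ~~ odd1 k /\ ~~ odd2 k.
Proof.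
move=> [l h] I1 I2.
have okN1 s1 s2 r1 r2 : ok4 s1 s2 r1 r2 -> ok4 (- s1) s2 (- r1) r2.
  by move=> [h1 h2 h3]; split => //; [rewrite rmorphN mulrNN | rewrite sqrrN].
have okN2 s1 s2 r1 r2 : ok4 s1 s2 r1 r2 -> ok4 s1 (- s2) r1 (- r2).
  by move=> [h1 h2 h3]; split => //; [rewrite rmorphN mulrNN | rewrite sqrrN].
have h1 : laurent_repr [seq k <- l | ~~ odd1 k] G.
  apply: (laurent_average h) => s1 s2 r1 r2 ok; have [n1 n2] := ok4_neq0 ok.
  by rewrite -I1 // h; [apply: eq_bigr => k _; rewrite mono_sign1 | exact: okN1].
exists [seq k <- [seq k <- l | ~~ odd1 k] | ~~ odd2 k]; split.
  apply: (laurent_average h1) => s1 s2 r1 r2 ok; have [n1 n2] := ok4_neq0 ok.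
  by rewrite -I2 // h1; [apply: eq_bigr => k _; rewrite mono_sign2 | exact: okN2].
by move=> k; rewrite !mem_filter => /andP[? /andP[? _]].
Qed.

Definition zpow (n : int) (e : nat) (x : C) : C :=
  (if n is Posz m then x ^+ m else (x^*) ^+ `|n|%N) * (x * x^*) ^+ e.

(** With x = s r, the phase s^n uses up |n| factors r to form a power of x or of conj x. The
    remaining power of r is even by parity and nonnegative by the bound on N, hence a power of
    |x|^2. *)
Lemma zpowE (n : int) (p N : nat) (s : C) (r : R) : s * s^* = 1 -> ~~ odd (`|n| + p) ->
  (`|n| <= 2 * N)%N ->
  (s * r%:C%C * (s * r%:C%C)^*) ^+ N * (s ^ n * r%:C%C ^+ p) =
  zpow n ((p + 2 * N - `|n|)./2) (s * r%:C%C).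
Proof.
move=> ss on nN.
have rr : (r%:C%C : C)^* = r%:C%C by rewrite conjE /= oppr0.
have xx : s * r%:C%C * (s * r%:C%C)^* = r%:C%C ^+ 2.
  rewrite rmorphM /= rr expr2; transitivity (s * s^* * (r%:C%C * r%:C%C)); first by ring.
  by rewrite ss mul1r.
have eN : (2 * ((p + 2 * N - `|n|)./2) = p + 2 * N - `|n|)%N.
  rewrite mul2n even_halfK // oddB; last by lia.
  by rewrite oddD mul2n odd_double addbF addbC -oddD.
rewrite /zpow xx -!exprM eN.
have s0 : s != 0 by apply: contra_eqT ss => /negbNE/eqP ->; rewrite mul0r eq_sym oner_neq0.
have sV : s^-1 = s^* by apply: (mulfI s0); rewrite mulfV.
case: n on nN eN => m on nN eN.
  rewrite exprMn -mulrA -exprD mulrCA -exprD; congr (s ^+ _ * _ ^+ _); rewrite absz_nat in nN *; lia.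
have aE : `|Negz m|%N = m.+1 by [].
rewrite aE in nN eN *; rewrite rmorphM /= rr exprMn -mulrA -exprD NegzE -exprnN -exprVn sV.
by rewrite mulrCA -exprD; congr (_ * _ ^+ _); lia.
Qed.

End Laurent.

(** * Smooth K-finite functions on the sphere are polynomials *)

Section KFiniteSphere.
Variable R : realType.
Local Notation C := R[i].
Local Notation Re := complex.Re.
Local Notation sphere := (sphere R).
Variables (m : nat) (b : 'I_m -> sphere -> C).
Implicit Types (psi : sphere -> C) (U V : 'M[C]_2).

Definition ccurve (gam : R -> sphere) := forall t i, exists d,
  cder (fun t => val (gam t) i 0) t d.

(** The regularity that makes circle actions differentiable; in this form it is visibly preserved by
    linear combinations and rotations. *)
Definition smooth_curves psi := forall gam, ccurve gam -> forall t, exists d,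
  cder (fun t => psi (gam t)) t d.

(** With the family b fixed this is a space of dimension at most m, by taking U = 1, and it is
    stable under all of U(2): a finite-dimensional representation to which circles can be applied
    one after another. *)
Definition smooth_Kfin : set (sphere -> C) := [set psi | smooth_curves psi /\
  forall U, U2 U -> exists c : 'I_m -> C, forall v, psi (act U v) = \sum_i c i * b i v].

Lemma smooth_Kfin_flin : flin smooth_Kfin.
Proof.
split.
  split; first by move=> gam _ t; exists 0; exact: cder_cst.
  by move=> U _; exists (fun=> 0) => v; rewrite big1 // => i _; rewrite mul0r.
move=> c f h [f1 f2] [h1 h2]; split.
  move=> gam gc t; have [d fd] := f1 gam gc t; have [e he] := h1 gam gc t.
  by exists (c * d + e); apply: cderD => //; exact: cderZ.
move=> U UU; have [c1 c1E] := f2 U UU; have [c2 c2E] := h2 U UU.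
exists (fun i => c * c1 i + c2 i) => v; rewrite c1E c2E mulr_sumr -big_split.
by apply: eq_bigr => i _ /=; ring.
Qed.

Lemma ccurve_act U gam : U2 U -> ccurve gam -> ccurve (fun t => act U (gam t)).
Proof.
move=> UU gc t i; have [d0 h0] := gc t 0; have [d1 h1] := gc t 1.
exists (U i 0 * d0 + U i 1 * d1).
apply: (cder_ext (cderD (cderZ (U i 0) h0) (cderZ (U i 1) h1))) => s.
by rewrite val_act // mulmx_entry sum2.
Qed.

Lemma smooth_Kfin_act U psi : U2 U -> smooth_Kfin psi -> smooth_Kfin (fun v => psi (act U v)).
Proof.
move=> UU [p1 p2]; split.
  by move=> gam gc t; apply: (p1 (fun t => act U (gam t))); exact: ccurve_act.
move=> V VV; have [c cE] := p2 (U *m V) (U2_mul UU VV); exists c => v.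
by rewrite actM.
Qed.

(** In a dual basis the circle acts by matrices with entries phi_i (k(t) p_j), differentiable in t
    and periodic, so the flow is trigonometric. The components g_i remain in [smooth_Kfin], so that
    the next circle can be applied to them. *)
Lemma circle_step (k : R -> 'M[C]_2) psi : (forall t, U2 (k t)) ->
  (forall s t, k (s + t) = k s *m k t) -> k 0 = 1%:M -> k (pi *+ 2) = 1%:M ->
  (forall t i j, exists d, cder (fun t => k t i j) t d) ->
  smooth_Kfin psi -> exists N (n : 'I_N -> int) (g : 'I_N -> sphere -> C), (forall i, smooth_Kfin (g i)) /\
    forall t v, psi (act (k t) v) = \sum_i cexp ('i%C * (n i)%:~R * t%:C%C) * g i v.
Proof.
move=> kU kD k0 kT kd Wpsi.
have [|r [phi [p [Wphi dual expand]]]] := @dual_basis _ _ smooth_Kfin m b smooth_Kfin_flin.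
  move=> f [_ /(_ _ (U2_1 R))[c cE]]; exists c; apply/funext => v.
  by rewrite -cE act1.
pose rho t : 'M[C]_r := \matrix_(i, j) phi i (act (k t) (p j)).
have phiE t i v : phi i (act (k t) v) = \sum_j rho t i j * phi j v.
  have := expand _ (smooth_Kfin_act (kU t) (Wphi i)) => /(congr1 (fun f => f v)) ->.
  by apply: eq_bigr => j _; rewrite mxE.
have rhoD s t : rho (s + t) = rho s *m rho t.
  apply/matrixP => i j; rewrite mxE mulmx_entry kD -actM // phiE.
  by apply: eq_bigr => l _; rewrite [X in _ = _ * X]mxE.
have one t : k t = 1%:M -> rho t = 1%:M.
  by move=> kt; apply/matrixP => i j; rewrite !mxE kt act1 dual.
have dA i j : exists d, cder (fun t => rho t i j) 0 d.
  have [s1 _] := Wphi i; have gc : ccurve (fun t => act (k t) (p j)).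
    move=> t l; have [d0 h0] := kd t l 0; have [d1 h1] := kd t l 1.
    exists (val (p j) 0 0 * d0 + val (p j) 1 0 * d1).
    apply: (cder_ext (cderD (cderZ _ h0) (cderZ _ h1))) => s.
    by rewrite val_act // mulmx_entry sum2; ring.
  have [d dE] := s1 _ gc 0; exists d; apply: (cder_ext dE) => t; by rewrite mxE.
pose A : 'M[C]_r := \matrix_(i, j) projT1 (cid (dA i j)).
have rho_der : mxder rho 0 A.
  by move=> i j; rewrite mxE; exact: (projT2 (cid (dA i j))).
have [s sE] := trig_flow rhoD (one _ k0) (one _ kT) rho_der (\row_i psi (p i)).
exists (size s), (fun i => (nth (0, 0) s i).1),
  (fun i v => \sum_j (nth (0, 0) s i).2 0 j * phi j v); split.
  by move=> i; apply: (flin_sum smooth_Kfin_flin).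
move=> t v.
have -> : psi (act (k t) v) = \sum_j ((\row_i psi (p i)) *m rho t) 0 j * phi j v.
  rewrite {1}(expand _ Wpsi).
  under eq_bigr do rewrite phiE mulr_sumr.
  rewrite exchange_big; apply: eq_bigr => j _; rewrite mxE mulr_suml.
  by apply: eq_bigr => i _; rewrite [in RHS]mxE mulrA.
rewrite sE (big_nth (0, 0)) big_mkord.
under eq_bigr do rewrite summxE mulr_suml.
rewrite exchange_big; apply: eq_bigr => i _; rewrite mulr_sumr.
by apply: eq_bigr => j _; rewrite mxE mulrA.
Qed.

Definition dg (s1 s2 : C) : 'M[C]_2 :=
  \matrix_(i, j) (if i == j then (if i == 0 then s1 else s2) else 0).
Definition rotm (r1 r2 : R) : 'M[C]_2 :=
  \matrix_(i, j) (if i == j then r1%:C%C else if i == 0 then - r2%:C%C else r2%:C%C).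

Lemma conj_real (r : R) : (r%:C%C : C)^* = r%:C%C.
Proof. by rewrite conjE /= oppr0. Qed.

Lemma dg_U2 s1 s2 : s1 * s1^* = 1 -> s2 * s2^* = 1 -> U2 (dg s1 s2).
Proof.
move=> h1 h2; apply: mx22P; rewrite mulmx_entry sum2 !adjmxE !mxE /= ?conjC0.
- by rewrite mul0r addr0 mulrC.
- by rewrite mulr0 mul0r addr0.
- by rewrite mulr0 mul0r addr0.
- by rewrite mul0r add0r mulrC.
Qed.

Lemma rotm_U2 r1 r2 : r1 ^+ 2 + r2 ^+ 2 = 1 -> U2 (rotm r1 r2).
Proof.
move=> h; have h' : r1%:C%C * r1%:C%C + r2%:C%C * r2%:C%C = 1 :> C.
  by rewrite -!rmorphM -rmorphD -!expr2 h.
apply: mx22P; rewrite mulmx_entry sum2 !adjmxE !mxE /= ?rmorphN /= !conj_real.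
- exact: h'.
- ring.
- ring.
- by rewrite -[RHS]h'; ring.
Qed.

Lemma expi_unit (t : R) : cexp ('i%C * t%:C%C) * (cexp ('i%C * t%:C%C))^* = 1 :> C.
Proof.
rewrite cexp_i conjE; apply: complexP; rewrite ?cReM ?cImM /=; last by ring.
by rewrite -[RHS](cos2Dsin2 t); ring.
Qed.

Lemma north_sph : sph (\col_i (i == 0)%:R : 'cV[C]_2).
Proof. by rewrite /sph !mxE /= conjC0 conjC1 mulr0 mulr1 addr0. Qed.

Definition north : sphere := Sub (\col_i (i == 0)%:R) north_sph.

Definition Gfun psi (s1 s2 : C) (r1 r2 : R) : C :=
  psi (act (dg s1 1) (act (dg 1 s2) (act (rotm r1 r2) north))).

Lemma cexp_int (n : int) (t : R) : cexp ('i%C * n%:~R * t%:C%C) = cexp ('i%C * t%:C%C) ^ n :> C.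
Proof. by rewrite -cexpMz; congr cexp; ring. Qed.

Lemma sqrD1_cos (r1 r2 : R) : r1 ^+ 2 + r2 ^+ 2 = 1 -> exists t : R,
  r1 = cos t /\ r2 = sin t.
Proof. by move=> /polar_sphere[t [<- <-]]; exists t. Qed.

Lemma cder_expi (t : R) : exists d, cder (fun t => cexp ('i%C * t%:C%C) : C) t d.
Proof. by eexists; exact: cder_cexp. Qed.

(** The character e^(int) of the rotation circle is (r1 + i r2)^n; for negative n it equals (r1 - i
    r2)^|n| because r1^2 + r2^2 = 1, so no negative powers of the radii occur. *)
Lemma laurent_stage3 psi : smooth_Kfin psi -> laurent (fun _ _ r1 r2 => psi (act (rotm r1 r2) north)).
Proof.
move=> Wpsi.
have cs1 (t : R) : cos t ^+ 2 + sin t ^+ 2 = 1 by exact: cos2Dsin2.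
have [||||||N [n [g [Wg gE]]]] := @circle_step (fun t => rotm (cos t) (sin t)) psi.
- by move=> t; exact: rotm_U2.
- move=> s t; apply: mx22P; rewrite mulmx_entry sum2 !mxE /= ?cosD ?sinD;
  rewrite ?rmorphB ?rmorphD !rmorphM /=; ring.
- by apply: mx22P; rewrite !mxE /= ?cos0 ?sin0 ?oppr0.
- by apply: mx22P; rewrite !mxE /= ?cos2pi ?sin2pi ?oppr0.
- move=> t i j.
  have hc : cder (fun t => (cos t)%:C%C : C) t (- sin t)%:C%C.
    by apply: cder_real; exact: is_derive_cos.
  have hs : cder (fun t => (sin t)%:C%C : C) t (cos t)%:C%C.
    by apply: cder_real; exact: is_derive_sin.
  elim/ord2P: i; elim/ord2P: j; eexists.
  + by apply: (cder_ext hc) => s; rewrite mxE.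
  + by apply: (cder_ext (cderZ (-1) hs)) => s; rewrite mxE /= mulN1r.
  + by apply: (cder_ext hs) => s; rewrite mxE.
  + by apply: (cder_ext hc) => s; rewrite mxE.
- exact: Wpsi.
have L (k : int) : laurent (fun _ _ (r1 r2 : R) => (r1%:C%C + 'i%C * r2%:C%C : C) ^ k).
  case: k => k; first exact: laurent_rot.
  apply: laurent_ext (laurent_rot (- 'i%C) k.+1) => _ _ r1 r2 [_ _ h].
  rewrite NegzE -exprnN -exprVn; congr (_ ^+ _).
  have e : (r1%:C%C + 'i%C * r2%:C%C) * (r1%:C%C + - 'i%C * r2%:C%C) = 1 :> C.
    transitivity (r1%:C%C * r1%:C%C - ('i%C * 'i%C) * (r2%:C%C * r2%:C%C) : C); first by ring.
    by rewrite i_sqr mulN1r opprK -!rmorphM -rmorphD -!expr2 h.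
  apply: (mulfI (x := r1%:C%C + 'i%C * r2%:C%C)).
    by apply: contra_eqT e => /negbNE/eqP ->; rewrite mul0r eq_sym oner_neq0.
  rewrite e mulfV //.
  by apply: contra_eqT e => /negbNE/eqP ->; rewrite mul0r eq_sym oner_neq0.
have H i := laurent_mono (g i north, ((0, 0), (0%N, 0%N))) (L (n i)).
apply: laurent_ext (laurent_sum H) => s1 s2 r1 r2 [_ _ h].
have [t [-> ->]] := sqrD1_cos h; rewrite gE; apply: eq_bigr => i _.
have ce : Complex (cos t) (sin t) = (cos t)%:C%C + 'i%C * (sin t)%:C%C.
  by apply: complexP; rewrite ?cReD ?cImD ?cReM ?cImM /=; ring.
by rewrite mono_cst cexp_int cexp_i ce mulrC.
Qed.

Lemma dg_circle (e1 e2 : bool) : let k t := dg (if e1 then cexp ('i%C * t%:C%C) else 1)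
     (if e2 then cexp ('i%C * t%:C%C) else 1) in
  [/\ forall t, U2 (k t), forall s t, k (s + t) = k s *m k t, k 0 = 1%:M,
   k (pi *+ 2) = 1%:M & forall t i j, exists d, cder (fun t => k t i j) t d].
Proof.
move=> k.
have one : (1 : C) * 1^* = 1 by rewrite conjC1 mulr1.
have eD s t : cexp ('i%C * (s + t)%:C%C) = cexp ('i%C * s%:C%C) * cexp ('i%C * t%:C%C) :> C.
  by rewrite -cexpD -mulrDr -rmorphD.
split.
- by move=> t; apply: dg_U2; [case: e1 @k | case: e2 @k]; rewrite //= ?expi_unit.
- move=> s t; apply: mx22P; rewrite mulmx_entry sum2 !mxE /= ?(mulr0, mul0r, addr0, add0r) //.
    by case: e1 @k => /=; rewrite ?mulr1.
  by case: e2 @k => /=; rewrite ?mulr1.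
- apply: mx22P; rewrite !mxE //=; last by case: e2 @k => //=; rewrite mulr0 cexp0.
  by case: e1 @k => //=; rewrite mulr0 cexp0.
- apply: mx22P; rewrite !mxE //=; last by case: e2 @k => //=; rewrite cexp_2pi.
  by case: e1 @k => //=; rewrite cexp_2pi.
move=> t i j; have [d hd] := cder_expi t.
have fin (f : R -> C) (e : bool) : (forall t, f t = if e then cexp ('i%C * t%:C%C) else 1) ->
    exists d, cder f t d.
  move=> fE; exists (if e then d else 0); case: e fE => fE.
    by apply: (cder_ext hd) => s; rewrite fE.
  by apply: (cder_ext (cder_cst 1 t)) => s; rewrite fE.
have fin0 (f : R -> C) : (forall t, f t = 0) -> exists d, cder f t d.
  by move=> fE; exists 0; apply: (cder_ext (cder_cst 0 t)) => s; rewrite fE.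
elim/ord2P: i; elim/ord2P: j.
- by apply: (fin _ e1) => s; rewrite mxE.
- by apply: fin0 => s; rewrite mxE.
- by apply: fin0 => s; rewrite mxE.
- by apply: (fin _ e2) => s; rewrite mxE.
Qed.

Lemma laurent_stage2 psi : smooth_Kfin psi ->
  laurent (fun _ s2 r1 r2 => psi (act (dg 1 s2) (act (rotm r1 r2) north))).
Proof.
move=> Wpsi; have [kU kD k0 kT kd] := dg_circle false true.
have [N [n [g [Wg gE]]]] := circle_step kU kD k0 kT kd Wpsi.
have H i := laurent_mono (1, ((0, n i), (0%N, 0%N))) (laurent_stage3 (Wg i)).
apply: laurent_ext (laurent_sum H) => s1 s2 r1 r2 [_ h2 _].
have [t <-] := unit_complex h2; rewrite gE; apply: eq_bigr => i _.
by rewrite mono_s2 cexp_int.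
Qed.

Lemma laurent_stage1 psi : smooth_Kfin psi -> laurent (Gfun psi).
Proof.
move=> Wpsi; have [kU kD k0 kT kd] := dg_circle true false.
have [N [n [g [Wg gE]]]] := circle_step kU kD k0 kT kd Wpsi.
have H i := laurent_mono (1, ((n i, 0), (0%N, 0%N))) (laurent_stage2 (Wg i)).
apply: laurent_ext (laurent_sum H) => s1 s2 r1 r2 [h1 _ _].
have [t <-] := unit_complex h1; rewrite /Gfun gE; apply: eq_bigr => i _.
by rewrite mono_s1 cexp_int.
Qed.

Lemma val_param s1 s2 r1 r2 : ok4 s1 s2 r1 r2 ->
  (val (act (dg s1 1) (act (dg 1 s2) (act (rotm r1 r2) north))) 0 0 = s1 * r1%:C%C) *
  (val (act (dg s1 1) (act (dg 1 s2) (act (rotm r1 r2) north))) 1 0 = s2 * r2%:C%C).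
Proof.
move=> [h1 h2 h3]; have one : (1 : C) * 1^* = 1 by rewrite conjC1 mulr1.
have u1 := dg_U2 h1 one; have u2 := dg_U2 one h2; have u3 := rotm_U2 h3.
rewrite !val_act //; set w := rotm _ _ *m _.
have w0 : w 0 0 = r1%:C%C by rewrite mulmx_entry sum2 !mxE /= mulr1 mulr0 addr0.
have w1 : w 1 0 = r2%:C%C by rewrite mulmx_entry sum2 !mxE /= mulr1 mulr0 addr0.
by rewrite !mulmx_entry !sum2 !mulmx_entry !sum2 w0 w1 !mxE /= !(mul0r, addr0, add0r, mul1r).
Qed.

Lemma sphere_eq (v w : sphere) : val v 0 0 = val w 0 0 -> val v 1 0 = val w 1 0 -> v = w.
Proof. by move=> h0 h1; apply: val_inj; apply/colP; exact: ord2P. Qed.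

Lemma Gfun_eq psi s1 s2 r1 r2 s1' s2' r1' r2' : ok4 s1 s2 r1 r2 -> ok4 s1' s2' r1' r2' ->
  s1 * r1%:C%C = s1' * r1'%:C%C -> s2 * r2%:C%C = s2' * r2'%:C%C ->
  Gfun psi s1 s2 r1 r2 = Gfun psi s1' s2' r1' r2'.
Proof.
move=> ok ok' e1 e2; apply: (congr1 psi); apply: sphere_eq.
  exact: etrans (val_param ok).1 (etrans e1 (esym (val_param ok').1)).
exact: etrans (val_param ok).2 (etrans e2 (esym (val_param ok').2)).
Qed.

Lemma sphere_param (v : sphere) : exists s1 s2 r1 r2, ok4 s1 s2 r1 r2 /\
  v = act (dg s1 1) (act (dg 1 s2) (act (rotm r1 r2) north)).
Proof.
have pol (z : C) : exists (s : C) (r : R), [/\ s * s^* = 1, z = s * r%:C%C & z * z^* = (r ^+ 2)%:C%C].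
  have [->|z0] := eqVneq z 0.
    by exists 1, 0; split; rewrite ?conjC1 ?mulr1 // ?mulr0 // mul0r expr0n.
  have n0 : `|z| != 0 by rewrite normr_eq0.
  have rz : (Re `|z|)%:C%C = `|z| by rewrite RRe_real // normr_real.
  exists (z / `|z|), (Re `|z|); split.
  - rewrite rmorphM fmorphV /= [(`|z|)^*]conj_Creal ?normr_real //.
    by rewrite mulrACA -normCK -invfM -expr2 mulfV // expf_neq0.
  - by rewrite rz divfK.
  - by rewrite rmorphXn /= rz normCK.
have [s1 [r1 [h1 e1 n1]]] := pol (val v 0 0); have [s2 [r2 [h2 e2 n2]]] := pol (val v 1 0).
have ok : ok4 s1 s2 r1 r2.
  split => //; have /eqP := valP v; rewrite n1 n2 -rmorphD => h.
  by apply: (@complexI R); rewrite h.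
exists s1, s2, r1, r2; split => //.
by apply: sphere_eq; rewrite (val_param ok).
Qed.

Variables A B : int.
Local Notation spherical := (@spherical R A B).

Definition Xf (v : sphere) : C := (val v 0 0 * (val v 0 0)^*) * (val v 1 0 * (val v 1 0)^*).

Lemma spherical_Xf psi : spherical psi -> spherical (fun v => Xf v * psi v).
Proof.
move=> h; apply: spherical_ext (spherical_x (spherical_xc (spherical_y (spherical_yc h)))) => v.
by rewrite /Xf !mulrA.
Qed.

Lemma spherical_zpow0 n e psi : spherical psi -> spherical (fun v => zpow n e (val v 0 0) * psi v).
Proof.
move=> h.
have h1 : spherical (fun v => (val v 0 0 * (val v 0 0)^*) ^+ e * psi v).
  apply: spherical_iter h => f hf; apply: spherical_ext (spherical_x (spherical_xc hf)) => v; by rewrite mulrA.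
case: n => n.
  by apply: spherical_ext (spherical_iter n (@spherical_x R A B) h1) => v; rewrite /zpow mulrA.
by apply: spherical_ext (spherical_iter n.+1 (@spherical_xc R A B) h1) => v; rewrite /zpow mulrA.
Qed.

Lemma spherical_zpow1 n e psi : spherical psi -> spherical (fun v => zpow n e (val v 1 0) * psi v).
Proof.
move=> h.
have h1 : spherical (fun v => (val v 1 0 * (val v 1 0)^*) ^+ e * psi v).
  apply: spherical_iter h => f hf; apply: spherical_ext (spherical_y (spherical_yc hf)) => v; by rewrite mulrA.
case: n => n.
  by apply: spherical_ext (spherical_iter n (@spherical_y R A B) h1) => v; rewrite /zpow mulrA.
by apply: spherical_ext (spherical_iter n.+1 (@spherical_yc R A B) h1) => v; rewrite /zpow mulrA.
Qed.

(* Multiplying by a power of |xy|^2 clears all the negative powers of the radii. *)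
Lemma spherical_clear psi : smooth_Kfin psi -> exists N, spherical (fun v => Xf v ^+ N * psi v).
Proof.
move=> Wpsi.
have okN1 s1 s2 r1 r2 : ok4 s1 s2 r1 r2 -> @ok4 R (- s1) s2 (- r1) r2.
  by move=> [h1 h2 h3]; split => //; [rewrite rmorphN mulrNN | rewrite sqrrN].
have okN2 s1 s2 r1 r2 : ok4 s1 s2 r1 r2 -> @ok4 R s1 (- s2) r1 (- r2).
  by move=> [h1 h2 h3]; split => //; [rewrite rmorphN mulrNN | rewrite sqrrN].
have [||l [lE leven]] := laurent_even (laurent_stage1 Wpsi).
- move=> s1 s2 r1 r2 ok; apply: (Gfun_eq _ (okN1 _ _ _ _ ok) ok) => //.
  by rewrite rmorphN mulrNN.
- move=> s1 s2 r1 r2 ok; apply: (Gfun_eq _ (okN2 _ _ _ _ ok) ok) => //.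
  by rewrite rmorphN mulrNN.
(* A crude bound for all phase exponents at once, as required by [zpowE]. *)
pose N := (\sum_(k <- l) (`|k.2.1.1| + `|k.2.1.2|))%N; exists N.
have kN k : k \in l -> (`|k.2.1.1| + `|k.2.1.2| <= N)%N.
  by move=> kl; rewrite /N (big_rem k) //= leq_addr.
pose t k (v : sphere) := k.1 * (zpow k.2.1.1 ((k.2.2.1 + 2 * N - `|k.2.1.1|)./2) (val v 0 0) *
   zpow k.2.1.2 ((k.2.2.2 + 2 * N - `|k.2.1.2|)./2) (val v 1 0)).
have tP k : spherical (t k).
  apply: sphericalZ; apply: spherical_ext (spherical_zpow0 k.2.1.1 ((k.2.2.1 + 2 * N - `|k.2.1.1|)./2)
    (spherical_zpow1 k.2.1.2 ((k.2.2.2 + 2 * N - `|k.2.1.2|)./2) (@spherical_one R A B))) => v.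
  by rewrite mulr1.
apply: (@spherical_ext R A B (fun v => \sum_(k <- l) t k v)); last first.
  elim: {1}l => [|k s IH]; first by apply: spherical_ext (@spherical0 R A B) => v; rewrite big_nil.
  by apply: spherical_ext (sphericalD (tP k) IH) => v; rewrite big_cons.
move=> v; have [s1 [s2 [r1 [r2 [ok vE]]]]] := sphere_param v.
have e : psi v = Gfun psi s1 s2 r1 r2 by rewrite vE.
rewrite e lE // mulr_sumr; apply: eq_big_seq => k kl.
have [od1 od2] := leven k kl; have le := kN k kl; have [h1 h2 _] := ok.
have le1 : (`|k.2.1.1| <= 2 * N)%N by apply: leq_trans (leq_trans (leq_addr _ _) le) _; rewrite leq_pmull.
have le2 : (`|k.2.1.2| <= 2 * N)%N by apply: leq_trans (leq_trans (leq_addl _ _) le) _; rewrite leq_pmull.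
rewrite /t /Xf vE !(val_param ok) -(zpowE _ h1 od1 le1) -(zpowE _ h2 od2 le2).
rewrite /mono [in RHS]exprMn; move: (s1 ^ _) (s2 ^ _) (_%:C%C ^+ k.2.2.1) (_%:C%C ^+ k.2.2.2) => a c a' c'.
move: ((s1 * _ * _) ^+ N) ((s2 * _ * _) ^+ N) => p q; ring.
Qed.

(** It carries xy to i (x^2 + y^2) / 2, while [rot45] carries it to (x^2 - y^2) / 2. *)
Definition rot45i : 'M[C]_2 :=
  \matrix_(i, j) (if i == j then half_sqrt R else 'i%C * half_sqrt R).

Lemma rot45i_U2 : U2 rot45i.
Proof.
have h := half_sqrt_sqr R.
apply: mx22P; rewrite mulmx_entry sum2 !adjmxE !mxE /= ?rmorphM /= ?conj_i !half_sqrt_conj.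
- transitivity (half_sqrt R * half_sqrt R * (1 - 'i%C * 'i%C)); first by ring.
  by rewrite i_sqr h; field.
- ring.
- ring.
- transitivity (half_sqrt R * half_sqrt R * (1 - 'i%C * 'i%C)); first by ring.
  by rewrite i_sqr h; field.
Qed.

Lemma Xf_act U v : U2 U -> Xf (act U v) =
  (U 0 0 * val v 0 0 + U 0 1 * val v 1 0) * (U 0 0 * val v 0 0 + U 0 1 * val v 1 0)^* *
  ((U 1 0 * val v 0 0 + U 1 1 * val v 1 0) * (U 1 0 * val v 0 0 + U 1 1 * val v 1 0)^*).
Proof. by move=> UU; rewrite /Xf (val_act _ UU) !mulmx_entry !sum2. Qed.

(** By the parallelogram law the two rotated terms add up to (|x|^4 + |y|^4) / 2, and |xy|^2
    completes the square (|x|^2 + |y|^2)^2 / 2. *)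
Lemma Xf_sum v : Xf v + Xf (act (rot45 R) v) + Xf (act rot45i v) = 2^-1.
Proof.
have /eqP e := valP v; have h := half_sqrt_sqr R; have hi := i_sqr R.
rewrite (Xf_act _ (rot45_U2 R)) (Xf_act _ rot45i_U2) /Xf !mxE /= !rmorphD !rmorphM.
rewrite ?rmorphN /= conj_i half_sqrt_conj.
move: (val v 0 0) (val v 1 0) e => x y.
move: (x^*) (y^*) => xc yc e.
move: (half_sqrt R) h ('i%C) hi => s h i hi.
transitivity (x * xc * (y * yc) + (s * s) * (s * s) * ((x * x - y * y) * (xc * xc - yc * yc) +
  (i * (x * x + y * y) + x * y * (1 + i * i)) * (- i * (xc * xc + yc * yc) + xc * yc * (1 + i * i)))).
  by ring.
rewrite h hi addrN !mulr0 !addr0.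
transitivity (x * xc * (y * yc) + 2^-1 * 2^-1 * ((x * x - y * y) * (xc * xc - yc * yc) +
  - (i * i) * ((x * x + y * y) * (xc * xc + yc * yc)))); first by ring.
rewrite hi; transitivity (2^-1 * ((x * xc + y * yc) * (x * xc + y * yc))); first by field.
by rewrite e mulr1 mulr1.
Qed.

(** The relation X0 + X1 + X2 = 1/2 writes psi times a monomial as twice the sum of its three
    multiples of the next degree. From degree N0 + N1 + N2 on, every monomial contains one of the
    given powers, and induction descends to degree 0. *)
Lemma spherical_cover (X0 X1 X2 : sphere -> C) psi N0 N1 N2 :
  (forall f, spherical f -> spherical (fun v => X0 v * f v)) ->
  (forall f, spherical f -> spherical (fun v => X1 v * f v)) ->
  (forall f, spherical f -> spherical (fun v => X2 v * f v)) ->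
  (forall v, X0 v + X1 v + X2 v = 2^-1) ->
  spherical (fun v => X0 v ^+ N0 * psi v) -> spherical (fun v => X1 v ^+ N1 * psi v) ->
  spherical (fun v => X2 v ^+ N2 * psi v) -> spherical psi.
Proof.
move=> m0 m1 m2 XS h0 h1 h2.
have base i j k : (N0 <= i)%N || (N1 <= j)%N || (N2 <= k)%N ->
    spherical (fun v => X0 v ^+ i * (X1 v ^+ j * (X2 v ^+ k * psi v))).
  move=> /orP[/orP[le|le]|le].
  - apply: spherical_ext (spherical_iter (i - N0) m0 (spherical_iter j m1 (spherical_iter k m2 h0))) => v.
    rewrite -{2}(subnK le) exprD; move: (_ ^+ _) (_ ^+ _) (_ ^+ _) (_ ^+ _) => p q r s; ring.
  - apply: spherical_ext (spherical_iter i m0 (spherical_iter (j - N1) m1 (spherical_iter k m2 h1))) => v.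
    rewrite -{2}(subnK le) exprD; move: (_ ^+ _) (_ ^+ _) (_ ^+ _) (_ ^+ _) => p q r s; ring.
  - apply: spherical_ext (spherical_iter i m0 (spherical_iter j m1 (spherical_iter (k - N2) m2 h2))) => v.
    rewrite -{2}(subnK le) exprD; move: (_ ^+ _) (_ ^+ _) (_ ^+ _) (_ ^+ _) => p q r s; ring.
have main n : forall i j k, (N0 + N1 + N2 <= i + j + k + n)%N ->
    spherical (fun v => X0 v ^+ i * (X1 v ^+ j * (X2 v ^+ k * psi v))).
  elim: n => [|n IH] i j k le; first by apply: base; lia.
  have [g0 g1] : (N0 + N1 + N2 <= i.+1 + j + k + n)%N /\ (N0 + N1 + N2 <= i + j.+1 + k + n)%N by lia.
  have g2 : (N0 + N1 + N2 <= i + j + k.+1 + n)%N by lia.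
  apply: spherical_ext (sphericalZ 2 (sphericalD (IH _ _ _ g0) (sphericalD (IH _ _ _ g1) (IH _ _ _ g2)))) => v.
  transitivity (2 * (X0 v + X1 v + X2 v) * (X0 v ^+ i * (X1 v ^+ j * (X2 v ^+ k * psi v)))).
    rewrite !exprS; move: (X0 v ^+ _) (X1 v ^+ _) (X2 v ^+ _) => p q r; ring.
  by rewrite XS mulfV ?mul1r // pnatr_eq0.
have := main (N0 + N1 + N2)%N 0%N 0%N 0%N; rewrite !add0n leqnn => /(_ isT).
by apply: spherical_ext => v; rewrite !expr0 !mul1r.
Qed.

(** Denominators are cleared for psi and for its two rotated copies; rotating back gives three
    clearings of the same psi, by functions without common zero. *)
Lemma smooth_Kfin_spherical psi : smooth_Kfin psi -> spherical psi.
Proof.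
move=> Wpsi.
have clr U : U2 U -> exists N, spherical (fun v => Xf (act U v) ^+ N * psi v).
  move=> UU; have VV := U2_inv UU; have [N h] := spherical_clear (smooth_Kfin_act VV Wpsi).
  exists N; apply: spherical_ext (spherical_act UU h) => v.
  by rewrite actM // mulVmx ?U2_unit // act1.
have mulU U : U2 U -> forall f, spherical f -> spherical (fun v => Xf (act U v) * f v).
  move=> UU f hf; have VV := U2_inv UU.
  apply: spherical_ext (spherical_act UU (spherical_Xf (spherical_act VV hf))) => v.
  by rewrite actM // mulVmx ?U2_unit // act1.
have [N0 h0] := spherical_clear Wpsi; have [N1 h1] := clr _ (rot45_U2 R); have [N2 h2] := clr _ rot45i_U2.
exact: spherical_cover spherical_Xf (mulU _ (rot45_U2 R)) (mulU _ rot45i_U2) Xf_sum h0 h1 h2.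
Qed.

End KFiniteSphere.

(** * The principal series is spanned by the basis functions *)

Section SphericalModel.
Variable R : realType.
Local Notation C := R[i].
Local Notation Re := complex.Re.
Local Notation Im := complex.Im.
Local Notation M3 := 'M[C]_3.
Local Notation V2 := ('M[R]_3 * 'M[R]_3)%type.
Local Notation sphere := (sphere R).

(** Near the given time f along the curve is a local smooth extension composed with a differentiable
    curve in the real matrix space, so the chain rule applies. *)
Lemma smoothG_curve (f : funG R) (h : R -> M3) t : smoothG f -> (forall s, SU21 (h s)) ->
  (forall i j, exists d, cder (fun s => h s i j) t d) -> exists d, cder (fun s => f (h s)) t d.
Proof.
move=> fs hG hd; pose Q s : V2 := (\matrix_(i, j) Re (h s i j), \matrix_(i, j) Im (h s i j)).
have QE s : cmx (Q s) = h s.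
  by apply/matrixP => i j; rewrite !mxE; apply: complexP.
have Qd : differentiable Q t.
  apply: differentiable_pair; apply/derivable1_diffP/derivable_mxP => i j; have [d [d1 d2]] := hd i j.
    rewrite (_ : (fun _ => _) = (fun s => Re (h s i j))); first exact: (@ex_derive _ _ _ _ _ _ _ d1).
    by apply/funext => s; rewrite mxE.
  rewrite (_ : (fun _ => _) = (fun s => Im (h s i j))); first exact: (@ex_derive _ _ _ _ _ _ _ d2).
  by apply/funext => s; rewrite mxE.
have [U [F1 [F2 [Uo UQ F1s F2s FE]]]] := fs (Q t) (eq_ind_r (fun g => SU21 g) (hG t) (QE t)).
have nearU : \near t, U (Q t).
  exact: (differentiable_continuous Qd) (open_nbhs_nbhs (conj Uo UQ)).
have fE s : U (Q s) -> f (h s) = Complex (F1 (Q s)) (F2 (Q s)).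
  by move=> Us; rewrite -[h s]QE; apply: FE => //; rewrite QE.
have dRe : derivable (fun s => Re (f (h s))) t 1.
  apply/derivable1_diffP; apply: (near_eq_differentiable (F := F1 \o Q)).
    by apply: filterS nearU => s Us /=; rewrite fE.
  by apply: differentiable_comp => //; apply: (F1s 1%N).1.
have dIm : derivable (fun s => Im (f (h s))) t 1.
  apply/derivable1_diffP; apply: (near_eq_differentiable (F := F2 \o Q)).
    by apply: filterS nearU => s Us /=; rewrite fE.
  by apply: differentiable_comp => //; apply: (F2s 1%N).1.
exists (Complex ('D_1 (fun s => Re (f (h s))) t) ('D_1 (fun s => Im (f (h s))) t)).
by split; apply/derivableP.
Qed.

Lemma gSE (v : sphere) : (gS v 0 0 = val v 0 0) * (gS v 0 1 = - (val v 1 0)^*) * (gS v 0 2 = 0) *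
  (gS v 1 0 = val v 1 0) * (gS v 1 1 = (val v 0 0)^*) * (gS v 1 2 = 0) *
  (gS v 2 0 = 0) * (gS v 2 1 = 0) * (gS v 2 2 = 1).
Proof. by rewrite /gS !KembE Asu_det invr1 !mxE. Qed.

Lemma smooth_curves_gS (f : funG R) : smoothG f -> smooth_curves (fun v => f (gS v)).
Proof.
move=> fs gam gc t; apply: smoothG_curve => // [s|i j]; first exact: gS_SU21.
have [d0 h0] := gc t 0; have [d1 h1] := gc t 1.
elim/ord3P: i; elim/ord3P: j.
- by exists d0; apply: cder_ext h0 _ => s; rewrite gSE.
- by exists (-1 * d1^*); apply: cder_ext (cderZ (-1) (cder_conj h1)) _ => s; rewrite gSE mulN1r.
- by exists 0; apply: cder_ext (cder_cst 0 t) _ => s; rewrite gSE.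
- by exists d1; apply: cder_ext h1 _ => s; rewrite gSE.
- by exists d0^*; apply: cder_ext (cder_conj h0) _ => s; rewrite gSE.
- by exists 0; apply: cder_ext (cder_cst 0 t) _ => s; rewrite gSE.
- by exists 0; apply: cder_ext (cder_cst 0 t) _ => s; rewrite gSE.
- by exists 0; apply: cder_ext (cder_cst 0 t) _ => s; rewrite gSE.
- by exists 0; apply: cder_ext (cder_cst 1 t) _ => s; rewrite gSE.
Qed.

Variables A B : int.
Local Notation I := (princ (B - A) ((A + B)%:~R : C)).
Local Notation charz := (charz A B).
Local Notation Fall := (Fspan (R := R) A B (fun _ _ => True)).

Lemma charz_neq0 (z : C) : z != 0 -> charz z != 0.
Proof. by move=> z0; rewrite /charz mulf_neq0 // expfz_neq0 // conjC_eq0. Qed.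

(** Every point of the cone over the group is its third coordinate times a point over the sphere,
    and homogeneity gives the value there. *)
Lemma princ_gS_eq f h : I f -> I h -> (forall v, f (gS v) = h (gS v)) -> f = h.
Proof.
move=> fI hI fh; apply/funext => g.
have [gG|ngG] := pselect (SU21 g); last first.
  by have [-> // _ _ _] := fI; have [-> // _ _ _] := hI.
have z0 := pt_neq0 gG; set z := pt g 2 0 in z0.
have sphP (p q : C) : p * p^* + q * q^* = z * z^* ->
    sph (\col_i (if i == 0 then p / z else q / z)).
  move=> nl; apply/eqP; rewrite !mxE /= !rmorphM !fmorphV /=.
  rewrite (mulrACA p) (mulrACA q) -mulrDl nl -invfM mulfV //.
  by rewrite mulf_neq0 ?conjC_eq0.
have sv := sphP _ _ (pt_null gG).
pose v : sphere := Sub _ sv.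
have e : pt g = z *: pt (gS v).
  have s k : (z *: pt (gS v)) k 0 = z * pt (gS v) k 0 by rewrite mxE.
  apply: colP3; rewrite s pt_gS ?mulr1 //.
    by rewrite [val v 0 0]mxE /= mulrC divfK.
  by rewrite [val v 1 0]mxE /= mulrC divfK.
rewrite (princ_charz fI gG (gS_SU21 v) z0 e) (princ_charz hI gG (gS_SU21 v) z0 e).
by rewrite fh.
Qed.

Lemma cspan_range m (b : 'I_m -> funG R) f : cspan (range b) f ->
  exists c : 'I_m -> C, f = fun g => \sum_i c i * b i g.
Proof.
suff : cspan (range b) `<=` [set f | exists c : 'I_m -> C, f = fun g => \sum_i c i * b i g] by apply.
apply: cspan_min => [|_ [i _ <-]]; last first.
  exists (fun j => (j == i)%:R); apply/funext => g.
  by rewrite (bigD1 i) //= eqxx mul1r big1 ?addr0 // => j /negPf ->; rewrite mul0r.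
split; first by exists (fun=> 0); apply/funext => g; rewrite big1 // => j _; rewrite mul0r.
move=> c _ _ [c1 ->] [c2 ->]; exists (fun i => c * c1 i + c2 i); apply/funext => g.
by rewrite mulr_sumr -big_split; apply: eq_bigr => i _ /=; ring.
Qed.

Lemma princ_smooth_Kfin f : I f -> exists m (b : 'I_m -> sphere -> C), smooth_Kfin b (fun v => f (gS v)).
Proof.
move=> fI; have [_ fs [m [b bP]] _] := fI.
exists m, (fun i v => b i (gS v)); split; first exact: smooth_curves_gS.
move=> U UU; have [d [V [d0 VV e]]] := act_Kemb UU; have VI := U2_inv VV.
have KV : K (Kemb (invmx V)) by exists (invmx V).
have [c cE] := cspan_range (bP _ KV).
exists (fun i => (charz d)^-1 * c i) => v.
have -> : f (gS (act U v)) = (charz d)^-1 * Kact (Kemb (invmx V)) f (gS v).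
  rewrite /Kact Kemb_inv // invmxK.
  rewrite (princ_charz fI _ (gS_SU21 (act U v)) d0 (e v)) ?mulKf ?charz_neq0 //.
  by apply: SU21_mul; [exact: Kemb_SU21 | exact: gS_SU21].
by rewrite cE mulr_sumr; apply: eq_bigr => i _; rewrite mulrA.
Qed.

(** It makes the classification of label sets apply to every submodule of the principal series. *)
Theorem princE : I = Fall.
Proof.
apply/seteqP; split; last exact: Fspan_princ.
move=> f fI; have [m [b Wf]] := princ_smooth_Kfin fI; have [h hF hE] := smooth_Kfin_spherical A B Wf.
by rewrite (princ_gS_eq fI (Fspan_princ hF) hE).
Qed.

End SphericalModel.

(** * Matrix coefficients of U(2) *)

Section KTypes.
Variable R : realType.
Local Notation C := R[i].
Local Notation V := ('cV[C]_2).
Variables A B : int.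
Variables (a b : nat) (j n : rat).
Hypothesis hj : 2 * j = (a + b)%:R.
Hypothesis hn : 2 * (n + (B - A)%:~R) = 3 * (b%:R - a%:R).
Implicit Types (U : 'M[C]_2) (z : V).

Lemma dimpiE : dimpi j = (a + b).+1.
Proof. by rewrite /dimpi hj natrK. Qed.

Let m2 : rat := (n + (B - A)%:~R) / 3.
Let hj' : j = (a + b)%:R / 2. Proof. by rewrite -hj mulrC mulKf. Qed.
Let hn' : n + (B - A)%:~R = 3 * (b%:R - a%:R) / 2. Proof. by rewrite -hn mulrC mulKf. Qed.

Definition snorm (i : nat) : C := sqrtC ((a + b - i)`! * i`!)%:R.
Definition snorm2 : C := sqrtC (a`! * b`!)%:R.

Lemma snorm_neq0 i : snorm i != 0.
Proof. by rewrite sqrtC_eq0 pnatr_eq0 -lt0n muln_gt0 !fact_gt0. Qed.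

Lemma snorm2_neq0 : snorm2 != 0.
Proof. by rewrite sqrtC_eq0 pnatr_eq0 -lt0n muln_gt0 !fact_gt0. Qed.

Lemma snorm_conj i : (snorm i)^* = snorm i.
Proof. by rewrite conj_Creal // ger0_real // sqrtC_ge0 ler0n. Qed.

Lemma snorm2_conj : snorm2^* = snorm2.
Proof. by rewrite conj_Creal // ger0_real // sqrtC_ge0 ler0n. Qed.

Lemma vpol_wt (i : 'I_(dimpi j)) z :
  vpol j (wt i) z = z 0 0 ^+ (a + b - i) * z 1 0 ^+ i / snorm i.
Proof.
have ile : (i <= a + b)%N by have := ltn_ord i; rewrite {2}dimpiE ltnS.
have e1 : j - wt i = (a + b - i)%:R by rewrite /wt natrB // -hj; ring.
have e2 : j + wt i = i%:R by rewrite /wt; ring.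
by rewrite /vpol e1 e2 !natrK.
Qed.

(** The hypotheses on j and n amount to j = (a + b)/2 and m2 = (b - a)/2, so j - m2 = a and j + m2 =
    b. *)
Lemma vpol_m2 z : vpol j m2 z = z 0 0 ^+ a * z 1 0 ^+ b / snorm2.
Proof.
have e1 : j - m2 = a%:R by rewrite /m2 hn' hj' natrD; field.
have e2 : j + m2 = b%:R by rewrite /m2 hn' hj' natrD; field.
by rewrite /vpol e1 e2 !natrK.
Qed.

Lemma poly_fun_inj (p q : {poly C}) : (forall x, p.[x] = q.[x]) -> p = q.
Proof.
move=> pq; apply/eqP; rewrite -subr_eq0; apply/eqP.
apply: (@roots_geq_poly_eq0 _ _ [seq i%:R | i <- iota 0 (size (p - q))]).
- by apply/allP => x _; rewrite rootE hornerD hornerN pq subrr.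
- by rewrite map_inj_uniq ?iota_uniq // => i k /eqP; rewrite eqr_nat => /eqP.
- by rewrite size_map size_iota.
Qed.

(** [vcoord] chooses some coordinates; they are unique because setting z = (1, x) turns the
    expansion into a polynomial in x, whose values determine its coefficients. *)
Lemma vcoordE (c : 'rV[C]_(dimpi j)) : vcoord j (fun z => \sum_i c 0 i * vpol j (wt i) z) = c.
Proof.
rewrite /vcoord; case: xgetP => [c' _ /= e | /(_ c)]; last by case.
pose p (d : 'rV[C]_(dimpi j)) : {poly C} := \sum_i (d 0 i / snorm i) *: 'X^i.
have pE d x : (p d).[x] = \sum_i d 0 i * vpol j (wt i) (\col_k (if k == 0 then 1 else x)).
  rewrite /p horner_sum; apply: eq_bigr => i _.
  by rewrite vpol_wt !mxE /= expr1n mul1r hornerZ hornerXn; ring.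
have pc d (i : 'I_(dimpi j)) : (p d)`_i = d 0 i / snorm i.
  rewrite /p coef_sum (bigD1 i) //= coefZ coefXn eqxx mulr1 big1 ?addr0 // => k ki.
  by rewrite coefZ coefXn (_ : (i == k :> nat) = false) ?mulr0 //; apply/negbTE; rewrite eq_sym.
have pp : p c' = p c by apply: poly_fun_inj => x; rewrite !pE; exact: (congr1 (fun f => f _) (esym e)).
apply/rowP => i; have := congr1 (fun p : {poly C} => p`_i) pp; rewrite !pc.
by apply: divIf; exact: snorm_neq0.
Qed.

Lemma hprod_vpol (i : 'I_(dimpi j)) (h : V -> C) : hprod j (vpol j (wt i)) h = (vcoord j h 0 i)^*.
Proof.
have e : vpol (R := R) j (wt i) = fun z => \sum_k (delta_mx 0 i : 'rV[C]_(dimpi j)) 0 k * vpol j (wt k) z.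
  apply/funext => z; rewrite (bigD1 i) //= !mxE !eqxx mul1r big1 ?addr0 // => k ki.
  by rewrite !mxE (negPf ki) andbF mul0r.
rewrite /hprod {1}e vcoordE (bigD1 i) //= !mxE !eqxx mul1r big1 ?addr0 // => k ki.
by rewrite !mxE (negPf ki) andbF mul0r.
Qed.

Lemma sum_dimpi (G : nat -> C) : \sum_(i < dimpi j) G i = \sum_(i < (a + b).+1) G i.
Proof. by rewrite -!(big_mkord xpredT) dimpiE. Qed.

(** The integer j + n, the exponent of the determinant in pi_(j,n). *)
Let N : int := 2 * b%:Z - a%:Z - (B - A).

Definition pU U : {poly C} := ((U 0 0)%:P + (U 1 0)%:P * 'X) ^+ a * ((U 0 1)%:P + (U 1 1)%:P * 'X) ^+ b.

Lemma pirep_vcoord U (i : 'I_(dimpi j)) : U2 U ->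
  vcoord j (pirep j n U (vpol j m2)) 0 i = (\det U ^ N) * (pU (map_mx Num.conj U))`_i * (snorm i / snorm2).
Proof.
move=> UU; pose c : 'rV[C]_(dimpi j) := \row_i ((\det U ^ N) * (pU (map_mx Num.conj U))`_i * (snorm i / snorm2)).
have -> : pirep j n U (vpol j m2) = fun z => \sum_i c 0 i * vpol j (wt i) z.
  apply/funext => z; rewrite /pirep vpol_m2.
  have -> : Num.floor (j + n) = N.
    rewrite (_ : j + n = N%:~R) ?intrKfloor // /N.
    have -> : n = 3 * (b%:R - a%:R) / 2 - (B - A)%:~R by rewrite -hn' addrK.
    by rewrite hj' !rmorphB /= intrM natrD; field.
  pose G (i : nat) : C := (\det U ^ N) / snorm2 * ((pU (map_mx Num.conj U))`_i *
      z 0 0 ^+ (a + b - i) * z 1 0 ^+ i).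
  transitivity (\sum_(i < dimpi j) G i); last first.
    apply: eq_bigr => k _; rewrite vpol_wt mxE /G.
    by have s0 := snorm_neq0 k; have t0 := snorm2_neq0; field; rewrite s0 t0.
  rewrite sum_dimpi /G -mulr_sumr (U2_invE UU) !mulmx_entry !sum2 !adjmxE.
  have := homog_MM (idfun : {rmorphism C -> C}) (z 0 0) (z 1 0) (U 0 0)^* (U 1 0)^* (U 0 1)^* (U 1 1)^* a b.
  rewrite /homog /= => ->; rewrite /pU !mxE; ring.
by rewrite vcoordE mxE.
Qed.

(** The inverse of U brings in conj U, and the conjugate-linear slot of the inner product removes it
    again. The second column of U is det U times (- conj U_10, conj U_00), so the product of column
    forms is (det U)^b times [MM], and the powers of the determinant match the radial factor. *)
Lemma Wfun_F U (i : 'I_(dimpi j)) : U2 U ->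
  Wfun j n (wt i) m2 U = snorm i / snorm2 * F A B a b i (Kemb U).
Proof.
move=> UU; rewrite /Wfun hprod_vpol pirep_vcoord // F_in; last exact: Kemb_SU21.
have [_ e1 e2 dd] := U2_eqs UU; have d0 := U2_det_neq0 UU.
have dV : (\det U)^* = (\det U)^-1 by apply: (mulfI d0); rewrite dd mulfV.
have conjz (w : C) (m : int) : (w ^ m)^* = (w^*) ^ m.
  case: m => m; first by rewrite -!exprnP rmorphXn.
  by rewrite NegzE -!exprnN fmorphV rmorphXn.
have pE : ((pU (map_mx Num.conj U))`_i)^* = (pU U)`_i.
  rewrite -coef_map /pU rmorphM !rmorphXn !rmorphD !rmorphM /= !map_polyC map_polyX /= !mxE.
  by rewrite !conjCK.
have MME : pU U = (\det U ^+ b)%:P * MM a b (pt (Kemb U)).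
  rewrite /pU /MM alE be_conj !pt_Kemb -e1 -[U 0 1]opprK -e2 rmorphXn /= mulrCA -exprMn.
  by congr (_ * _ ^+ _); rewrite !polyCN !polyCM; ring.
rewrite !rmorphM fmorphV /= snorm_conj snorm2_conj pE MME /Hp !coefCM conjz dV /radH !pt_Kemb.
have -> : ((\det U)^-1)^* = \det U by rewrite -dV conjCK.
have -> : (\det U)^-1 ^ Pexp B a * \det U ^ Qexp A b = (\det U)^-1 ^ N * \det U ^+ b.
  rewrite exprnP !exprz_inv -!expfzDr //; congr (_ ^ _); rewrite /Pexp /Qexp /N; lia.
move: (snorm i / snorm2) ((\det U)^-1 ^ N) (\det U ^+ b) (MM a b (pt (Kemb U)))`_i => w x y q; ring.
Qed.

End KTypes.

(** * Composition series *)

Section Submodules.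
Variable R : realType.
Local Notation C := R[i].
Variables A B : int.
Local Notation F := (F (R := R) A B).
Local Notation Fspan := (Fspan (R := R) A B).
Local Notation Fall := (Fspan (fun _ _ => True)).
Local Notation tau := (tau (B - A) ((A + B)%:~R : C)).
Local Notation ktypes := (ktypes (B - A) ((A + B)%:~R : C)).
Local Notation submodule := (submodule (B - A) ((A + B)%:~R : C)).
Local Notation irreducible := (irreducible (B - A) ((A + B)%:~R : C)).
Local Notation has_Ktypes := (has_Ktypes (B - A) ((A + B)%:~R : C)).
Local Notation dsum_quo := (dsum_quo (B - A) ((A + B)%:~R : C)).
Local Notation closed := (arrow_closed A B).
Implicit Types (S T : nat -> nat -> Prop).

Lemma Fspan_eqP a b f : Fspan (fun a' b' => a' = a /\ b' = b) f ->
  exists c : nat -> C, f = fun g => \sum_(i < (a + b).+1) c i * F a b i g.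
Proof.
suff : Fspan (fun a' b' => a' = a /\ b' = b) `<=`
    [set f | exists c : nat -> C, f = fun g => \sum_(i < (a + b).+1) c i * F a b i g] by apply.
apply: cspan_min.
  split; first by exists (fun=> 0); apply/funext => g; rewrite big1 // => i _; rewrite mul0r.
  move=> c _ _ [c1 ->] [c2 ->]; exists (fun i => c * c1 i + c2 i); apply/funext => g.
  by rewrite mulr_sumr -big_split; apply: eq_bigr => i _ /=; ring.
move=> _ [_ [_ [n [[-> ->] ->]]]]; have [nk|kn] := leqP n (a + b).
  exists (fun i => (i == n)%:R); apply/funext => g.
  rewrite (bigD1 (Ordinal (nk : (n < (a + b).+1)%N))) //= eqxx mul1r big1 ?addr0 // => i ni.
  by rewrite (_ : (i == n :> nat) = false) ?mul0r //; apply/negbTE.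
exists (fun=> 0); rewrite F_over //; apply/funext => g.
by rewrite big1 // => i _; rewrite mul0r.
Qed.

(** Matrix coefficients are nonzero multiples of the basis functions on K, and an element of the
    principal series is determined by its values on the section [gS], which lies in K. *)
Lemma tau_Fspan a b (j n : rat) : 2 * j = (a + b)%:R ->
  2 * (n + (B - A)%:~R) = 3 * (b%:R - a%:R) ->
  tau j n = Fspan (fun a' b' => a' = a /\ b' = b).
Proof.
move=> hj hn; apply/seteqP; split => f.
  move=> [fI [c cE]].
  pose h : funG R := fun g => \sum_i (c i * (snorm R a b i / snorm2 R a b)) * F a b i g.
  have hF : Fspan (fun a' b' => a' = a /\ b' = b) h.
    by apply: linset_sum; [exact: Fspan_lin | move=> i; exact: F_span].
  rewrite (princ_gS_eq fI (Fspan_princ hF)) // => v.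
  rewrite /gS cE; last exact: Asu_U2.
  by apply: eq_bigr => i _; rewrite (Wfun_F hj hn) ?mulrA //; exact: Asu_U2.
move=> fF; split; first exact: Fspan_princ fF.
have [c ->] := Fspan_eqP fF.
exists (fun i => c i * (snorm2 R a b / snorm R a b i)) => U UU.
rewrite -(sum_dimpi hj (fun i => c i * F a b i (Kemb U))).
apply: eq_bigr => i _; rewrite (Wfun_F hj hn) //.
have s0 := snorm_neq0 R a b i; have t0 := snorm2_neq0 R a b.
by move: (F a b i (Kemb U)) => x; field; rewrite s0 t0.
Qed.

Lemma inLP k l : inL k l -> exists a b : nat, k = a%:Z + b%:Z /\ l = b%:Z - a%:Z.
Proof.
move=> [k0 kl lk e]; exists `|((k - l) %/ 2)%Z|%N, `|((k + l) %/ 2)%Z|%N; lia.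
Qed.

Lemma inL_label (a b : nat) : inL (a%:Z + b%:Z) (b%:Z - a%:Z).
Proof. by split; lia. Qed.

Lemma tau_label a b :
  tau ((a%:Z + b%:Z)%:Q / 2) (- (B - A)%:Q + 3 * (b%:Z - a%:Z)%:Q / 2) =
  Fspan (fun a' b' => a' = a /\ b' = b).
Proof.
by apply: tau_Fspan; rewrite !(intrD, intrN) -!pmulrn ?natrD; field.
Qed.

Lemma ktypes_Fspan (P : int -> int -> bool) :
  ktypes P = Fspan (fun a b => P (a%:Z + b%:Z) (b%:Z - a%:Z)).
Proof.
apply/seteqP; split; apply: cspan_min; try exact: cspan_lin.
  move=> f [k [l [/inLP[a [b [-> ->]]] Pkl]]]; rewrite tau_label.
  by apply: FspanS => _ _ [-> ->].
move=> f [a [b [n [Pab ->]]]]; apply: cspan_incl.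
exists (a%:Z + b%:Z), (b%:Z - a%:Z); split => //; first exact: inL_label.
by rewrite tau_label; exact: F_span.
Qed.

Lemma submodule_Fspan S : closed S -> submodule (Fspan S).
Proof.
move=> Sc; split; first exact: Fspan_princ.
- exact: (@Fspan_lin R A B S).1.
- exact: (@Fspan_lin R A B S).2.
- by move=> X f; exact: Fspan_lieact.
- by move=> k f; exact: Fspan_Kact.
Qed.

Lemma submodule_gmod V : submodule V -> gmod A B V.
Proof. by rewrite /gmod -princE => -[VI V0 VD VX _]. Qed.

(** Induction on the distance; the two negated conditions say that no wall lies across the path in
    the direction of travel. *)
Lemma reach_a U a0 a b : closed U -> U a0 b ->
  ~ (a0%:Z < - B /\ - B <= a%:Z) -> ~ (a%:Z < A /\ A <= a0%:Z) -> U a b.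
Proof.
move=> [dn up _ _] U0; have [le|/ltnW le] := leqP a0 a => h1 h2.
  suff : forall d, (d <= a - a0)%N -> U (a0 + d)%N b by move=> /(_ _ (leqnn _)); rewrite subnKC.
  elim=> [|d IH] hd; first by rewrite addn0.
  by rewrite addnS; apply: up; [apply: IH; lia | lia].
suff : forall d, (d <= a0 - a)%N -> U (a0 - d)%N b by move=> /(_ _ (leqnn _)); rewrite subKn.
elim=> [|d IH] hd; first by rewrite subn0.
apply: dn; last by lia.
by rewrite (_ : (a0 - d.+1).+1 = a0 - d)%N; [apply: IH; lia | lia].
Qed.

Lemma reach_b U a b0 b : closed U -> U a b0 ->
  ~ (b0%:Z < - A /\ - A <= b%:Z) -> ~ (b%:Z < B /\ B <= b0%:Z) -> U a b.
Proof.
move=> [_ _ dn up] U0; have [le|/ltnW le] := leqP b0 b => h1 h2.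
  suff : forall d, (d <= b - b0)%N -> U a (b0 + d)%N by move=> /(_ _ (leqnn _)); rewrite subnKC.
  elim=> [|d IH] hd; first by rewrite addn0.
  by rewrite addnS; apply: up; [apply: IH; lia | lia].
suff : forall d, (d <= b0 - b)%N -> U a (b0 - d)%N by move=> /(_ _ (leqnn _)); rewrite subKn.
elim=> [|d IH] hd; first by rewrite subn0.
apply: dn; last by lia.
by rewrite (_ : (b0 - d.+1).+1 = b0 - d)%N; [apply: IH; lia | lia].
Qed.

(* The wall [-B] blocks raising the first index and [A] blocks lowering it;
   similarly [-A] and [B] for the second index. *)
Definition linked (a0 b0 a b : nat) := [/\
  ~ (a0%:Z < - B /\ - B <= a%:Z), ~ (a%:Z < A /\ A <= a0%:Z),
  ~ (b0%:Z < - A /\ - A <= b%:Z) & ~ (b%:Z < B /\ B <= b0%:Z)].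

Lemma reach U a0 b0 a b : closed U -> U a0 b0 -> linked a0 b0 a b -> U a b.
Proof. by move=> Uc U0 [h1 h2 h3 h4]; apply: (reach_b Uc) h3 h4; apply: (reach_a Uc U0). Qed.

(** An intermediate submodule is the span of a closed set between T and S. If it has a label outside
    T, linkage propagates that label to all of S minus T; otherwise it equals T. *)
Lemma irreducible_Fspan S T : closed S -> closed T -> (forall a b, T a b -> S a b) ->
  (exists a b, S a b /\ ~ T a b) ->
  (forall a0 b0 a b, S a0 b0 -> ~ T a0 b0 -> S a b -> ~ T a b -> linked a0 b0 a b) ->
  irreducible (Fspan S) (Fspan T).
Proof.
move=> Sc Tc TS [a1 [b1 [Sab nTab]]] conn; split.
- by split; [exact: submodule_Fspan | exact: submodule_Fspan | exact: FspanS].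
- by move=> e; apply: nTab; apply: (@Fspan_sub R A B S) => //; rewrite e.
move=> V /submodule_gmod Vg; rewrite (gmod_Fspan Vg).
have := gmod_arrow Vg; move: (fun a b => V (F a b 0)) => U Uc TU US.
have {}TU := Fspan_sub TU; have {}US := Fspan_sub US.
have [[a0 [b0 [Uab nT]]]|nex] := pselect (exists a b, U a b /\ ~ T a b).
  right; apply: eq_Fspan => a b; split; first exact: US.
  move=> Sab'; have [Tab|nTab'] := pselect (T a b); first exact: TU.
  by apply: (reach Uc Uab); apply: conn => //; exact: US.
left; apply: eq_Fspan => a b; split => [Uab|]; last exact: TU.
by apply: contrapT => nTab'; apply: nex; exists a, b.
Qed.

Lemma Ug_gmod (X : set (funG R)) : X `<=` Fall -> gmod A B (Ug X).
Proof.
move=> XF.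
have foldF s h : (forall Y, Y \in s -> su21 Y) -> X h -> Fall (foldr (@lieact R) h s).
  elim: s => [|Y s IH] sP Xh /=; first exact: XF.
  apply: Fspan_lieact => //; first by apply: sP; rewrite mem_head.
  by apply: IH => // Z Zs; apply: sP; rewrite inE Zs orbT.
have UF : Ug X `<=` Fall.
  apply: cspan_min; first exact: Fspan_lin.
  by move=> _ [s [h [sP Xh ->]]]; exact: foldF.
split=> [//||Y f Ys]; first exact: cspan_lin.
suff : Ug X `<=` [set f | Ug X f /\ Ug X (lieact Y f)] by move=> H /H[].
apply: cspan_min.
  split; first by rewrite /= lieact0; split; exact: (cspan_lin _).1.
  move=> c h h' [h1 h2] [h3 h4]; split; first exact: (cspan_lin _).2.
  rewrite lieactD //; [exact: (cspan_lin _).2|exact: Fspan_Ldiff (UF _ h1)|exact: Fspan_Ldiff (UF _ h3)].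
move=> _ [s [h [sP Xh ->]]]; split; first by apply: cspan_incl; exists s, h.
apply: cspan_incl; exists (Y :: s), h; split => // Z; rewrite inE => /orP[/eqP -> //|].
exact: sP.
Qed.

(** The generating label is given by integers because it is built from 0, A, B and their opposites,
    whose signs are known in each case. *)
Lemma Ug_tau S (p q : int) (j n : rat) : 0 <= p -> 0 <= q ->
  2 * j = (p + q)%:~R -> 2 * (n + (B - A)%:~R) = 3 * (q - p)%:~R ->
  closed S -> S `|p|%N `|q|%N -> (forall a b, S a b -> linked `|p|%N `|q|%N a b) ->
  Ug (tau j n) = Fspan S.
Proof.
case: p q => // p [] // q _ _ hj hn Sc Spq gen.
rewrite (@tau_Fspan p q) //; last by rewrite hn intrB.
have Xg := @Ug_gmod _ (@FspanS R A B (fun a' b' => a' = p /\ b' = q) _ (fun _ _ _ => Logic.I)).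
apply/seteqP; split.
  apply: cspan_min; first exact: Fspan_lin.
  move=> _ [s [h [sP Xh ->]]]; elim: s sP => [|Y s IH] sP /=.
    by move: Xh; apply: FspanS => _ _ [-> ->].
  apply: Fspan_lieact => //; first by apply: sP; rewrite mem_head.
  by apply: IH => // Z Zs; apply: sP; rewrite inE Zs orbT.
rewrite (gmod_Fspan Xg); apply: FspanS => a b Sab.
apply: (reach (gmod_arrow Xg) _ (gen a b Sab)).
by apply: cspan_incl; exists [::], (F p q 0); split => //; exact: F_span.
Qed.

Lemma has_Ktypes_Fspan S T (P : int -> int -> bool) : closed S -> closed T ->
  (forall a b, S a b <-> T a b \/ P (a%:Z + b%:Z) (b%:Z - a%:Z)) ->
  (forall a b, T a b -> P (a%:Z + b%:Z) (b%:Z - a%:Z) -> False) ->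
  has_Ktypes (Fspan S) (Fspan T) P.
Proof.
move=> Sc Tc STP TP; set Pn := fun a b : nat => P (a%:Z + b%:Z) (b%:Z - a%:Z) : Prop.
have TL := @Fspan_lin R A B T.
have T0 f : Fspan T (fun g => f g - f g).
  by rewrite (_ : (fun g => _) = fun=> 0); [exact: TL.1 | apply/funext => g; rewrite subrr].
have PnS : Fspan Pn `<=` Fspan S by apply: FspanS => a b h; apply/STP; right.
have dec f : Fspan S f -> exists2 h, Fspan Pn h & Fspan T (fun g => f g - h g).
  rewrite (eq_Fspan R A B STP) -Fspan_cup => -[t [p [Tt Pp ->]]]; exists p => //.
  by rewrite (_ : (fun g => _) = t) //; apply/funext => g; rewrite addrK.
rewrite /has_Ktypes ktypes_Fspan; split => //.
- by split; [exact: submodule_Fspan | exact: submodule_Fspan | apply: FspanS => a b h; apply/STP; left].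
(* The span of the types in P is a complement of the span of T, so the inclusion induces the
   isomorphism with the quotient. *)
exists id; split => //.
- move=> f Pf; split=> [Tf|->]; last exact: TL.1.
  have : (Fspan T `&` Fspan Pn) f by [].
  rewrite Fspan_cap (@eq_Fspan R A B _ (fun _ _ => False)) ?Fspan0 //.
  by move=> a b; split => // -[]; exact: TP.
- move=> h /dec[p Pp pT]; exists p => //.
  have := linsetZ (-1) TL pT; congr (Fspan T _); apply/funext => g; by rewrite mulN1r opprB.
Qed.

Lemma dsum_quo_Fspan S T S1 S2 : closed S -> closed T -> closed S1 -> closed S2 ->
  (forall a b, S1 a b /\ S2 a b <-> T a b) -> (forall a b, S1 a b \/ S2 a b <-> S a b) ->
  dsum_quo (Fspan S) (Fspan T) (Fspan S1) (Fspan S2).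
Proof.
move=> Sc Tc S1c S2c cap cup; split; last 2 first.
- by rewrite Fspan_cap; exact: eq_Fspan.
- by rewrite Fspan_cup; exact: eq_Fspan.
- split; try exact: submodule_Fspan; apply: FspanS => a b /cap[h _]; apply/cup; by left.
- split; try exact: submodule_Fspan; apply: FspanS => a b /cap[h _]; by [].
- split; try exact: submodule_Fspan; apply: FspanS => a b /cap[_ h]; by [].
Qed.

End Submodules.

(** * The six cases as integer arithmetic on labels *)

Ltac closed_tac := by split => a b /=; lia.
(** The arguments are a label of the subquotient, showing that it is nonzero. *)
Ltac irr_tac x y := apply: irreducible_Fspan;
  [closed_tac | closed_tac | by move=> *; lia | by exists x, y; lia |
   by move=> *; split; lia].
(** The arguments are the label (a, b) of the generating K-type. *)
Ltac ug_tac p q := apply: (@Ug_tau _ _ _ _ p q);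
  [lia | lia | by rewrite !(intrD, intrN); field | by rewrite !(intrD, intrN); field |
   closed_tac | by lia | by move=> *; split; lia].
Ltac types_tac := by rewrite ktypes_Fspan; apply: eq_Fspan => a b; lia.
Ltac sub_tac := by apply: submodule_Fspan; closed_tac.
Ltac has_tac := apply: has_Ktypes_Fspan; [closed_tac | closed_tac | by move=> *; lia | by move=> *; lia].
Ltac dsum_tac := apply: dsum_quo_Fspan;
  [closed_tac | closed_tac | closed_tac | closed_tac | by move=> *; lia | by move=> *; lia].

Theorem mainTheorem3 (R : realType) (delta lam : int)
    (hp : (2 %| lam + delta)%Z) (hm : (2 %| lam - delta)%Z)
    (hp0 : lam + delta != 0) (hm0 : lam - delta != 0) :
  let lambda : R[i] := lam%:~R in
  let I := princ delta lambda in
  let tau := tau delta lambda in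
  let types := ktypes delta lambda in
  let submodule := submodule delta lambda in
  let irr := irreducible delta lambda in
  let has_types := has_Ktypes delta lambda in
  let dsum := dsum_quo delta lambda in
  let O := @zeroF R in
  let d := delta%:Q in
  let x := lam%:Q in
  [/\
  (* I1 *)
  2 <= lam - delta -> 2 <= lam + delta ->
  exists VH V1 Qm Qp : set (funG R),
  [/\ [/\ submodule VH, submodule V1, VH `<=` V1 & submodule I],
      [/\ VH = Ug (tau (x / 2) (d / 2)),
          VH = types (fun k l =>
                 (lam - delta <= k - l) && (lam + delta <= k + l)) &
          V1 = sumF (Ug (tau ((x + d) / 4) ((3 * x - d) / 4)))
                    (Ug (tau ((x - d) / 4) ((- 3 * x - d) / 4)))],
      dsum V1 VH Qm Qp,
      [/\ has_types Qp VH (fun k l =>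
            (k - l < lam - delta) && (lam + delta <= k + l)),
          has_types Qm VH (fun k l =>
            (k + l < lam + delta) && (lam - delta <= k - l)) &
          has_types I V1 (fun k l =>
            (k + l < lam + delta) && (k - l < lam - delta))] &
      [/\ irr VH O, irr Qp VH, irr Qm VH & irr I V1]],
  (* II1 *)
  0 < lam -> lam - delta <= - 2 ->
  exists VH Vd : set (funG R),
  [/\ [/\ submodule VH, submodule Vd & submodule I],
      [/\ VH = Ug (tau ((x + d) / 4) ((3 * x - d) / 4)),
          VH = types (fun k l => lam + delta <= k + l),
          Vd = Ug (tau 0 (- d)) &
          Vd = types (fun k l => k + l < - lam + delta)],
      VH `&` Vd = O,
      has_types I (sumF VH Vd) (fun k l =>
        (- lam + delta <= k + l) && (k + l < lam + delta)) &
      [/\ irr VH O, irr Vd O & irr I (sumF VH Vd)]],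
  (* II2 *)
  lam < 0 -> 2 <= lam + delta ->
  exists Qm VH Vd : set (funG R),
  [/\ submodule Qm /\ submodule I,
      Qm = Ug (tau ((x + d) / 4) ((3 * x - d) / 4)) /\
      Qm = types (fun k l => (lam + delta <= k + l) && (k + l < - lam + delta)),
      dsum I Qm VH Vd,
      has_types VH Qm (fun k l => - lam + delta <= k + l) /\
      has_types Vd Qm (fun k l => k + l < lam + delta) &
      [/\ irr Qm O, irr VH Qm & irr Vd Qm]] &
  [/\
  (* I2 *)
  lam - delta <= - 2 -> lam + delta <= - 2 ->
  exists Vfin V1 Qm Qp : set (funG R),
  [/\ [/\ submodule Vfin, submodule V1, Vfin `<=` V1 & submodule I],
      [/\ Vfin = Ug (tau 0 (- d)),
          Vfin = types (fun k l =>
                   (k + l < - lam + delta) && (k - l < - lam - delta)) &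
          V1 = sumF (Ug (tau ((- x + d) / 4) ((- 3 * x - d) / 4)))
                    (Ug (tau ((- x - d) / 4) ((3 * x - d) / 4)))],
      dsum V1 Vfin Qm Qp,
      [/\ has_types Qp Vfin (fun k l =>
            (k - l < - lam - delta) && (- lam + delta <= k + l)),
          has_types Qm Vfin (fun k l =>
            (k + l < - lam + delta) && (- lam - delta <= k - l)) &
          has_types I V1 (fun k l =>
            (- lam + delta <= k + l) && (- lam - delta <= k - l))] &
      [/\ irr Vfin O, irr Qp Vfin, irr Qm Vfin & irr I V1]],
  (* III1 *)
  0 < lam -> lam + delta <= - 2 ->
  exists Vd VH : set (funG R),
  [/\ [/\ submodule Vd, submodule VH & submodule I],
      [/\ Vd = Ug (tau 0 (- d)),
          Vd = types (fun k l => k - l < - lam - delta),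
          VH = Ug (tau ((x - d) / 4) ((- 3 * x - d) / 4)) &
          VH = types (fun k l => lam - delta <= k - l)],
      VH `&` Vd = O,
      has_types I (sumF VH Vd) (fun k l =>
        (- lam - delta <= k - l) && (k - l < lam - delta)) &
      [/\ irr Vd O, irr VH O & irr I (sumF VH Vd)]] &
  (* III2 *)
  lam < 0 -> 2 <= lam - delta ->
  exists Qp VH Vd : set (funG R),
  [/\ submodule Qp /\ submodule I,
      Qp = Ug (tau ((x - d) / 4) ((- 3 * x - d) / 4)) /\
      Qp = types (fun k l => (lam - delta <= k - l) && (k - l < - lam - delta)),
      dsum I Qp VH Vd,
      has_types VH Qp (fun k l => - lam - delta <= k - l) /\
      has_types Vd Qp (fun k l => k - l < lam - delta) &
      [/\ irr Qp O, irr VH Qp & irr Vd Qp]]]].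
Proof.
(* Since k - l = 2a and k + l = 2b, the thresholds lam - delta = 2A and lam + delta = 2B become
   bounds of a by A and of b by B. *)
have [A [B [lamE deltaE]]] : exists A B : int, lam = A + B /\ delta = B - A.
  by exists ((lam - delta) %/ 2)%Z, ((lam + delta) %/ 2)%Z; lia.
(* The zero submodule is the span of the empty set of labels, so that every claim concerns spans of
   label sets. *)
subst lam delta; rewrite /= princE -(Fspan0 R A B).
split.
- move=> h1 h2.
  (* Here A and B are positive: raising is never blocked, and only the descents below A and below B
     are. *)
  exists (Fspan A B (fun a b => (A <= a%:Z) && (B <= b%:Z))),
    (Fspan A B (fun a b => (A <= a%:Z) || (B <= b%:Z))),
    (Fspan A B (fun a b => (A <= a%:Z))), (Fspan A B (fun a b => (B <= b%:Z))).
  split.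
  + by split; try sub_tac; apply: FspanS => a b; lia.
  + split; [apply/esym; ug_tac A B | types_tac |].
    transitivity (sumF (Fspan (R := R) A B (fun a b => B <= b%:Z)) (Fspan A B (fun a b => A <= a%:Z))).
      by rewrite Fspan_cup; apply: eq_Fspan => a b; lia.
    by congr (sumF _ _); apply/esym; [ug_tac (0 : int) B | ug_tac A (0 : int)].
  + dsum_tac.
  + split; has_tac.
  + split; [irr_tac `|A|%N `|B|%N | irr_tac 0%N `|B|%N | irr_tac `|A|%N 0%N | irr_tac 0%N 0%N].
- move=> l0 h1.
  (* Here A < 0 < -A < B: only b meets walls, and the one-way walls -A (upwards) and B (downwards)
     make both outer regions submodules. *)
  exists (Fspan A B (fun a b => B <= b%:Z)), (Fspan A B (fun a b => b%:Z < - A)).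
  split.
  + split; sub_tac.
  + split; [apply/esym; ug_tac (0 : int) B | types_tac | apply/esym; ug_tac (0 : int) (0 : int) | types_tac].
  + by rewrite Fspan_cap; apply: eq_Fspan => a b; lia.
  + rewrite Fspan_cup; has_tac.
  + rewrite Fspan_cup; split; [irr_tac 0%N `|B|%N | irr_tac 0%N 0%N | irr_tac 0%N `|A|%N].
- move=> l0 h1.
  (* Here 0 < B < -A: the same two walls in the opposite order now confine the strip between
     them. *)
  exists (Fspan A B (fun a b => (B <= b%:Z) && (b%:Z < - A))), (Fspan A B (fun a b => B <= b%:Z)),
    (Fspan A B (fun a b => b%:Z < - A)).
  split.
  + split; sub_tac.
  + split; [apply/esym; ug_tac (0 : int) B | types_tac].
  + dsum_tac.
  + split; has_tac.
  + split; [irr_tac 0%N `|B|%N | irr_tac 0%N `|A|%N | irr_tac 0%N 0%N].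
- split.
  + move=> h1 h2.
    (* Here A and B are negative: lowering is never blocked, and only the ascents to -B in a and to
       -A in b are. *)
    exists (Fspan A B (fun a b => (b%:Z < - A) && (a%:Z < - B))),
      (Fspan A B (fun a b => (b%:Z < - A) || (a%:Z < - B))),
      (Fspan A B (fun a b => b%:Z < - A)), (Fspan A B (fun a b => a%:Z < - B)).
    split.
    * by split; try sub_tac; apply: FspanS => a b; lia.
    * split; [apply/esym; ug_tac (0 : int) (0 : int) | types_tac |].
      transitivity (sumF (Fspan (R := R) A B (fun a b => a%:Z < - B)) (Fspan A B (fun a b => b%:Z < - A))).
        by rewrite Fspan_cup; apply: eq_Fspan => a b; lia.
      by congr (sumF _ _); apply/esym; [ug_tac (0 : int) (- A) | ug_tac (- B) (0 : int)].
    * dsum_tac.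
    * split; has_tac.
    * split; [irr_tac 0%N 0%N | irr_tac 0%N `|A|%N | irr_tac `|B|%N 0%N | irr_tac `|B|%N `|A|%N].
  + move=> l0 h1.
    (* Here B < 0 < -B < A: the mirror image of the case with walls on b only, with the two indices
       exchanged. *)
    exists (Fspan A B (fun a b => a%:Z < - B)), (Fspan A B (fun a b => A <= a%:Z)).
    split.
    * split; sub_tac.
    * split; [apply/esym; ug_tac (0 : int) (0 : int) | types_tac | apply/esym; ug_tac A (0 : int) | types_tac].
    * by rewrite Fspan_cap; apply: eq_Fspan => a b; lia.
    * rewrite Fspan_cup; has_tac.
    * rewrite Fspan_cup; split; [irr_tac 0%N 0%N | irr_tac `|A|%N 0%N | irr_tac `|B|%N 0%N].
  + move=> l0 h1.
    (* Here 0 < A < -B, so the strip in a is confined from both sides. *)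
    exists (Fspan A B (fun a b => (A <= a%:Z) && (a%:Z < - B))), (Fspan A B (fun a b => A <= a%:Z)),
      (Fspan A B (fun a b => a%:Z < - B)).
    split.
    * split; sub_tac.
    * split; [apply/esym; ug_tac A (0 : int) | types_tac].
    * dsum_tac.
    * split; has_tac.
    * split; [irr_tac `|A|%N 0%N | irr_tac `|B|%N 0%N | irr_tac 0%N 0%N].
Qed.
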